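(* Plan Verification on primitive task networks is fixed-parameter tractable when parameterized by the vertex cover number of $G_\prec$, i.e., it can be solved in time $f(k)\cdot n^{O(1)}$ for some computable function $f$, where $k$ is the vertex cover number of $G_\prec$ and $n$ is the input size.
   Context: An HTN domain contains a finite set $F$ of propositions and a set $A$ of actions, each action $a$ having $\mathrm{pre}(a),\mathrm{del}(a),\mathrm{add}(a)\subseteq F$. Action $a$ is executable in state $s\subseteq F$ if $\mathrm{pre}(a)\subseteq s$, yielding $(s\setminus\mathrm{del}(a))\cup\mathrm{add}(a)$; a plan (action sequence) is executable in $s$ if its actions can be executed consecutively from $s$. A primitive task network is $(T,\prec^+,\alpha)$ with $T$ a finite set of tasks, $\prec^+$ a strict partial order on $T$ and $\alpha:T\to A$. A linearization is a total order $\bar t$ of $T$ extending $\prec^+$, with action sequence $\alpha(\bar t)$. $\prec$ denotes the cover relation of $\prec^+$ ($(a,b)\in\prec$ iff $a\prec^+ b$ and there is no $c$ with $a\prec^+c\prec^+b$), and $G_\prec$ is the undirected graph on $T$ with edges $\{a,b\}$ for $(a,b)\in\prec$. Plan Verification (primitive case): given a primitive network $tn$, an initial state $s_0\subseteq F$ and a plan $p$ over $A$, decide whether $tn$ has a linearization $\bar t$ with $\alpha(\bar t)=p$ and $p$ executable in $s_0$. *)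

(* Defs.v *)
From mathcomp Require Import all_boot.
Set Implicit Arguments. Unset Strict Implicit. Unset Printing Implicit Defensive.

(* 1. Machine model: deterministic single-tape Turing machines over   *)
(*    the tape alphabet {0,1,blank} (blank = None).                   *)

Definition sym := option bool.
Inductive move := MoveL | MoveR | Stay.

Record TM := {
  tm_states : nat;                       (* states are 0 .. tm_states-1; 0 is initial *)
  tm_delta  : nat -> sym -> nat * sym * move;
  tm_acc    : nat;
  tm_rej    : nat
}.

Definition wf_tm (M : TM) : Prop :=
  [/\ 0 < tm_states M, tm_acc M < tm_states M, tm_rej M < tm_states M
    & forall q s, q < tm_states M -> (tm_delta M q s).1.1 < tm_states M].

(* configuration: state, tape left of head (reversed), symbol under head,
   tape right of head; missing cells are blank *)
Record config := Config { c_state : nat; c_left : seq sym; c_head : sym; c_right : seq sym }.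

Definition halted (M : TM) (c : config) : bool :=
  (c_state c == tm_acc M) || (c_state c == tm_rej M).

Definition step (M : TM) (c : config) : config :=
  if halted M c then c else
  let: (q', w, mv) := tm_delta M (c_state c) (c_head c) in
  match mv with
  | Stay => Config q' (c_left c) w (c_right c)
  | MoveL => match c_left c with
             | [::] => Config q' [::] None (w :: c_right c)
             | x :: l => Config q' l x (w :: c_right c)
             end
  | MoveR => match c_right c with
             | [::] => Config q' (w :: c_left c) None [::]
             | x :: r => Config q' (w :: c_left c) x r
             end
  end.

Definition run (M : TM) (t : nat) (c : config) : config := iter t (step M) c.

Definition init_config (w : seq bool) : config :=
  match w with
  | [::] => Config 0 [::] None [::]
  | b :: w' => Config 0 [::] (Some b) (map Some w')
  end.

Fixpoint read_word (s : seq sym) : seq bool :=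
  match s with
  | Some b :: s' => b :: read_word s'
  | _ => [::]
  end.
Definition output (c : config) : seq bool := read_word (c_head c :: c_right c).

Fixpoint binf (fuel n : nat) : seq bool :=
  match fuel with
  | 0 => [::]
  | fuel'.+1 => if n is 0 then [::] else odd n :: binf fuel' n./2
  end.
Definition bin (n : nat) : seq bool := binf n n.

Definition computable (f : nat -> nat) : Prop :=
  exists M : TM, wf_tm M /\
    forall k, exists t, let c := run M t (init_config (bin k)) in
      c_state c = tm_acc M /\ output c = bin (f k).

Definition decides_within (M : TM) (w : seq bool) (t : nat) (P : Prop) : Prop :=
  let c := run M t (init_config w) in
  halted M c /\ (c_state c = tm_acc M <-> P).

(*    Propositions are 0..nF-1, actions are indexed by their position  *)
(*    in [acts], tasks are 0..m-1 with m = size alpha.                 *)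

Record instance := Instance {
  i_nF    : nat;                                    (* F = {0,..,nF-1} *)
  i_acts  : seq (seq nat * seq nat * seq nat);      (* (pre, del, add) *)
  i_alpha : seq nat;                                (* alpha(t) for task t *)
  i_ord   : seq (nat * nat);                        (* the strict partial order prec^+ *)
  i_s0    : seq nat;
  i_plan  : seq nat                                 (* the plan, as action indices *)
}.

Definition ntasks (I : instance) : nat := size (i_alpha I).
Definition prec (I : instance) (a b : nat) : bool := (a, b) \in i_ord I.

Definition valid (I : instance) : Prop :=
  [/\ all (fun x => let: (p, d, a) := x in
                    all (fun f => f < i_nF I) (p ++ d ++ a)) (i_acts I),
      all (fun a => a < size (i_acts I)) (i_alpha I),
      all (fun a => a < size (i_acts I)) (i_plan I),
      all (fun f => f < i_nF I) (i_s0 I) &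
      all (fun e => (e.1 < ntasks I) && (e.2 < ntasks I)) (i_ord I) /\
      ((forall a, ~~ prec I a a) /\
       (forall a b c, prec I a b -> prec I b c -> prec I a c))].

Definition act_of (I : instance) (a : nat) := nth ([::], [::], [::]) (i_acts I) a.

Fixpoint executable (I : instance) (s : pred nat) (p : seq nat) : bool :=
  match p with
  | [::] => true
  | a :: p' => let: (pre, del, add) := act_of I a in
               all s pre &&
               executable I (fun x => (x \in add) || (s x && (x \notin del))) p'
  end.

Definition linearization (I : instance) (ts : seq nat) : Prop :=
  perm_eq ts (iota 0 (ntasks I)) /\
  forall a b, prec I a b -> index a ts < index b ts.

Definition plan_verification (I : instance) : Prop :=
  exists ts, linearization I ts /\
    map (nth 0 (i_alpha I)) ts = i_plan I /\
    executable I (fun x => x \in i_s0 I) (i_plan I).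

Definition cover (I : instance) (a b : nat) : bool :=
  prec I a b && ~~ has (fun c => prec I a c && prec I c b) (iota 0 (ntasks I)).

Definition is_vertex_cover (I : instance) (C : {set 'I_(ntasks I)}) : bool :=
  [forall a : 'I_(ntasks I), forall b : 'I_(ntasks I),
     cover I a b ==> (a \in C) || (b \in C)].

Lemma vertex_cover_exists (I : instance) :
  exists k, [exists C : {set 'I_(ntasks I)}, (#|C| == k) && @is_vertex_cover I C].
Proof.
exists #|[set: 'I_(ntasks I)]|; apply/existsP; exists setT.
rewrite eqxx /=; apply/forallP => a; apply/forallP => b.
by rewrite !in_setT implybT.
Qed.

Definition vc_number (I : instance) : nat := ex_minn (vertex_cover_exists I).

(* 3. Binary encoding of instances (self-delimiting).                  *)
(*    Each bit b of a number is written as bb, a number ends with 01;  *)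
(*    in a list, each element is preceded by 10 and the list ends 01.  *)

Definition enc_nat (n : nat) : seq bool :=
  flatten [seq [:: b; b] | b <- bin n] ++ [:: false; true].
Definition enc_list (T : Type) (e : T -> seq bool) (s : seq T) : seq bool :=
  flatten [seq [:: true; false] ++ e x | x <- s] ++ [:: false; true].
Definition enc_pair (e : nat * nat) : seq bool := enc_nat e.1 ++ enc_nat e.2.
Definition enc_act (x : seq nat * seq nat * seq nat) : seq bool :=
  let: (p, d, a) := x in enc_list enc_nat p ++ enc_list enc_nat d ++ enc_list enc_nat a.

Definition enc (I : instance) : seq bool :=
  enc_nat (i_nF I) ++ enc_list enc_act (i_acts I) ++ enc_list enc_nat (i_alpha I)
  ++ enc_list enc_pair (i_ord I) ++ enc_list enc_nat (i_s0 I)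
  ++ enc_list enc_nat (i_plan I).

(* Main.v *)
(** The endpoints of a greedy maximal matching of the cover graph form a vertex cover [C]
    with at most [2k] elements.  Every binary relation on [C] is tried as a guess for the
    order in which a solution visits [C]; there are at most [2 ^ (4 k ^ 2)] of them.  Given
    the right guess, list scheduling is exact: at every position of the plan, among the
    available tasks carrying the required action, take one whose first successor in [C]
    comes earliest in the guessed order (a task of [C] counts as its own successor, and
    tasks of [C] wait for their guessed predecessors).  All cover successors of a task
    outside [C] lie in [C], so exchanging the chosen task with the one a solution has at
    this position gives again a solution.

    The running time is polynomial in [n + 2 ^ (4 k ^ 2)].  To see this on a single-tape
    machine, the tape is cut into blocks of constant width that carry several bit tracks and
    several marks, a mark being a register with a unary value.  Expressions with bounded
    sums over these registers have polynomial values whatever the tracks contain, so every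
    loop bounded by such expressions costs polynomial time. *)

From Stdlib Require Import ZArith Lia FunctionalExtensionality.
From mathcomp Require Import all_boot zify.
Require Import Defs.
Set Implicit Arguments. Unset Strict Implicit. Unset Printing Implicit Defensive.
Local Arguments Z.add : simpl never.
Local Arguments Z.sub : simpl never.
Local Arguments Z.of_nat : simpl never.

(** * Structured tape programs and their compilation *)

(** Why the exchange works: let a solution have [u] at the current position where [v] is chosen.
    Moving [v] forward is harmless, as its predecessors, by [prec] or by the guess, are already
    done. Moving [u] back endangers only tasks after [u]. If [u] were in [C], its deadline would be
    [u] itself, and [v], never placed after its own deadline, could not come later; so [u] is
    outside [C]. A path out of [u] then starts with a cover edge into [C], and [v] is placed no
    later than the first such task.

    The machine never learns the vertex cover number: it counts guesses from its own matching, and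
    the parameter only bounds this count. Unary values suit indices and the number of guesses, but
    not the names of propositions, which may be exponential in the input length; these are only
    compared bit by bit.

    The factor [f] must be output in binary by a Turing machine. The expansion of a power of two is
    a run of zeros closed by a one, so it suffices to mark off a tape segment as long as the
    exponent. *)

Definition updZ (T : Z -> sym) (h : Z) (x : sym) : Z -> sym :=
  fun z => if Z.eqb z h then x else T z.

Definition shift (mv : move) (h : Z) : Z :=
  match mv with MoveL => (h - 1)%Z | MoveR => (h + 1)%Z | Stay => h end.

Inductive prog :=
| Act of (sym -> sym) & move
| Sq of prog & prog
| Cond of (sym -> bool) & prog & prog
| Loop of (sym -> bool) & prog.

Inductive texec : prog -> (Z -> sym) -> Z -> (Z -> sym) -> Z -> nat -> Prop :=
| XAct f mv T h : texec (Act f mv) T h (updZ T h (f (T h))) (shift mv h) 1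
| XSq p q T h T1 h1 T2 h2 k l :
    texec p T h T1 h1 k -> texec q T1 h1 T2 h2 l -> texec (Sq p q) T h T2 h2 (k + l)
| XCondT (t : sym -> bool) p q T h T1 h1 k :
    t (T h) -> texec p T h T1 h1 k -> texec (Cond t p q) T h T1 h1 k.+1
| XCondF (t : sym -> bool) p q T h T1 h1 k :
    ~~ t (T h) -> texec q T h T1 h1 k -> texec (Cond t p q) T h T1 h1 k.+1
| XLoopF (t : sym -> bool) p T h : ~~ t (T h) -> texec (Loop t p) T h T h 1
| XLoopT (t : sym -> bool) p T h T1 h1 T2 h2 k l :
    t (T h) -> texec p T h T1 h1 k -> texec (Loop t p) T1 h1 T2 h2 l ->
    texec (Loop t p) T h T2 h2 (k + l).+1.

Fixpoint psize (p : prog) : nat :=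
  match p with
  | Act _ _ => 1
  | Sq p q => psize p + psize q
  | Cond _ p q => (psize p + psize q).+1
  | Loop _ p => (psize p).+1
  end.

(* [pdelta p b e] is the code of [p] occupying the states [b .. b + psize p - 1],
   entered at [b] and left through state [e]. *)
Fixpoint pdelta (p : prog) (b e q : nat) (s : sym) : nat * sym * move :=
  match p with
  | Act f mv => (e, f s, mv)
  | Sq p1 p2 =>
      if q < b + psize p1 then pdelta p1 b (b + psize p1) q s
      else pdelta p2 (b + psize p1) e q s
  | Cond t p1 p2 =>
      if q == b then (if t s then b.+1 else b.+1 + psize p1, s, Stay)
      else if q < b.+1 + psize p1 then pdelta p1 b.+1 e q s
      else pdelta p2 (b.+1 + psize p1) e q s
  | Loop t p1 =>
      if q == b then (if t s then b.+1 else e, s, Stay)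
      else pdelta p1 b.+1 b q s
  end.

Lemma psize_gt0 p : 0 < psize p.
Proof. by elim: p => //= p IH q _; lia. Qed.

Lemma pdelta_bound p b e q s N :
  b <= q < b + psize p -> b + psize p <= N -> e < N -> (pdelta p b e q s).1.1 < N.
Proof.
elim: p b e => [f mv|p1 IH1 p2 IH2|t p1 IH1 p2 IH2|t p1 IH1] b e /= Hq HN He //.
- have := psize_gt0 p2 => H2.
  by case: ifP => H; [apply: IH1; lia | apply: IH2; lia].
- have := psize_gt0 p1; have := psize_gt0 p2 => H2 H1.
  case: eqP => Hb /=; first by case: ifP; lia.
  by case: ifP => H; [apply: IH1; lia | apply: IH2; lia].
- have := psize_gt0 p1 => H1.
  case: eqP => Hb /=; first by case: ifP; lia.
  by apply: IH1; lia.
Qed.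

(** The lists of a configuration are finite while the tape is total; reading past a list gives the
    default [None], which is the blank, so unvisited cells agree. *)
Definition crep (c : config) (q : nat) (T : Z -> sym) (h : Z) : Prop :=
  [/\ c_state c = q, c_head c = T h,
      forall i, nth None (c_left c) i = T (h - 1 - Z.of_nat i)%Z
    & forall i, nth None (c_right c) i = T (h + 1 + Z.of_nat i)%Z].

Lemma updZ_same T h : updZ T h (T h) = T.
Proof. by apply: functional_extensionality => z; rewrite /updZ; case: Z.eqb_spec => [->|]. Qed.

Lemma updZ_eq T h x : updZ T h x h = x.
Proof. by rewrite /updZ Z.eqb_refl. Qed.

Lemma updZ_neq T h x z : z <> h -> updZ T h x z = T z.
Proof. by rewrite /updZ; case: Z.eqb_spec. Qed.

Lemma crep_step M c q T h : crep c q T h -> q != tm_acc M -> q != tm_rej M ->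
  let: (q', x, mv) := tm_delta M q (T h) in
  crep (step M c) q' (updZ T h x) (shift mv h).
Proof.
case: c => q0 l s r [/= -> -> Hl Hr] Ha Hrj.
case E: (tm_delta M q (T h)) => [[q' x] mv].
rewrite /step /halted /= (negbTE Ha) (negbTE Hrj) /= E.
case: mv E => E.
- case: l Hl => [|y l] Hl; split => //=.
  + by rewrite updZ_neq; [have := Hl 0; rewrite Z.sub_0_r | lia].
  + by move=> i; rewrite updZ_neq; [have := Hl i.+1; rewrite !nth_nil => ->; congr (T _); lia | lia].
  + case=> [|i] /=; first by rewrite (_ : (h - 1 + 1 + Z.of_nat 0)%Z = h); [rewrite updZ_eq | lia].
    by rewrite updZ_neq; [rewrite Hr; congr (T _); lia | lia].
  + by rewrite updZ_neq; [have := Hl 0; rewrite Z.sub_0_r | lia].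
  + by move=> i; rewrite updZ_neq; [have := Hl i.+1 => /= ->; congr (T _); lia | lia].
  + case=> [|i] /=; first by rewrite (_ : (h - 1 + 1 + Z.of_nat 0)%Z = h); [rewrite updZ_eq | lia].
    by rewrite updZ_neq; [rewrite Hr; congr (T _); lia | lia].
- case: r Hr => [|y r] Hr; split => //=.
  + by rewrite updZ_neq; [have := Hr 0; rewrite Z.add_0_r | lia].
  + case=> [|i] /=; first by rewrite (_ : (h + 1 - 1 - Z.of_nat 0)%Z = h); [rewrite updZ_eq | lia].
    by rewrite updZ_neq; [rewrite Hl; congr (T _); lia | lia].
  + by move=> i; rewrite updZ_neq; [have := Hr i.+1; rewrite !nth_nil => ->; congr (T _); lia | lia].
  + by rewrite updZ_neq; [have := Hr 0; rewrite Z.add_0_r | lia].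
  + case=> [|i] /=; first by rewrite (_ : (h + 1 - 1 - Z.of_nat 0)%Z = h); [rewrite updZ_eq | lia].
    by rewrite updZ_neq; [rewrite Hl; congr (T _); lia | lia].
  + by move=> i; rewrite updZ_neq; [have := Hr i.+1 => /= ->; congr (T _); lia | lia].
- split => //=; first by rewrite updZ_eq.
  + by move=> i; rewrite updZ_neq; [rewrite Hl | lia].
  + by move=> i; rewrite updZ_neq; [rewrite Hr | lia].
Qed.

Lemma runS M k c : step M (run M k c) = run M k (step M c).
Proof. exact: iterSr. Qed.

Lemma run_add M k l c : run M (k + l) c = run M k (run M l c).
Proof. exact: iterD. Qed.

(** By induction on the execution rather than on the code, so that the remaining rounds of a loop
    are again an instance with the same [b] and [e]. Halting states must lie outside the code
    because [step] freezes in them. *)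
Lemma pdelta_run M p T h T' h' k : texec p T h T' h' k ->
  forall b e c, crep c b T h ->
  (forall q s, b <= q < b + psize p -> tm_delta M q s = pdelta p b e q s) ->
  (forall q, b <= q < b + psize p -> (q != tm_acc M) && (q != tm_rej M)) ->
  crep (run M k c) e T' h'.
Proof.
elim=> {p T h T' h' k}.
- move=> f mv T h b e c Hc Hd Hh.
  have /andP[h1 h2] := Hh b ltac:(rewrite /=; lia).
  have := crep_step Hc h1 h2; rewrite Hd //= ; lia.
- move=> p q T h T1 h1 T2 h2 k l _ IH1 _ IH2 b e c Hc Hd Hh; rewrite /= in Hd Hh.
  have Hp := psize_gt0 p; have Hq := psize_gt0 q.
  rewrite addnC run_add; apply: (IH2 (b + psize p)); last 2 first.
  + move=> q0 s Hq0; rewrite Hd; last lia.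
    by case: ifP => //; lia.
  + by move=> q0 Hq0; apply: Hh; lia.
  apply: (IH1 b) => //.
  + move=> q0 s Hq0; rewrite Hd; last lia.
    by case: ifP => //; lia.
  + by move=> q0 Hq0; apply: Hh; lia.
- move=> t p q T h T1 h1 k Ht _ IH b e c Hc Hd Hh; rewrite /= in Hd Hh.
  have /andP[h1' h2'] := Hh b ltac:(lia).
  have := crep_step Hc h1' h2'; rewrite Hd; last lia.
  rewrite eqxx Ht /= updZ_same => Hs.
  have Hp := psize_gt0 p; have Hq := psize_gt0 q.
  rewrite runS; apply: (IH b.+1) => //.
  + move=> q0 s Hq0; rewrite Hd; last lia.
    by case: eqP => [|_]; [lia | case: ifP => //; lia].
  + by move=> q0 Hq0; apply: Hh; lia.
- move=> t p q T h T1 h1 k Ht _ IH b e c Hc Hd Hh; rewrite /= in Hd Hh.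
  have /andP[h1' h2'] := Hh b ltac:(lia).
  have := crep_step Hc h1' h2'; rewrite Hd; last lia.
  rewrite eqxx (negbTE Ht) /= updZ_same => Hs.
  have Hp := psize_gt0 p; have Hq := psize_gt0 q.
  rewrite runS; apply: (IH (b.+1 + psize p)) => //.
  + move=> q0 s Hq0; rewrite Hd; last lia.
    by case: eqP => [|_]; [lia | case: ifP => //; lia].
  + by move=> q0 Hq0; apply: Hh; lia.
- move=> t p T h Ht b e c Hc Hd Hh; rewrite /= in Hd Hh.
  have /andP[h1' h2'] := Hh b ltac:(lia).
  have := crep_step Hc h1' h2'; rewrite Hd; last lia.
  by rewrite eqxx (negbTE Ht) /= updZ_same.
- move=> t p T h T1 h1 T2 h2 k l Ht _ IH1 _ IH2 b e c Hc Hd Hh; rewrite /= in Hd Hh.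
  have /andP[h1' h2'] := Hh b ltac:(lia).
  have := crep_step Hc h1' h2'; rewrite Hd; last lia.
  rewrite eqxx Ht /= updZ_same => Hs.
  have Hp := psize_gt0 p.
  rewrite runS addnC run_add; apply: (IH2 b e) => //.
  apply: (IH1 b.+1) => //.
  + move=> q0 s Hq0; rewrite Hd; last lia.
    by case: eqP => //; lia.
  + by move=> q0 Hq0; apply: Hh; lia.
Qed.

(** The code starts at the initial state 0; its exit state [psize p] performs the final test and
    passes to one of the two halting states. *)
Definition tm_of (p : prog) (test : sym -> bool) : TM :=
  let a := (psize p).+1 in
  {| tm_states := (psize p).+3;
     tm_delta := fun q s =>
       if q < psize p then pdelta p 0 (psize p) q s
       else (if test s then a else a.+1, s, Stay);
     tm_acc := a;
     tm_rej := a.+1 |}.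

Lemma tm_of_wf p test : wf_tm (tm_of p test).
Proof.
split=> //= q s Hq; case: ifP => H; last by case: ifP.
apply: (@leq_trans (psize p).+1); last lia.
by apply: pdelta_bound; lia.
Qed.

Definition tape_of (w : seq bool) (z : Z) : sym :=
  if Z.ltb z 0 then None else nth None (map Some w) (Z.to_nat z).

Lemma crep_init w : crep (init_config w) 0 (tape_of w) 0.
Proof.
case: w => [|b w]; split => //= i; rewrite /tape_of.
- by rewrite nth_nil; case: Z.ltb_spec => //; lia.
- by rewrite nth_nil; case: Z.ltb_spec => // _; rewrite nth_nil.
- by rewrite nth_nil; case: Z.ltb_spec => //; lia.
- case: Z.ltb_spec => [|_]; first lia.
  by have -> : Z.to_nat (1 + Z.of_nat i) = i.+1 by lia.
Qed.

Lemma run_halted M c t : halted M c -> run M t c = c.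
Proof. by move=> H; elim: t => //= t ->; rewrite /step H. Qed.

(** Halting configurations are fixed by [step], so the outcome is the same at every later time. This
    allows a mere upper bound on the running time to serve as the number of steps. *)
Lemma tm_of_run p test w T h k : texec p (tape_of w) 0 T h k ->
  forall t, k < t ->
  crep (run (tm_of p test) t (init_config w))
    (if test (T h) then tm_acc (tm_of p test) else tm_rej (tm_of p test)) T h.
Proof.
move=> Hx t Ht.
have Hc : crep (run (tm_of p test) k (init_config w)) (psize p) T h.
  apply: (pdelta_run Hx (crep_init w)) => [q s|q] /=; rewrite add0n => Hq.
    by rewrite Hq.
  by rewrite /=; lia.
have := @crep_step (tm_of p test) _ _ _ _ Hc.
rewrite /= ltnn /= updZ_same => /(_ ltac:(lia) ltac:(lia)) Hs.
have -> : t = (t - k.+1) + k.+1 by lia.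
rewrite run_add /= run_halted //.
by case: Hs => /= Hs _ _ _; rewrite /halted /= Hs; case: ifP; rewrite eqxx ?orbT.
Qed.

(** * A tape cut into blocks *)

Definition tx p T h T' h' k := exists2 t, t <= k & texec p T h T' h' t.

Notation "p ;; q" := (Sq p q) (at level 60, right associativity).

Lemma tx_seq p q T h T1 h1 T2 h2 k l n :
  tx p T h T1 h1 k -> tx q T1 h1 T2 h2 l -> k + l <= n -> tx (p ;; q) T h T2 h2 n.
Proof.
move=> [t Ht X] [u Hu Y] H; exists (t + u); first lia.
exact: XSq X Y.
Qed.

Lemma tx_le p T h T' h' k l : tx p T h T' h' k -> k <= l -> tx p T h T' h' l.
Proof. by move=> [t Ht X] H; exists t => //; lia. Qed.

Lemma tx_act f mv T h : tx (Act f mv) T h (updZ T h (f (T h))) (shift mv h) 1.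
Proof. by exists 1 => //; constructor. Qed.

Lemma tx_cond (t : sym -> bool) p q T h T' h' k :
  (if t (T h) then tx p T h T' h' k else tx q T h T' h' k) ->
  tx (Cond t p q) T h T' h' k.+1.
Proof.
by case E: (t (T h)) => [] [u Hu X]; exists u.+1 => //;
  [apply: XCondT | apply: XCondF => //; rewrite E].
Qed.

Lemma tx_loopF (t : sym -> bool) p T h : ~~ t (T h) -> tx (Loop t p) T h T h 1.
Proof. by move=> H; exists 1 => //; constructor. Qed.

Lemma tx_loopT (t : sym -> bool) p T h T1 h1 T2 h2 k l n : t (T h) ->
  tx p T h T1 h1 k -> tx (Loop t p) T1 h1 T2 h2 l -> k + l < n ->
  tx (Loop t p) T h T2 h2 n.
Proof.
move=> Ht [u Hu X] [v Hv Y] H; exists (u + v).+1; first lia.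
exact: XLoopT X Y.
Qed.

Lemma tx_seq_inv p q T h T' h' k : tx (p ;; q) T h T' h' k ->
  exists T1 h1 l n, [/\ tx p T h T1 h1 l, tx q T1 h1 T' h' n & l + n <= k].
Proof.
move=> [t Ht X]; inversion X; subst.
by do 4 eexists; split; [eexists; first exact: leqnn | eexists; first exact: leqnn | ]; eassumption.
Qed.

Definition go mv := Act id mv.
Definition put x mv := Act (fun=> x) mv.

Lemma tx_go mv T h : tx (go mv) T h T (shift mv h) 1.
Proof. by have := tx_act id mv T h; rewrite /= updZ_same. Qed.

Lemma tx_put x mv T h : tx (put x mv) T h (updZ T h x) (shift mv h) 1.
Proof. exact: tx_act (fun=> x) mv T h. Qed.

Fixpoint goN mv k := if k is k'.+1 then go mv ;; goN mv k' else go Stay.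

Lemma tx_goR k T h : tx (goN MoveR k) T h T (h + Z.of_nat k)%Z k.+1.
Proof.
elim: k h => [|k IH] h; first by have := tx_go Stay T h; rewrite /= Z.add_0_r.
rewrite -[goN _ _]/(go _ ;; goN _ k).
apply: (tx_seq (tx_go _ _ _) (l := k.+1)) => //.
by have := IH (h + 1)%Z; rewrite (_ : (h + 1 + _)%Z = (h + Z.of_nat k.+1)%Z); [exact | lia].
Qed.

Lemma tx_goL k T h : tx (goN MoveL k) T h T (h - Z.of_nat k)%Z k.+1.
Proof.
elim: k h => [|k IH] h; first by have := tx_go Stay T h; rewrite /= Z.sub_0_r.
rewrite -[goN _ _]/(go _ ;; goN _ k).
apply: (tx_seq (tx_go _ _ _) (l := k.+1)) => //.
by have := IH (h - 1)%Z; rewrite (_ : (h - 1 - _)%Z = (h - Z.of_nat k.+1)%Z); [exact | lia].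
Qed.

Definition scan mv := Loop (fun s => s != None) (go mv).

Lemma tx_scanL T a h : (a <= h)%Z -> T a = None ->
  (forall z, (a < z <= h)%Z -> T z <> None) ->
  tx (scan MoveL) T h T a (Z.to_nat (h - a)).*2.+1.
Proof.
move=> Hah Ha; have [n Hn] : exists n, h = (a + Z.of_nat n)%Z.
  by exists (Z.to_nat (h - a)); lia.
rewrite {}Hn (_ : Z.to_nat _ = n); last lia.
elim: n {Hah} => [|n IH] H; first by rewrite Z.add_0_r; apply: tx_loopF; rewrite Ha.
apply: (tx_loopT (k := 1) (l := n.*2.+1)); last lia.
- by apply/eqP/H; lia.
- exact: tx_go.
rewrite /= (_ : (_ - 1)%Z = (a + Z.of_nat n)%Z); last lia.
by apply: IH => z Hz; apply: H; lia.
Qed.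

Lemma tx_scanR T a h : (h <= a)%Z -> T a = None ->
  (forall z, (h <= z < a)%Z -> T z <> None) ->
  tx (scan MoveR) T h T a (Z.to_nat (a - h)).*2.+1.
Proof.
move=> Hah Ha; have [n Hn] : exists n, h = (a - Z.of_nat n)%Z.
  by exists (Z.to_nat (a - h)); lia.
rewrite {}Hn (_ : Z.to_nat _ = n); last lia.
elim: n {Hah} => [|n IH] H; first by rewrite Z.sub_0_r; apply: tx_loopF; rewrite Ha.
apply: (tx_loopT (k := 1) (l := n.*2.+1)); last lia.
- by apply/eqP/H; lia.
- exact: tx_go.
rewrite /= (_ : (_ + 1)%Z = (a - Z.of_nat n)%Z); last lia.
by apply: IH => z Hz; apply: H; lia.
Qed.

Fixpoint putN (s : seq bool) :=
  if s is x :: s' then put (Some x) MoveR ;; putN s' else go Stay.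

Definition over (T : Z -> sym) (h : Z) (s : seq bool) : Z -> sym :=
  fun z => if Z.leb h z && Z.ltb z (h + Z.of_nat (size s)) then
             Some (nth false s (Z.to_nat (z - h)))
           else T z.

Lemma tx_putN s T h : tx (putN s) T h (over T h s) (h + Z.of_nat (size s))%Z (size s).+1.
Proof.
elim: s T h => [|x s IH] T h.
  have := tx_go Stay T h; rewrite /= Z.add_0_r (_ : over T h [::] = T) //.
  by apply: functional_extensionality => z; rewrite /over; case: ifP => //=; lia.
rewrite -[putN _]/(put (Some x) MoveR ;; putN s).
apply: (tx_seq (tx_put _ _ _ _) (l := (size s).+1)) => //.
have := IH (updZ T h (Some x)) (h + 1)%Z.
rewrite (_ : (h + 1 + _)%Z = (h + Z.of_nat (size (x :: s)))%Z); last by rewrite /=; lia.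
rewrite (_ : over _ (h + 1) _ = over T h (x :: s)) //.
apply: functional_extensionality => z; rewrite /over /updZ /=.
case: (Z.eqb_spec z h) => [->|Hz].
  rewrite (_ : _ && _ = false); last lia.
  by rewrite (_ : _ && _ = true) ?Z.sub_diag //; lia.
case: ifP => H1; last by rewrite (_ : _ && _ = false) //; lia.
rewrite (_ : _ && _ = true); last lia.
by rewrite (_ : Z.to_nat (z - h) = (Z.to_nat (z - (h + 1))).+1) //; lia.
Qed.

Section Blocks.
Variable w : nat.

Definition cell (H : Z) (q j : nat) : Z := (H + Z.of_nat (q * w + j))%Z.

Lemma cell_inj H q j q' j' : j < w -> j' < w -> cell H q j = cell H q' j' ->
  q = q' /\ j = j'.
Proof.
rewrite /cell => Hj Hj' E.
have {}E : q * w + j = q' * w + j' by lia.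
have w0 : 0 < w by lia.
have Eq : q = q'.
  have := congr1 (divn^~ w) E.
  by rewrite !divnMDl // !divn_small // !addn0.
by split=> //; move: E; rewrite Eq; lia.
Qed.

Lemma cell_lt H q j L : j < w -> q < L -> (H <= cell H q j < cell H L 0)%Z.
Proof. rewrite /cell => Hj HL; nia. Qed.

Lemma cell_split H L z : (H <= z < cell H L 0)%Z ->
  exists q j, [/\ q < L, j < w & z = cell H q j].
Proof.
rewrite /cell => Hz; set n := Z.to_nat (z - H).
have Hn : n < L * w by lia.
have w0 : 0 < w by case: (w) Hn => //; lia.
exists (n %/ w), (n %% w); split; first by rewrite ltn_divLR.
  by rewrite ltn_mod.
by rewrite -divn_eq /n; lia.
Qed.

(** The blank at [H - 1] stops the leftward scan of [home], and the blanks from block [L] on let an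
    increment recognise the end of the tape. *)
Definition blocks (H : Z) (L : nat) (F : nat -> nat -> bool) (T : Z -> sym) : Prop :=
  [/\ T (H - 1)%Z = None,
      forall q j, q < L -> j < w -> T (cell H q j) = Some (F j q)
    & forall z, (cell H L 0 <= z)%Z -> T z = None].

Definition setF (F : nat -> nat -> bool) j q b : nat -> nat -> bool :=
  fun j' q' => if (j' == j) && (q' == q) then b else F j' q'.

Lemma blocks_ext H L F F' T : (forall j q, j < w -> q < L -> F j q = F' j q) ->
  blocks H L F T -> blocks H L F' T.
Proof. by move=> E [h1 h2 h3]; split=> // q j Hq Hj; rewrite h2 // E. Qed.

Lemma blocks_upd H L F T q j b : q < L -> j < w -> blocks H L F T ->
  blocks H L (setF F j q b) (updZ T (cell H q j) (Some b)).
Proof.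
move=> Hq Hj [h1 h2 h3]; have := cell_lt H Hj Hq => Hc; split.
- by rewrite updZ_neq //; lia.
- move=> q' j' Hq' Hj'; rewrite /updZ /setF; case: Z.eqb_spec => [/cell_inj|E].
    by case=> // -> ->; rewrite !eqxx.
  case: eqP => [Ej|_]; case: eqP => [Eq|_] /=; rewrite ?h2 //.
  by case: E; rewrite Ej Eq.
- by move=> z Hz; rewrite updZ_neq ?h3 //; lia.
Qed.

Lemma blocks_app H L F T s : size s = w -> blocks H L F T ->
  (forall j, j < w -> nth false s j = F j L) ->
  blocks H L.+1 F (over T (cell H L 0) s).
Proof.
move=> Hs [h1 h2 h3] HF; have E : cell H L.+1 0 = (cell H L 0 + Z.of_nat w)%Z by rewrite /cell; lia.
split; rewrite /over ?Hs.
- by case: ifP => //; rewrite /cell; lia.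
- move=> q j Hq Hj; case: ifP => [Hz|Hz].
    have [HqL|HqL] := ltnP q L; first by have := cell_lt H Hj HqL; lia.
    have -> : q = L by lia.
    by rewrite (_ : Z.to_nat _ = j) ?HF // /cell; lia.
  have HqL : q < L.
    rewrite ltnNge; apply/negP => HL; have Eq : q = L by lia.
    by move: Hz; rewrite Eq /cell; lia.
  by apply: h2.
- by rewrite E => z Hz; case: ifP => [|_]; [lia | apply: h3; lia].
Qed.

Definition home := scan MoveL ;; go MoveR.

Lemma tx_home H L F T z : blocks H L F T -> (H - 1 <= z < cell H L 0)%Z ->
  tx home T z T H (L * w).*2.+4.
Proof.
move=> [h1 h2 h3] Hz.
have Hs : tx (scan MoveL) T z T (H - 1) (Z.to_nat (z - (H - 1))).*2.+1.
  apply: tx_scanL => //; first lia.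
  move=> z' Hz'; have [q [j [Hq Hj ->]]] : exists q j, [/\ q < L, j < w & z' = cell H q j].
    by apply: (@cell_split H); lia.
  by rewrite h2.
apply: (tx_seq Hs (l := 1)).
  have := tx_go MoveR T (H - 1)%Z; rewrite /= (_ : (H - 1 + 1)%Z = H) //; lia.
move: Hz; rewrite /cell; lia.
Qed.

Definition isone (s : sym) := s == Some true.
Definition notone (s : sym) := s != Some true.

(** Jumps of length [w] stay on lane [j], so bits of other lanes cannot stop the search. *)
Definition locate j := goN MoveR j ;; Loop notone (goN MoveR w).

Lemma tx_find H L F T j p : blocks H L F T -> j < w -> p < L -> F j p ->
  (forall q, q < p -> F j q = false) ->
  tx (locate j) T H T (cell H p j) (w.+2 * L.+1).
Proof.
move=> [h1 h2 h3] Hj HpL Hp Hmin.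
have Hl : forall k q, q + k = p ->
    tx (Loop notone (goN MoveR w)) T (cell H q j) T (cell H p j) (k * w.+2).+1.
  elim=> [|k IH] q Eq.
    have -> : q = p by lia.
    by apply: tx_loopF; rewrite /notone h2 // Hp.
  have Hq : q < p by lia.
  apply: (tx_loopT (k := w.+1) (l := (k * w.+2).+1)); last lia.
  - by rewrite /notone h2 ?Hmin //; lia.
  - exact: tx_goR.
  rewrite (_ : (_ + _)%Z = cell H q.+1 j); last by rewrite /cell; lia.
  by apply: IH; lia.
apply: (tx_seq (tx_goR _ _ _) (l := (p * w.+2).+1)); last nia.
by rewrite (_ : (H + _)%Z = cell H 0 j) ?/cell; [apply: Hl | lia].
Qed.

(* From the home position, moves to lane [j'] of the block marked on lane [j]. *)
Definition seek j j' := locate j ;; goN MoveL j ;; goN MoveR j'.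

Lemma tx_seek H L F T j j' p : blocks H L F T -> j < w -> j' < w -> p < L -> F j p ->
  (forall q, q < p -> F j q = false) ->
  tx (seek j j') T H T (cell H p j') (w.+2 * L.+1 + w.*2).
Proof.
move=> HB Hj Hj' HpL Hp Hmin.
apply: (tx_seq (tx_find HB Hj HpL Hp Hmin) (l := j.+1 + j'.+1)); last lia.
apply: (tx_seq (tx_goL j _ _) (l := j'.+1)) => //.
have -> : cell H p j' = (cell H p j - Z.of_nat j + Z.of_nat j')%Z by rewrite /cell; lia.
exact: tx_goR.
Qed.

End Blocks.

(** * Registers and bit tracks stored in blocks *)

Record st := St { reg : nat -> nat; trk : nat -> nat -> bool }.

Definition setr (s : st) i x : st :=
  St (fun i' => if i' == i then x else reg s i') (trk s).
Definition sett (s : st) t q b : st := St (reg s) (setF (trk s) t q b).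

Section Machine.
Variables d w : nat.

(* Cell [j] of block [q] is lane [j] at position [q].  Lanes below [d] are bit tracks;
   lane [d + i] is register [i], stored as a single mark in block number [reg s i]. *)
Definition lane (s : st) (j q : nat) : bool :=
  if j < d then trk s j q else reg s (j - d) == q.

(** The last clause makes the tracks vanish beyond the tape, so a block appended later can be filled
    with zeros. *)
Definition rep H L s T : Prop :=
  [/\ blocks w H L (lane s) T,
      forall i, d + i < w -> reg s i < L
    & forall t q, t < d -> L <= q -> trk s t q = false].

(** A generous constant: an elementary operation makes a few sweeps, each taking about [2 w] steps
    per block at most. *)
Definition cw := 30 * w.+2.

(* [k] bounds the number of elementary operations.  One operation adds at most one
   block and costs a constant number of sweeps over the tape. *)
Definition does p s s' k : Prop := forall H L T, rep H L s T ->
  exists L' T', [/\ rep H L' s' T', L <= L' <= L + k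
                & tx p T H T' H (k * (cw * (L + k).+1))].

Lemma does_le p s s' k l : does p s s' k -> k <= l -> does p s s' l.
Proof.
move=> D Hkl H L T /D [L' [T' [h1 h2 h3]]]; exists L', T'; split=> //; first lia.
apply: (tx_le h3); apply: leq_mul => //; apply: leq_mul => //; lia.
Qed.

Lemma does_seq p q s s1 s2 k l n : does p s s1 k -> does q s1 s2 l -> k + l <= n ->
  does (p ;; q) s s2 n.
Proof.
move=> D1 D2 Hn H L T /D1 [L1 [T1 [/D2 [L2 [T2 [r2 b2 x2]]] b1 x1]]].
exists L2, T2; split=> //; first lia.
apply: (tx_seq x1 x2); apply: (@leq_trans ((k + l) * (cw * (L + (k + l)).+1))).
  by rewrite mulnDl leq_add // leq_mul // leq_mul //; lia.
by rewrite leq_mul // leq_mul //; lia.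
Qed.

Lemma does_skip s : does (go Stay) s s 1.
Proof.
move=> H L T R; exists L, T; split=> //; first lia.
by apply: (tx_le (tx_go _ _ _)); rewrite /cw; lia.
Qed.

Lemma lane_trk s t q : t < d -> lane s t q = trk s t q.
Proof. by rewrite /lane => ->. Qed.

Lemma lane_reg s i q : lane s (d + i) q = (reg s i == q).
Proof. by rewrite /lane ltnNge leq_addr /= addKn. Qed.

Lemma rep_seek H L s T i j : rep H L s T -> d + i < w -> j < w ->
  tx (seek w (d + i) j) T H T (cell w H (reg s i) j) (w.+2 * L.+1 + w.*2).
Proof.
move=> [HB Hr _] Hi Hj; apply: (tx_seek HB) => //; first exact: Hr.
  by rewrite lane_reg.
by move=> q Hq; rewrite lane_reg; apply/eqP; lia.
Qed.

Lemma rep_home H L s T q j : rep H L s T -> q < L -> j < w ->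
  tx home T (cell w H q j) T H (L * w).*2.+4.
Proof.
move=> [HB _ _] Hq Hj; apply: (tx_home HB).
by have := cell_lt H Hj Hq; lia.
Qed.

Definition writeP t i b := seek w (d + i) t ;; put (Some b) Stay ;; home.

Lemma does_write t i b s : t < d -> d + i < w ->
  does (writeP t i b) s (sett s t (reg s i) b) 1.
Proof.
move=> Ht Hi H L T R; have [HB Hr Htk] := R; have Hp := Hr _ Hi.
exists L, (updZ T (cell w H (reg s i) t) (Some b)).
have R' : rep H L (sett s t (reg s i) b) (updZ T (cell w H (reg s i) t) (Some b)).
  split=> //.
  - apply: (blocks_ext _ (blocks_upd b Hp _ HB)); last lia.
    move=> j q Hj Hq; rewrite /lane /setF /=; have [Hjd|Hjd] := ltnP j d; first by [].
    by rewrite (_ : j == t = false) //; lia.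
  - move=> t' q Ht' Hq; rewrite /= /setF; case: eqP => [_|_] /=; last exact: Htk.
    by case: eqP => [E|_]; [lia | apply: Htk].
split=> //; first lia.
apply: (tx_seq (rep_seek R Hi _) (l := 1 + (L * w).*2.+4)); first lia; last by rewrite /cw; nia.
apply: (tx_seq (tx_put _ _ _ _)); first by apply: (rep_home R') => //; lia.
lia.
Qed.

Definition zeroP i :=
  seek w (d + i) (d + i) ;; put (Some false) Stay ;; home ;;
  goN MoveR (d + i) ;; put (Some true) Stay ;; home.

Lemma rep_setr H L s T i x T' : rep H L s T -> d + i < w -> x < L ->
  blocks w H L (setF (setF (lane s) (d + i) (reg s i) false) (d + i) x true) T' ->
  rep H L (setr s i x) T'.
Proof.
move=> [HB Hr Htk] Hi Hx HB'; split.
- apply: (blocks_ext _ HB') => j q Hj Hq; rewrite /setF.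
  have [Hjd|Hjd] := ltnP j d.
    by rewrite (_ : (j == d + i) = false) /lane ?Hjd //; lia.
  have -> : j = d + (j - d) by lia.
  rewrite !lane_reg /= eqn_add2l; case: eqP => [->|_] //=.
  by rewrite [x == q]eq_sym; case: eqP => // _; case: eqP => [|/eqP/negbTE]; rewrite // eq_sym.
- by move=> i' Hi' /=; case: eqP => _ //; apply: Hr.
- by move=> t q Ht Hq; apply: Htk.
Qed.

Lemma does_zero i s : d + i < w -> does (zeroP i) s (setr s i 0) 1.
Proof.
move=> Hi H L T R; have [HB Hr Htk] := R; have Hp := Hr _ Hi.
have HB1 := blocks_upd false Hp Hi HB.
have HB2 := blocks_upd true (leq_ltn_trans (leq0n _) Hp) Hi HB1.
have R' := rep_setr R Hi (leq_ltn_trans (leq0n _) Hp) HB2.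
exists L, (updZ (updZ T (cell w H (reg s i) (d + i)) (Some false)) (cell w H 0 (d + i)) (Some true)).
split=> //; first lia.
apply: (tx_seq (rep_seek R Hi Hi) (l := 1 + ((L * w).*2.+4 + (w + 1 + (L * w).*2.+4)))); last by rewrite /cw; nia.
apply: (tx_seq (tx_put _ _ _ _)); last exact: leqnn.
apply: (tx_seq (tx_home HB1 _)); last exact: leqnn.
  by have := cell_lt H Hi Hp => /=; lia.
apply: (tx_seq (tx_goR _ _ _) (l := 1 + (L * w).*2.+4)); last lia.
have -> : (H + Z.of_nat (d + i))%Z = cell w H 0 (d + i) by rewrite /cell; lia.
apply: (tx_seq (tx_put _ _ _ _)); last exact: leqnn.
by apply: (tx_home HB2); have := cell_lt H Hi Hp; have := cell_lt (L := L) H Hi (leq_ltn_trans (leq0n _) Hp) => /=; lia.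
Qed.

(** The mark of [i] is erased before the mark of [k] is looked up, hence the condition [i != k] in
    the correctness lemma. *)
Definition copyP i k :=
  seek w (d + i) (d + i) ;; put (Some false) Stay ;; home ;;
  seek w (d + k) (d + i) ;; put (Some true) Stay ;; home.

Lemma does_copy i k s : d + i < w -> d + k < w -> i != k ->
  does (copyP i k) s (setr s i (reg s k)) 1.
Proof.
move=> Hi Hk Hik H L T R; have [HB Hr Htk] := R; have Hp := Hr _ Hi; have Hpk := Hr _ Hk.
have HB1 := blocks_upd false Hp Hi HB.
have HB2 := blocks_upd true Hpk Hi HB1.
have R' := rep_setr R Hi Hpk HB2.
exists L, (updZ (updZ T (cell w H (reg s i) (d + i)) (Some false)) (cell w H (reg s k) (d + i)) (Some true)).
split=> //; first lia.
apply: (tx_seq (rep_seek R Hi Hi) (l := 1 + ((L * w).*2.+4 + (w.+2 * L.+1 + w.*2 + (1 + (L * w).*2.+4))))); last by rewrite /cw; nia.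
apply: (tx_seq (tx_put _ _ _ _)); last exact: leqnn.
apply: (tx_seq (tx_home HB1 _)); last exact: leqnn.
  by have := cell_lt H Hi Hp => /=; lia.
have Hlk q : setF (lane s) (d + i) (reg s i) false (d + k) q = (reg s k == q).
  by rewrite /setF eqn_add2l eq_sym (negbTE Hik) /= lane_reg.
have Hs := tx_seek (p := reg s k) HB1 Hk Hi Hpk; rewrite Hlk eqxx in Hs.
apply: (tx_seq (Hs isT _)); last exact: leqnn.
  by move=> q Hq; rewrite Hlk; apply/eqP; lia.
apply: (tx_seq (tx_put _ _ _ _)); last exact: leqnn.
by apply: (tx_home HB2); have := cell_lt H Hi Hpk => /=; lia.
Qed.

(** A blank one block to the right means that the register stood in the last block; a zero block is
    then appended before the new mark is set. *)
Definition incP i :=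
  seek w (d + i) (d + i) ;; put (Some false) Stay ;;
  goN MoveL (d + i) ;; goN MoveR w ;;
  Cond (fun x => x == None) (putN (nseq w false) ;; goN MoveL w) (go Stay) ;;
  goN MoveR (d + i) ;; put (Some true) Stay ;; home.

Lemma does_inc i s : d + i < w -> does (incP i) s (setr s i (reg s i).+1) 1.
Proof.
move=> Hi H L T R; have [HB Hr Htk] := R; have Hp := Hr _ Hi.
have HB1 := blocks_upd false Hp Hi HB.
set T1 := updZ T _ _ in HB1; set F1 := setF _ _ _ _ in HB1.
pose L' := maxn L (reg s i).+2.
have [T2 [HB2 X2]] : exists T2, blocks w H L' F1 T2 /\
    tx (Cond (fun x => x == None) (putN (nseq w false) ;; goN MoveL w) (go Stay))
      T1 (cell w H (reg s i).+1 0) T2 (cell w H (reg s i).+1 0) (w.+1 + w.+1).+1.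
  have [HL|HL] := leqP (reg s i).+2 L.
    exists T1; split; first by rewrite /L' (_ : maxn _ _ = L) //; lia.
    apply: tx_cond; case: HB1 => _ h2 _; rewrite h2 //=; last lia.
    by apply: (tx_le (tx_go _ _ _)); lia.
  have EL : L = (reg s i).+1 by lia.
  exists (over T1 (cell w H L 0) (nseq w false)); split.
    rewrite /L' (_ : maxn _ _ = L.+1); last lia.
    apply: blocks_app => //; first by rewrite size_nseq.
    (* A zero block is correct here: tracks vanish from [L] on, and all register marks lie below
       [L]. *)
    move=> j Hj; rewrite nth_nseq Hj /F1 /setF (_ : (L == _) = false) ?andbF; last lia.
    have [Hjd|Hjd] := ltnP j d; first by rewrite lane_trk // Htk.
    have -> : j = d + (j - d) by lia.
    by rewrite lane_reg; apply/esym/eqP => E; have := Hr (j - d) ltac:(lia); lia.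
  apply: tx_cond; case: HB1 => _ _ h3; rewrite -EL h3 /=; last lia.
  apply: (tx_seq (tx_putN _ _ _) (l := w.+1)); last by rewrite size_nseq.
  have := tx_goL w (over T1 (cell w H L 0) (nseq w false)) (cell w H L 0 + Z.of_nat w)%Z.
  by rewrite size_nseq (_ : (_ + _ - _)%Z = cell w H L 0); [exact | lia].
have Hp' : (reg s i).+1 < L' by lia.
have HB3 := blocks_upd true Hp' Hi HB2.
exists L', (updZ T2 (cell w H (reg s i).+1 (d + i)) (Some true)).
split; last 1 first.
- apply: (tx_seq (rep_seek R Hi Hi) (l := 1 + (w + (w.+1 + ((w.+1 + w.+1).+1 + (w + (1 + (L' * w).*2.+4))))))); last first.
    have HL : L' <= L.+1 by lia.
    have : L' * w <= L.+1 * w by rewrite leq_mul.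
    by rewrite /cw; nia.
  apply: (tx_seq (tx_put _ _ _ _)); last exact: leqnn.
  apply: (tx_seq (tx_goL _ _ _) (l := (w.+1 + ((w.+1 + w.+1).+1 + (w + (1 + (L' * w).*2.+4)))))); last lia.
  apply: (tx_seq (tx_goR _ _ _)); last exact: leqnn.
  rewrite (_ : (_ + Z.of_nat w)%Z = cell w H (reg s i).+1 0); last by rewrite /cell /=; lia.
  apply: (tx_seq X2); last exact: leqnn.
  apply: (tx_seq (tx_goR _ _ _) (l := 1 + (L' * w).*2.+4)); last lia.
  rewrite (_ : (_ + Z.of_nat (d + i))%Z = cell w H (reg s i).+1 (d + i)); last by rewrite /cell /=; lia.
  apply: (tx_seq (tx_put _ _ _ _)); last exact: leqnn.
  by apply: (tx_home HB3); have := cell_lt H Hi Hp' => /=; lia.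
(* [rep_setr] starts from a representation of the old state on [L'] blocks. Restoring the erased
   mark gives one, on an auxiliary tape. *)
- have R2 : rep H L' s (updZ T2 (cell w H (reg s i) (d + i)) (Some true)).
    have HB2' := blocks_upd true (ltn_trans (ltnSn _) Hp') Hi HB2.
    split.
    + apply: (blocks_ext _ HB2') => j q Hj Hq; rewrite /F1 /setF.
      by case: andP => // -[/eqP-> /eqP->]; rewrite lane_reg eqxx.
    + by move=> i' Hi'; have := Hr _ Hi'; lia.
    + by move=> t q Ht Hq; apply: Htk => //; lia.
  exact: (rep_setr R2 Hi Hp' HB3).
- by lia.
Qed.

(** One test with two uses: on a track lane it reads the bit at position [reg s i], on a register
    lane it compares two registers for equality. *)
Definition branchP i j p q := seek w (d + i) j ;; Cond isone (home ;; p) (home ;; q).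

Lemma does_if i j p q s s' k : d + i < w -> j < w ->
  (if lane s j (reg s i) then does p s s' k else does q s s' k) ->
  does (branchP i j p q) s s' k.+1.
Proof.
move=> Hi Hj D H L T R; have [HB Hr _] := R; have Hp := Hr _ Hi.
have [L' [T' [R' HL X]]] : exists L' T', [/\ rep H L' s' T', L <= L' <= L + k &
    tx (if lane s j (reg s i) then p else q) T H T' H (k * (cw * (L + k).+1))].
  by case: (lane _ _ _) D => D; apply: D.
exists L', T'; split=> //; first lia.
have Xh := rep_home R Hp Hj.
apply: (tx_seq (rep_seek R Hi Hj) (l := ((L * w).*2.+4 + (k * (cw * (L + k).+1))).+1)).
  apply: tx_cond; case: HB => _ h2 _; rewrite h2 // /isone.
  by case: (lane _ _ _) X => /= X; apply: (tx_seq Xh X).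
have h1 : k * (cw * (L + k).+1) <= k * (cw * (L + k.+1).+1).
  by rewrite leq_mul // leq_mul //; lia.
have h2 : w.+2 * L.+1 + w.*2 + (L * w).*2.+4 < cw * (L + k.+1).+1 by rewrite /cw; nia.
rewrite mulSn; lia.
Qed.

Definition whileP i j p := seek w (d + i) j ;; Loop notone (home ;; p ;; seek w (d + i) j) ;; home.

Lemma does_whileF i j p s : d + i < w -> j < w -> lane s j (reg s i) ->
  does (whileP i j p) s s 1.
Proof.
move=> Hi Hj E H L T R; have [HB Hr _] := R; have Hp := Hr _ Hi.
exists L, T; split=> //; first lia.
apply: (tx_seq (rep_seek R Hi Hj) (l := 1 + (L * w).*2.+4)); last by rewrite /cw; nia.
apply: (tx_seq (tx_loopF _ _) (rep_home R Hp Hj)) => //.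
by case: HB => _ h2 _; rewrite h2 // E.
Qed.

(** The loop body ends with the very seek that the remaining loop begins with. The run of the
    remaining loop is therefore cut behind its seek, and the two pieces are regrouped around the
    present body. *)
Lemma does_whileT i j p s s1 s2 k l : d + i < w -> j < w -> ~~ lane s j (reg s i) ->
  does p s s1 k -> does (whileP i j p) s1 s2 l -> does (whileP i j p) s s2 (k + l).+1.
Proof.
move=> Hi Hj E D1 D2 H L T R; have [HB Hr _] := R; have Hp := Hr _ Hi.
have [L1 [T1 [R1 b1 x1]]] := D1 _ _ _ R.
have [L2 [T2 [R2 b2 x2]]] := D2 _ _ _ R1.
exists L2, T2; split=> //; first lia.
have [Ta [ha [k0 [m [Xa /tx_seq_inv[Tb [hb [k1 [k2 [Xb Xc Hm]]]]] Hu]]]]] := tx_seq_inv x2.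
have Xh := rep_home R Hp Hj.
have Xs := rep_seek R Hi Hj.
set A := w.+2 * L.+1 + w.*2 in Xs; set B := (L * w).*2.+4 in Xh.
set C := k * (cw * (L + k).+1) in x1.
apply: (tx_seq Xs (l := (B + C + l * (cw * (L1 + l).+1)).+1)); last first.
  have e1 : A + B + 1 <= cw * (L + (k + l).+1).+1 by rewrite /A /B /cw; nia.
  have e2 : C <= k * (cw * (L + (k + l).+1).+1) by rewrite /C leq_mul // leq_mul //; lia.
  have e3 : l * (cw * (L1 + l).+1) <= l * (cw * (L + (k + l).+1).+1).
    by rewrite leq_mul // leq_mul //; lia.
  by rewrite mulSn mulnDl; lia.
apply: (tx_seq (k := (B + (C + k0) + k1).+1) (l := k2) _ Xc); last lia.
apply: (tx_loopT (k := B + (C + k0)) (l := k1) _ _ Xb); last lia.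
  by case: HB => _ e2 _; rewrite e2 // /notone; case: (lane _ _ _) E.
exact: (tx_seq Xh (tx_seq x1 Xa (leqnn _)) (leqnn _)).
Qed.

Definition forP i k p := whileP i (d + k) (p ;; incP i).

(** A round costs [k] for the body, one operation for the increment and one for the test. The loop
    bound stays in register [n], so the invariant has to preserve it. *)
Lemma does_for i n p (Inv : nat -> st -> Prop) N k s : d + i < w -> d + n < w ->
  (forall x s, Inv x s -> reg s i = x /\ reg s n = N) ->
  (forall x s, x < N -> Inv x s ->
     exists s', does p s s' k /\ Inv x.+1 (setr s' i (reg s' i).+1)) ->
  Inv 0 s -> exists s', does (forP i n p) s s' (N * k.+2).+1 /\ Inv N s'.
Proof.
move=> Hi Hn HI Hstep.
suff Hgen : forall m x s, x + m = N -> Inv x s ->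
    exists s', does (forP i n p) s s' (m * k.+2).+1 /\ Inv N s'.
  by apply: Hgen; rewrite add0n.
elim=> [|m IH] x s0 Hx Hs; have [E1 E2] := HI _ _ Hs.
  exists s0; split; last by rewrite -Hx addn0.
  by apply: does_whileF => //; rewrite lane_reg E1 E2; apply/eqP; lia.
have HxN : x < N by lia.
have [s1 [D1 I1]] := Hstep _ _ HxN Hs.
have [s2 [D2 I2]] := IH x.+1 _ ltac:(lia) I1.
exists s2; split=> //.
have D : does (p ;; incP i) s0 (setr s1 i (reg s1 i).+1) k.+1.
  by apply: (does_seq D1 (does_inc Hi)); rewrite addn1.
apply: (does_le (does_whileT Hi Hn _ D D2)); last by rewrite mulSn; lia.
by rewrite lane_reg E1 E2; apply/eqP; lia.
Qed.

End Machine.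

(** * Expressions and commands *)

(* [V i] is a de Bruijn variable, [Gl false] and [Gl true] are the two global
   constants, [Rd t e] reads track [t].  [Fold N c e b] iterates [b] (variables:
   accumulator, index) from [e]; values not below [c] are replaced by [0], which
   keeps every expression polynomially bounded. *)
Inductive ex :=
| V of nat
| Gl of bool
| Sc of ex
| IfE of ex & ex & ex & ex
| Rd of nat & ex
| Sum of ex & ex
| Fold of ex & ex & ex & ex
| Ap of ex & seq ex.

Fixpoint eachP (P : ex -> Prop) (s : seq ex) : Prop :=
  if s is e :: s' then P e /\ eachP P s' else True.

Lemma ex_ind' (P : ex -> Prop) :
  (forall i, P (V i)) -> (forall b, P (Gl b)) -> (forall e, P e -> P (Sc e)) ->
  (forall a b c d, P a -> P b -> P c -> P d -> P (IfE a b c d)) ->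
  (forall t e, P e -> P (Rd t e)) -> (forall a b, P a -> P b -> P (Sum a b)) ->
  (forall a b c d, P a -> P b -> P c -> P d -> P (Fold a b c d)) ->
  (forall f s, P f -> eachP P s -> P (Ap f s)) -> forall e, P e.
Proof.
move=> h1 h2 h3 h4 h5 h6 h7 h8; fix IH 1; case=> [i|b|e|a b c d|t e|a b|a b c d|f s].
- exact: h1.
- exact: h2.
- exact: h3.
- exact: h4.
- exact: h5.
- exact: h6.
- exact: h7.
- by apply: h8 => //; elim: s => //= e s IHs; split.
Qed.

Definition tracks := nat -> nat -> bool.

Fixpoint eval (n K : nat) (A : tracks) (e : ex) (v : seq nat) : nat :=
  match e with
  | V i => nth 0 v i
  | Gl b => if b then K else n
  | Sc e => (eval n K A e v).+1
  | IfE a b c d =>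
      if eval n K A a v == eval n K A b v then eval n K A c v else eval n K A d v
  | Rd t e => A t (eval n K A e v)
  | Sum N b => \sum_(i <- iota 0 (eval n K A N v)) eval n K A b (i :: v)
  | Fold N c e b =>
      foldl (fun acc x => let r := eval n K A b [:: acc, x & v] in
                          if r < eval n K A c v then r else 0)
        (eval n K A e v) (iota 0 (eval n K A N v))
  | Ap f s => eval n K A f (map (fun a => eval n K A a v) s)
  end.

Fixpoint vb (e : ex) (B : nat) : nat :=
  match e with
  | V _ | Gl _ => B
  | Sc e => (vb e B).+1
  | IfE a b c d => vb c B + vb d B
  | Rd _ _ => 1
  | Sum N b => vb N B * vb b (B + vb N B)
  | Fold N c e b => vb e B + vb c B
  | Ap f s => vb f (B + sumn (map (fun a => vb a B) s))
  end.

(** Mirrors [cexp]. Values are unary: a summand is added by as many increments as its value, and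
    clipping a [Fold] scans all values below the cap; hence the factors [vb b] and [vb c]. *)
Fixpoint cb (e : ex) (B : nat) : nat :=
  match e with
  | V _ | Gl _ => 1
  | Sc e => (cb e B).+1
  | IfE a b c d => (cb a B + cb b B + cb c B + cb d B).+1
  | Rd _ e => (cb e B).+3
  | Sum N b =>
      let B' := B + vb N B in
      cb N B + 3 + vb N B * (cb b B' + 4 + 4 * vb b B')
  | Fold N c e b =>
      let B' := B + vb N B + vb c B + vb e B in
      cb N B + cb c B + cb e B + 2 + vb N B * (cb b B' + 5 + 4 * vb c B)
  | Ap f s => sumn (map (fun a => cb a B) s) + cb f (B + sumn (map (fun a => vb a B) s)) + 1
  end.

Fixpoint need (e : ex) : nat :=
  match e with
  | V _ | Gl _ => 0
  | Sc e => need e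
  | IfE a b c d => 2 + need a + need b + need c + need d
  | Rd _ e => 1 + need e
  | Sum N b => 4 + need N + need b
  | Fold N c e b => 5 + need N + need c + need e + need b
  | Ap f s => size s + need f + sumn (map need s)
  end.

Fixpoint okE (d : nat) (e : ex) : bool :=
  match e with
  | V _ | Gl _ => true
  | Sc e => okE d e
  | IfE a b c c' => [&& okE d a, okE d b, okE d c & okE d c']
  | Rd t e => (t < d) && okE d e
  | Sum N b => okE d N && okE d b
  | Fold N c e b => [&& okE d N, okE d c, okE d e & okE d b]
  | Ap f s => okE d f && all (okE d) s
  end.

(** The tracks [A] are arbitrary: reading them yields a bit, a [Sum] multiplies two bounds, and a
    [Fold] returns its start value or something below its cap. *)
Lemma eval_bound e n K A v B : n <= B -> K <= B -> all (fun x => x <= B) v ->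
  eval n K A e v <= vb e B.
Proof.
elim/ex_ind': e v B => [i|b|e IH|a b c d IHa IHb IHc IHd|t e IH|a b IHa IHb
  |a b c d IHa IHb IHc IHd|f s IHf IHs] v B Hn HK Hv /=.
- have [Hi|Hi] := ltnP i (size v); last by rewrite nth_default.
  by move/allP: Hv; apply; apply: mem_nth.
- by case: b.
- by rewrite ltnS; apply: IH.
- case: ifP => _; first by apply: leq_trans (leq_addr _ _); apply: IHc.
  by apply: leq_trans (leq_addl _ _); apply: IHd.
- by case: (A _ _).
- have HN := IHa _ _ Hn HK Hv.
  rewrite big_seq; apply: (@leq_trans (\sum_(i <- iota 0 (eval n K A a v) | i \in iota 0 (eval n K A a v)) vb b (B + vb a B))).
    apply: leq_sum => i; rewrite mem_iota => Hi; apply: IHb; [lia|lia|].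
    rewrite /= (_ : i <= _) /=; last lia.
    by apply/allP => x /(allP Hv) /=; lia.
  rewrite -big_seq big_const_seq count_predT size_iota iter_addn_0 mulnC.
  by apply: leq_mul.
- have Hc := IHb _ _ Hn HK Hv; have He := IHc _ _ Hn HK Hv.
  have : eval n K A c v <= vb c B + vb b B by lia.
  elim: (iota _ _) (eval n K A c v) => //= x l IH acc Hacc; apply: IH.
  by case: ifP; lia.
- have Hs : all (fun x => x <= B + sumn [seq vb a B | a <- s]) (map (fun a => eval n K A a v) s).
    elim: s IHs => //= a s IH [Ha Hs]; apply/andP; split.
      by have := Ha _ _ Hn HK Hv; lia.
    by apply/allP => x /(allP (IH Hs)) /=; lia.
  by apply: IHf => //; lia.
Qed.

(* Most side conditions only compare register numbers; dropping the rest of the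
   context keeps [lia] fast. *)
Ltac clia := first
  [ match goal with
    | B : is_true (3 <= ?t), C : is_true (?t < ?fr), A : is_true (_ + (?fr + _) <= _) |- _ =>
        clear -A B C; lia
    end
  | lia ].

(** * Compilation of expressions *)

Section Compile.
Variables d w : nat.

Notation does := (does d w).
Notation zeroP := (zeroP d w).
Notation incP := (incP d w).
Notation copyP := (copyP d w).
Notation branchP := (branchP d w).
Notation forP := (forP d w).

Definition loopP i n p := zeroP i ;; forP i n p.

(** [r] lists the registers holding the variables, [tgt] receives the value, and registers from [fr]
    on are scratch. The default 2 in [nth 2 r i] is the register that holds zero, in accordance with
    [nth 0 v i] in [eval]. *)
Fixpoint cexp (e : ex) (r : seq nat) (tgt fr : nat) : prog :=
  match e with
  | V i => copyP tgt (nth 2 r i)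
  | Gl b => copyP tgt (if b then 1 else 0)
  | Sc e => cexp e r tgt fr ;; incP tgt
  | IfE a b c c' =>
      cexp a r fr fr.+2 ;; cexp b r fr.+1 fr.+2 ;;
      branchP fr (d + fr.+1) (cexp c r tgt fr.+2) (cexp c' r tgt fr.+2)
  | Rd t e => cexp e r fr fr.+1 ;; zeroP tgt ;; branchP fr t (incP tgt) (go Stay)
  | Sum N b =>
      cexp N r fr fr.+4 ;; zeroP tgt ;;
      loopP fr.+1 fr
        (cexp b (fr.+1 :: r) fr.+2 fr.+4 ;; loopP fr.+3 fr.+2 (incP tgt))
  | Fold N c e b =>
      cexp N r fr fr.+4.+1 ;; cexp c r fr.+1 fr.+4.+1 ;; cexp e r tgt fr.+4.+1 ;;
      loopP fr.+2 fr
        (cexp b [:: tgt, fr.+2 & r] fr.+3 fr.+4.+1 ;; zeroP tgt ;;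
         loopP fr.+4 fr.+1 (branchP fr.+4 (d + fr.+3) (copyP tgt fr.+3) (go Stay)))
  | Ap f s =>
      (fix cargs (s' : seq ex) (i : nat) :=
         if s' is a :: s'' then cexp a r i (fr + size s) ;; cargs s'' i.+1
         else go Stay) s fr ;;
      cexp f (iota fr (size s)) tgt (fr + size s)
  end.

Definition same (fr t : nat) (s s' : st) : Prop :=
  trk s' = trk s /\ forall r, r < fr -> r <> t -> reg s' r = reg s r.

Definition glob n K (s : st) : Prop := [/\ reg s 0 = n, reg s 1 = K & reg s 2 = 0].

Definition vars (r : seq nat) fr t := all (fun x => (x < fr) && (x != t)) r.

Lemma same_trans fr t s s1 s2 : same fr t s s1 -> same fr t s1 s2 -> same fr t s s2.
Proof. by move=> [a1 b1] [a2 b2]; split=> [|r h1 h2]; rewrite ?a2 // b2 // b1. Qed.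

Lemma same_setr fr t i x s : fr <= i -> same fr t s (setr s i x).
Proof. by move=> H; split=> //= r Hr _; case: eqP => // E; lia. Qed.

Lemma same_setr_tgt fr t x s : same fr t s (setr s t x).
Proof. by split=> //= r Hr Ht; case: eqP. Qed.

Lemma same_weak fr t fr' t' s s' : same fr' t' s s' -> fr <= fr' -> (t' = t \/ fr <= t') ->
  same fr t s s'.
Proof. by move=> [a b] H Ht; split=> // r Hr Hn; apply: b; [lia | case: Ht; lia]. Qed.

Lemma same_glob n K fr t s s' : same fr t s s' -> 3 <= fr -> 3 <= t -> glob n K s ->
  glob n K s'.
Proof. by move=> [_ b] H H' [g1 g2 g3]; split; rewrite b //; lia. Qed.

Lemma same_vars fr t s s' r : same fr t s s' -> vars r fr t ->
  map (reg s') r = map (reg s) r.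
Proof.
move=> [_ b]; elim: r => //= x r IH /andP[/andP[h1 h2] h3].
by rewrite IH // b //; apply/eqP.
Qed.

Lemma vars_weak r fr t fr' t' : vars r fr t -> fr <= fr' -> (t' = t \/ fr <= t') ->
  vars r fr' t'.
Proof.
move=> H Hf Ht; apply/allP => x /(allP H) /=; case: Ht => [->|Ht]; first by lia.
by lia.
Qed.

Lemma does_loop i n p (Inv : nat -> st -> Prop) N k s :
  d + i < w -> d + n < w ->
  (forall x s, Inv x s -> reg s i = x /\ reg s n = N) ->
  (forall x s, x < N -> Inv x s ->
     exists s', does p s s' k /\ Inv x.+1 (setr s' i (reg s' i).+1)) ->
  Inv 0 (setr s i 0) ->
  exists s', does (loopP i n p) s s' (N * k.+2 + 2) /\ Inv N s'.
Proof.
move=> Hi Hn HI Hs H0.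
have [s' [D I]] := does_for Hi Hn HI Hs H0.
exists s'; split=> //; apply: (does_seq (does_zero Hi) D); lia.
Qed.

Definition cexp_ok e := forall r tgt fr s v n K B,
  okE d e -> d + (fr + need e) <= w -> 3 <= tgt -> tgt < fr -> vars r fr tgt ->
  v = map (reg s) r -> glob n K s -> n <= B -> K <= B -> all (fun x => x <= B) v ->
  exists s', [/\ does (cexp e r tgt fr) s s' (cb e B), same fr tgt s s'
    & reg s' tgt = eval n K (trk s) e v].

Lemma cexp_sum N b : cexp_ok N -> cexp_ok b -> cexp_ok (Sum N b).
Proof.
move=> IHN IHb r tgt fr s v n K B /= /andP[okN okb] Hw Ht Htf Hr Hv Hg HnB HKB HvB.
have [s1 [D1 S1 E1]] : exists s', [/\ does (cexp N r fr fr.+4) s s' (cb N B),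
    same fr.+4 fr s s' & reg s' fr = eval n K (trk s) N v].
  apply: (IHN) => //; try clia.
  by apply: vars_weak Hr _ _; clia.
set NN := eval _ _ _ N v in E1 *.
have HNN : NN <= vb N B by apply: eval_bound.
set B' := B + vb N B.
pose s1' := setr s1 tgt 0.
have S1' : same fr tgt s s1'.
  apply: same_trans (same_setr_tgt _ _ _ _).
  by apply: same_weak S1 _ _; clia.
have E1' : reg s1' fr = NN by rewrite /= ; case: eqP => //; clia.
pose sm x := \sum_(i <- iota 0 x) eval n K (trk s) b (i :: v).
pose Inv x s' := [/\ same fr tgt s s', reg s' fr = NN, reg s' fr.+1 = x & reg s' tgt = sm x].
pose k := cb b B' + (vb b B' * 3 + 2).
have [s2 [D2 [S2 _ _ E2]]] : exists s', does (loopP fr.+1 fr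
    (cexp b (fr.+1 :: r) fr.+2 fr.+4 ;; loopP fr.+3 fr.+2 (incP tgt))) s1' s' (NN * k.+2 + 2) /\ Inv NN s'.
  apply: does_loop; [clia | clia | by move=> x s' [] | | ]; last first.
    split=> /=.
    - by apply: same_trans S1' _; apply: same_setr; clia.
    - by case: eqP => [|_]; [clia|].
    - by rewrite eqxx.
    - by case: eqP => [|_]; [clia | rewrite eqxx /sm big_nil].
  move=> x s2 Hx [S2 e1 e2 e3].
  have [T2 _] := S2.
  have Hv2 : x :: v = map (reg s2) (fr.+1 :: r) by rewrite /= e2 Hv (same_vars S2 Hr).
  have Hg2 := same_glob S2 (ltnW (leq_ltn_trans Ht Htf)) Ht Hg.
  have Hb2 : all (fun y => y <= B') (x :: v).
    rewrite /= (_ : x <= B') /=; last by rewrite /B'; lia.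
    by apply/allP => y /(allP HvB) /=; rewrite /B'; lia.
  have [s3 [D3 S3 E3]] : exists s', [/\ does (cexp b (fr.+1 :: r) fr.+2 fr.+4) s2 s' (cb b B'),
    same fr.+4 fr.+2 s2 s' & reg s' fr.+2 = eval n K (trk s2) b (x :: v)].
    apply: IHb => //; try (rewrite /B'; lia).
    apply/andP; split; first clia.
    by apply: vars_weak Hr _ _; clia.
  set M := eval n K (trk s2) b (x :: v) in E3.
  have HM : M <= vb b B' by apply: eval_bound => //; rewrite /B'; lia.
  pose Inv2 y s' := [/\ same fr.+2 tgt s3 s', reg s' fr.+2 = M, reg s' fr.+3 = y & reg s' tgt = sm x + y].
  have Etgt : reg s3 tgt = sm x by case: S3 => _ h; rewrite h //; clia.
  have [s4 [D4 [S4 e4 e5 e6]]] : exists s', does (loopP fr.+3 fr.+2 (incP tgt)) s3 s' (M * 3 + 2) /\ Inv2 M s'.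
    apply: does_loop; [clia | clia | by move=> y s' [] | | ]; last first.
      split=> /=.
      - by apply: same_setr; clia.
      - by case: eqP => [|_]; [clia|].
      - by rewrite eqxx.
      - by case: eqP => [|_]; [clia | rewrite addn0].
    move=> y s4 Hy [S4 f1 f2 f3]; exists (setr s4 tgt (reg s4 tgt).+1); split.
      by apply: does_inc; clia.
    split=> /=.
    - apply: same_trans S4 _; apply: same_trans (same_setr_tgt _ _ _ _) _.
      by apply: same_setr; clia.
    - by case: eqP => [|_]; [clia | case: eqP => [|_]; [clia|]].
    - by rewrite eqxx; case: eqP => [|_]; [clia | rewrite f2].
    - by case: eqP => [|_]; [clia | rewrite eqxx f3 addnS].
  exists s4; split.
    apply: (does_seq D3 D4); rewrite /k; nia.
  have S34 : same fr tgt s2 s4.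
    apply: (@same_trans _ _ _ s3); first by apply: same_weak S3 _ _; clia.
    by apply: same_weak S4 _ _; clia.
  have r1 : reg s4 fr.+1 = x.
    by case: S4 => _ h; rewrite h; [case: S3 => _ h'; rewrite h' //; clia | clia | clia].
  have r2 : reg s4 fr = NN.
    by case: S4 => _ h; rewrite h; [case: S3 => _ h'; rewrite h' //; clia | clia | clia].
  split=> /=.
  - by apply: same_trans S2 _; apply: same_trans S34 _; apply: same_setr; clia.
  - by case: eqP => [|_]; [clia|].
  - by rewrite eqxx r1.
  - case: eqP => [|_]; [clia | rewrite e6 /sm -addn1 iotaD big_cat /= big_seq1 add0n].
    by rewrite /M T2.
exists s2; split=> //.
apply: (does_seq D1 (l := 1 + (NN * k.+2 + 2))).
  by apply: (does_seq _ D2); [apply: does_zero; clia | ].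
have : NN * k.+2 <= vb N B * (cb b B' + 4 + 4 * vb b B').
  by apply: leq_mul => //; rewrite /k; lia.
by rewrite -/B'; lia.
Qed.

Lemma cexp_fold N c e b : cexp_ok N -> cexp_ok c -> cexp_ok e -> cexp_ok b ->
  cexp_ok (Fold N c e b).
Proof.
move=> IHN IHc IHe IHb r tgt fr s v n K B /= /and4P[okN okc oke okb] Hw Ht Htf Hr Hv Hg HnB HKB HvB.
have [s1 [D1 S1 E1]] : exists s', [/\ does (cexp N r fr fr.+4.+1) s s' (cb N B),
    same fr.+4.+1 fr s s' & reg s' fr = eval n K (trk s) N v].
  apply: (IHN) => //; try clia.
  by apply: vars_weak Hr _ _; clia.
set NN := eval _ _ _ N v in E1 *.
have HNN : NN <= vb N B by apply: eval_bound.
have Ss1 : same fr tgt s s1 by apply: same_weak S1 _ _; clia.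
have [T1 _] := S1.
have Hg1 := same_glob Ss1 (ltnW (leq_ltn_trans Ht Htf)) Ht Hg.
have [s2 [D2 S2 E2]] : exists s', [/\ does (cexp c r fr.+1 fr.+4.+1) s1 s' (cb c B),
    same fr.+4.+1 fr.+1 s1 s' & reg s' fr.+1 = eval n K (trk s1) c v].
  apply: (IHc) => //; try clia.
  - by apply: vars_weak Hr _ _; clia.
  - by rewrite Hv (same_vars Ss1 Hr).
rewrite T1 in E2; set CC := eval _ _ _ c v in E2 *.
have HCC : CC <= vb c B by apply: eval_bound.
have Ss2 : same fr tgt s s2.
  by apply: same_trans Ss1 _; apply: same_weak S2 _ _; clia.
have [T2 _] := Ss2.
have Hg2 := same_glob Ss2 (ltnW (leq_ltn_trans Ht Htf)) Ht Hg.
have E1' : reg s2 fr = NN by case: S2 => _ h; rewrite h //; clia.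
have [s3 [D3 S3 E3]] : exists s', [/\ does (cexp e r tgt fr.+4.+1) s2 s' (cb e B),
    same fr.+4.+1 tgt s2 s' & reg s' tgt = eval n K (trk s2) e v].
  apply: (IHe) => //; try clia.
  - by apply: vars_weak Hr _ _; clia.
  - by rewrite Hv (same_vars Ss2 Hr).
rewrite T2 in E3.
have HEE : eval n K (trk s) e v <= vb e B by apply: eval_bound.
have Ss3 : same fr tgt s s3.
  by apply: same_trans Ss2 _; apply: same_weak S3 _ _; clia.
set B' := B + vb N B + vb c B + vb e B.
pose fd x := foldl (fun acc x => let r := eval n K (trk s) b [:: acc, x & v] in
                          if r < CC then r else 0) (eval n K (trk s) e v) (iota 0 x).
have Hfd x : fd x <= vb c B + vb e B.
  rewrite /fd; have : eval n K (trk s) e v <= vb c B + vb e B by clia.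
  elim: (iota _ _) (eval n K (trk s) e v) => //= y l IH acc Hacc; apply: IH.
  by case: ifP; clia.
pose Inv x s' := [/\ same fr tgt s s', reg s' fr = NN, reg s' fr.+1 = CC, reg s' fr.+2 = x & reg s' tgt = fd x].
pose k := cb b B' + (1 + (vb c B * 4 + 2)).
have [s4 [D4 [S4 _ _ _ E4]]] : exists s', does (loopP fr.+2 fr
    (cexp b [:: tgt, fr.+2 & r] fr.+3 fr.+4.+1 ;; zeroP tgt ;;
         loopP fr.+4 fr.+1 (branchP fr.+4 (d + fr.+3) (copyP tgt fr.+3) (go Stay)))) s3 s' (NN * k.+2 + 2) /\ Inv NN s'.
  apply: does_loop; [clia | clia | by move=> x s' [] | | ]; last first.
    split=> /=.
    - by apply: same_trans Ss3 _; apply: same_setr; clia.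
    - by case: eqP => [|_]; [clia|]; case: S3 => _ h; rewrite h //; clia.
    - by case: eqP => [|_]; [clia|]; case: S3 => _ h; rewrite h //; clia.
    - by rewrite eqxx.
    - by case: eqP => [|_]; [clia | rewrite E3].
  move=> x s4 Hx [S4 e1 e2 e3 e4].
  have [T4 _] := S4.
  have Hv4 : [:: fd x, x & v] = map (reg s4) [:: tgt, fr.+2 & r] by rewrite /= e3 e4 Hv (same_vars S4 Hr).
  have Hg4 := same_glob S4 (ltnW (leq_ltn_trans Ht Htf)) Ht Hg.
  have Hb4 : all (fun y => y <= B') [:: fd x, x & v].
    have Hf : fd x <= B' by apply: leq_trans (Hfd x) _; rewrite /B' -addnA leq_addl.
    have Hx' : x <= B' by apply: leq_trans (ltnW Hx) _; rewrite /B'; lia.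
    rewrite /= Hf Hx' /=; apply/allP => y /(allP HvB) /= Hy.
    by apply: leq_trans Hy _; rewrite /B' -!addnA leq_addr.
  have [s5 [D5 S5 E5]] : exists s', [/\ does (cexp b [:: tgt, fr.+2 & r] fr.+3 fr.+4.+1) s4 s' (cb b B'),
    same fr.+4.+1 fr.+3 s4 s' & reg s' fr.+3 = eval n K (trk s4) b [:: fd x, x & v]].
    apply: IHb => //; try (rewrite /B'; lia).
    apply/and3P; split; try clia.
    by apply: vars_weak Hr _ _; clia.
  rewrite T4 in E5; set M := eval n K (trk s) b _ in E5.
  pose s6 := setr s5 tgt 0.
  (* As [y] runs through the values below the cap, the target is set to [M] when [y] meets it; if
     [M] is not below the cap, the target keeps its 0. This is the clipping. *)
  pose Inv2 y s' := [/\ same fr.+4 tgt s6 s', reg s' fr.+4 = y & reg s' tgt = if M < y then M else 0].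
  have r1 : reg s5 fr = NN by case: S5 => _ h; rewrite h //; clia.
  have r2 : reg s5 fr.+1 = CC by case: S5 => _ h; rewrite h //; clia.
  have r3 : reg s5 fr.+2 = x by case: S5 => _ h; rewrite h //; clia.
  have [s7 [D7 [S7 e5 e6]]] : exists s', does (loopP fr.+4 fr.+1 (branchP fr.+4 (d + fr.+3) (copyP tgt fr.+3) (go Stay))) s6 s' (CC * 4 + 2) /\ Inv2 CC s'.
    apply: does_loop; [clia | clia | | | ]; last first.
    - split=> /=.
      + by apply: same_setr; clia.
      + by rewrite eqxx.
      + by case: eqP => [|_]; [clia | rewrite eqxx].
    - move=> y s7 Hy [S7 f1 f2].
      have f3 : reg s7 fr.+3 = M.
        by case: S7 => _ h; rewrite h /=; [case: eqP => [|_]; [clia|] | clia | clia].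
      have Hl : lane d s7 (d + fr.+3) (reg s7 fr.+4) = (M == y) by rewrite lane_reg f3 f1.
      have [My|My] := eqVneq M y.
        exists (setr s7 tgt M); split.
          apply: does_if; [clia | clia | rewrite Hl My eqxx -My -f3].
          by apply: does_copy; clia.
        split=> /=.
        * apply: same_trans S7 _; apply: same_trans (same_setr_tgt _ _ _ _) _.
          by apply: same_setr; clia.
        * by rewrite eqxx; case: eqP => [|_]; [clia | rewrite f1].
        * by case: eqP => [|_]; [clia | rewrite eqxx My ltnSn].
      exists s7; split.
        apply: does_if; [clia | clia | rewrite Hl (negbTE My)].
        exact: does_skip.
      split=> /=.
      * by apply: same_trans S7 _; apply: same_setr; clia.
      * by rewrite eqxx f1.
      * by case: eqP => [|_]; [clia | rewrite f2 ltnS [M <= y]leq_eqVlt (negbTE My)].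
    move=> y s' [Sy g1 _]; split=> //; case: Sy => _ h; rewrite h; [|clia|clia].
    by rewrite /=; case: eqP => [|_]; [clia|].
  exists s7; split.
    apply: (does_seq D5 (l := 1 + (vb c B * 4 + 2))); last by rewrite /k.
    apply: (does_seq _ D7); [by apply: does_zero; clia | clia].
  have S47 : same fr tgt s4 s7.
    apply: (@same_trans _ _ _ s5); first by apply: same_weak S5 _ _; clia.
    apply: (@same_trans _ _ _ s6); first exact: same_setr_tgt.
    by apply: same_weak S7 _ _; clia.
  have r6 : forall i, i < 3 -> reg s7 (fr + i) = reg s5 (fr + i).
    move=> i Hi; case: S7 => _ h; rewrite h; [|clia|clia].
    by rewrite /=; case: eqP => [|_]; [clia|].
  have := r6 0 isT; have := r6 1 isT; have := r6 2 isT.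
  rewrite addn0 addn1 addn2 r1 r2 r3 => q3 q2 q1.
  split=> /=.
  - by apply: same_trans S4 _; apply: same_trans S47 _; apply: same_setr; clia.
  - by case: eqP => [|_]; [clia|].
  - by case: eqP => [|_]; [clia|].
  - by rewrite eqxx q3.
  - case: eqP => [|_]; [clia | rewrite e6 /fd -[x.+1]addn1 iotaD foldl_cat /= add0n].
    by rewrite -/(fd x).
exists s4; split=> //.
apply: (does_seq D1 (l := cb c B + (cb e B + (NN * k.+2 + 2)))).
  by apply: (does_seq D2 _ (leqnn _)); apply: (does_seq D3 D4 (leqnn _)).
have : NN * k.+2 <= vb N B * (cb b B' + 5 + 4 * vb c B).
  by apply: leq_mul => //; rewrite /k; lia.
by rewrite -/B'; lia.
Qed.

Lemma cexp_correct e : cexp_ok e.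
Proof.
elim/ex_ind': e => [i|b|e IH|a b c c' IHa IHb IHc IHd|t e IH|a b IHa IHb
  |a b c c' IHa IHb IHc IHd|f l IHf IHs];
  try by [apply: cexp_sum | apply: cexp_fold];
  move=> r tgt fr s v n K B /= Hok Hw Ht Htf Hr Hv Hg HnB HKB HvB.
- have Hi : nth 2 r i != tgt /\ d + nth 2 r i < w.
    have [Hi|Hi] := ltnP i (size r); last by rewrite nth_default //; clia.
    by have := allP Hr _ (mem_nth 2 Hi); rewrite /=; clia.
  exists (setr s tgt (reg s (nth 2 r i))); split.
  + by apply: does_copy; [clia | case: Hi | rewrite eq_sym; case: Hi].
  + exact: same_setr_tgt.
  + rewrite /= eqxx Hv; have [Hi'|Hi'] := ltnP i (size r); first by rewrite (nth_map 2).
    by rewrite nth_default // nth_default ?size_map //; case: Hg.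
- exists (setr s tgt (reg s (if b then 1 else 0))); split.
  + by apply: does_copy; case: b; clia.
  + exact: same_setr_tgt.
  + by rewrite /= eqxx; case: Hg => g1 g2 _; case: b.
- have [s1 [D1 S1 E1]] := IH r tgt fr s v n K B Hok Hw Ht Htf Hr Hv Hg HnB HKB HvB.
  exists (setr s1 tgt (reg s1 tgt).+1); split.
  + by apply: (does_seq D1 (l := 1)); [apply: does_inc; clia | rewrite addn1].
  + by apply: same_trans S1 _; apply: same_setr_tgt.
  + by rewrite /= eqxx E1.
- move: Hok => /and4P[oka okb okc okd].
  have [s1 [D1 S1 E1]] : exists s', [/\ does (cexp a r fr fr.+2) s s' (cb a B),
      same fr.+2 fr s s' & reg s' fr = eval n K (trk s) a v].
    apply: IHa => //; try clia.
    by apply: vars_weak Hr _ _; clia.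
  have Ss1 : same fr tgt s s1 by apply: same_weak S1 _ _; clia.
  have [T1 _] := S1.
  have Hg1 := same_glob Ss1 (ltnW (leq_ltn_trans Ht Htf)) Ht Hg.
  have [s2 [D2 S2 E2]] : exists s', [/\ does (cexp b r fr.+1 fr.+2) s1 s' (cb b B),
      same fr.+2 fr.+1 s1 s' & reg s' fr.+1 = eval n K (trk s1) b v].
    apply: IHb => //; try clia.
    + by apply: vars_weak Hr _ _; clia.
    + by rewrite Hv (same_vars Ss1 Hr).
  rewrite T1 in E2.
  have Ss2 : same fr tgt s s2.
    by apply: same_trans Ss1 _; apply: same_weak S2 _ _; clia.
  have [T2 _] := Ss2.
  have Hg2 := same_glob Ss2 (ltnW (leq_ltn_trans Ht Htf)) Ht Hg.
  have E1' : reg s2 fr = eval n K (trk s) a v by case: S2 => _ h; rewrite h //; clia.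
  have Hbr x : cexp_ok x -> okE d x -> need x <= need c + need c' ->
      exists s', [/\ does (cexp x r tgt fr.+2) s2 s' (cb x B), same fr.+2 tgt s2 s'
                  & reg s' tgt = eval n K (trk s2) x v].
    move=> IHx okx Hx; apply: IHx => //; try clia.
    + by apply: vars_weak Hr _ _; clia.
    + by rewrite Hv (same_vars Ss2 Hr).
  rewrite T2 in Hbr.
  pose bt := eval n K (trk s) a v == eval n K (trk s) b v.
  have [s3 [D3 S3 E3]] : exists s', [/\ does (if bt then cexp c r tgt fr.+2 else cexp c' r tgt fr.+2) s2 s' (cb c B + cb c' B),
      same fr.+2 tgt s2 s' & reg s' tgt = if bt then eval n K (trk s) c v else eval n K (trk s) c' v].
    have [s3 [D3 S3 E3]] := Hbr c IHc okc (leq_addr _ _).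
    have [s4 [D4 S4 E4]] := Hbr c' IHd okd (leq_addl _ _).
    case: bt; [exists s3 | exists s4]; split=> //.
      by apply: does_le D3 _; clia.
    by apply: does_le D4 _; clia.
  exists s3; split=> //; last by apply: same_trans Ss2 _; apply: same_weak S3 _ _; clia.
  apply: (does_seq D1 (l := cb b B + (cb c B + cb c' B).+1)); last clia.
  apply: (does_seq D2 (l := (cb c B + cb c' B).+1)) => //.
  apply: does_if; [clia | clia |].
  by rewrite lane_reg E1' E2 eq_sym; move: D3; rewrite /bt; case: (_ == _).
- move: Hok => /andP[Htd ok].
  have [s1 [D1 S1 E1]] : exists s', [/\ does (cexp e r fr fr.+1) s s' (cb e B),
      same fr.+1 fr s s' & reg s' fr = eval n K (trk s) e v].
    apply: IH => //; try clia.
    by apply: vars_weak Hr _ _; clia.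
  have Ss1 : same fr tgt s s1 by apply: same_weak S1 _ _; clia.
  have [T1 _] := S1.
  pose s2 := setr s1 tgt 0.
  pose x := trk s t (eval n K (trk s) e v).
  have Ss2 : same fr tgt s s2 by apply: same_trans Ss1 _; apply: same_setr_tgt.
  exists (if x then setr s2 tgt (reg s2 tgt).+1 else s2); split.
  + apply: (does_seq D1 (l := 1 + 2)); last clia.
    apply: (does_seq (l := 2) _ _ (leqnn _)); first by apply: does_zero; clia.
    apply: does_if; [clia | clia |].
    rewrite lane_trk //= (_ : (fr == tgt) = false); last clia.
    rewrite E1 T1 -/x; case: x; first by apply: does_inc; clia.
    exact: does_skip.
  + by case: x => //; apply: same_trans Ss2 _; apply: same_setr_tgt.
  + by rewrite -/x; case: x; rewrite /= eqxx.
- move: Hok => /andP[okf oks].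
  set base := fr + size l.
  pose cargs := fix cargs (s' : seq ex) (i : nat) :=
         if s' is a :: s'' then cexp a r i base ;; cargs s'' i.+1 else go Stay.
  have Hargs : forall l' i s1, eachP cexp_ok l' -> all (okE d) l' ->
      d + (base + sumn (map need l')) <= w -> fr <= i -> i + size l' = base ->
      same fr tgt s s1 ->
      exists s', [/\ does (cargs l' i) s1 s' (sumn (map (fun a => cb a B) l') + 1), same i tgt s1 s'
        & map (reg s') (iota i (size l')) = map (fun a => eval n K (trk s) a v) l'].
    elim=> [|a l' IH] i s1 /=.
      by move=> *; exists s1; split=> //; apply: does_skip.
    move=> [Ha Hl] /andP[oka okl] Hw1 Hi Hb Ss1; have [T1 _] := Ss1.
    have Hg1 := same_glob Ss1 (ltnW (leq_ltn_trans Ht Htf)) Ht Hg.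
    have [s2 [D2 S2 E2]] : exists s', [/\ does (cexp a r i base) s1 s' (cb a B),
        same base i s1 s' & reg s' i = eval n K (trk s1) a v].
      apply: Ha => //; try clia.
      + by apply: vars_weak Hr _ _; clia.
      + by rewrite Hv (same_vars Ss1 Hr).
    have [s3 [D3 S3 E3]] : exists s', [/\ does (cargs l' i.+1) s2 s' (sumn (map (fun a => cb a B) l') + 1), same i.+1 tgt s2 s'
        & map (reg s') (iota i.+1 (size l')) = map (fun a => eval n K (trk s) a v) l'].
      apply: IH => //; try clia.
      by apply: same_trans Ss1 _; apply: same_weak S2 _ _; clia.
    exists s3; split.
    + by apply: (does_seq D2 D3); clia.
    + apply: (@same_trans _ _ _ s2); first by apply: same_weak S2 _ _; clia.
      by apply: same_weak S3 _ _; clia.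
    + by rewrite E3; case: S3 => _ h; rewrite h ?E2 ?T1 //; clia.
  have [s1 [D1 S1 E1]] := Hargs l fr s IHs oks ltac:(rewrite /base; clia) (leqnn _) (erefl _) (conj (erefl _) (fun _ _ _ => erefl _)).
  have [T1 _] := S1.
  have Hg1 := same_glob S1 (ltnW (leq_ltn_trans Ht Htf)) Ht Hg.
  have [s2 [D2 S2 E2]] : exists s', [/\ does (cexp f (iota fr (size l)) tgt base) s1 s' (cb f (B + sumn (map (fun a => vb a B) l))),
      same base tgt s1 s' & reg s' tgt = eval n K (trk s1) f (map (fun a => eval n K (trk s) a v) l)].
    apply: IHf => //; try (rewrite /base; clia).
    + by apply/allP => x; rewrite mem_iota /base; clia.
    + elim: (l) => //= a l' IHl; apply/andP; split.
        by have := eval_bound a (trk s) HnB HKB HvB; clia.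
      by apply/allP => x /(allP IHl) /=; clia.
  exists s2; split.
  + by apply: (does_seq D1 D2); clia.
  + by apply: same_trans S1 _; apply: same_weak S2 _ _; rewrite /base; clia.
  + by rewrite E2 T1.
Qed.

End Compile.

(* [Wr t e1 e2] sets track [t] at position [e1] to [e2 != 0]; [Fr N c] pushes the loop index. *)
Inductive cmd :=
| Wr of nat & ex & ex
| Sqc of cmd & cmd
| Fr of ex & cmd.

Fixpoint semc (n K : nat) (c : cmd) (v : seq nat) (A : tracks) : tracks :=
  match c with
  | Wr t e1 e2 => setF A t (eval n K A e1 v) (eval n K A e2 v != 0)
  | Sqc c1 c2 => semc n K c2 v (semc n K c1 v A)
  | Fr N c => foldl (fun A x => semc n K c (x :: v) A) A (iota 0 (eval n K A N v))
  end.

Fixpoint cbc (c : cmd) (B : nat) : nat :=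
  match c with
  | Wr t e1 e2 => cb e1 B + cb e2 B + 2
  | Sqc c1 c2 => cbc c1 B + cbc c2 B
  | Fr N c => cb N B + (vb N B * (cbc c (B + vb N B) + 2) + 2)
  end.

Fixpoint needc (c : cmd) : nat :=
  match c with
  | Wr t e1 e2 => 2 + need e1 + need e2
  | Sqc c1 c2 => needc c1 + needc c2
  | Fr N c => 2 + need N + needc c
  end.

Fixpoint okC (d : nat) (c : cmd) : bool :=
  match c with
  | Wr t e1 e2 => [&& t < d, okE d e1 & okE d e2]
  | Sqc c1 c2 => okC d c1 && okC d c2
  | Fr N c => okE d N && okC d c
  end.

(** * Compilation of commands *)

Section Commands.
Variables d w : nat.

Fixpoint ccmd (c : cmd) (r : seq nat) (fr : nat) : prog :=
  match c with
  | Wr t e1 e2 =>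
      cexp d w e1 r fr fr.+2 ;; cexp d w e2 r fr.+1 fr.+2 ;;
      branchP d w fr.+1 (d + 2) (writeP d w t fr false) (writeP d w t fr true)
  | Sqc c1 c2 => ccmd c1 r fr ;; ccmd c2 r fr
  | Fr N c =>
      cexp d w N r fr fr.+2 ;; loopP d w fr.+1 fr (ccmd c (fr.+1 :: r) fr.+2)
  end.

Definition keep (fr : nat) (s s' : st) : Prop := forall r, r < fr -> reg s' r = reg s r.

Lemma keep_glob n K fr s s' : keep fr s s' -> 3 <= fr -> glob n K s -> glob n K s'.
Proof. by move=> b H [g1 g2 g3]; split; rewrite b //; lia. Qed.

Lemma keep_vars fr s s' r : keep fr s s' -> all (fun x => x < fr) r ->
  map (reg s') r = map (reg s) r.
Proof. by move=> b; elim: r => //= x r IH /andP[h1 h2]; rewrite IH // b. Qed.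

Lemma keep_trans fr s s1 s2 : keep fr s s1 -> keep fr s1 s2 -> keep fr s s2.
Proof. by move=> a b r Hr; rewrite b // a. Qed.

Lemma same_keep fr fr' t s s' : same fr' t s s' -> fr <= fr' -> fr <= t -> keep fr s s'.
Proof. by move=> [_ b] h h' r Hr; apply: b; lia. Qed.

(** Expression bounds do not depend on the tracks, so one [B] covers all rounds of a loop even
    though the body rewrites the tracks it reads. *)
Lemma ccmd_correct c : forall r fr s v n K B,
  okC d c -> d + (fr + needc c) <= w -> 3 <= fr -> all (fun x => x < fr) r ->
  v = map (reg s) r -> glob n K s -> n <= B -> K <= B -> all (fun x => x <= B) v ->
  exists s', [/\ does d w (ccmd c r fr) s s' (cbc c B), keep fr s s'
    & trk s' = semc n K c v (trk s)].
Proof.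
elim: c => [t e1 e2|c1 IH1 c2 IH2|N c IH] r fr s v n K B /=.
- move=> /and3P[Htd ok1 ok2] Hw Hfr Hr Hv Hg HnB HKB HvB.
  have Hr2 t' : fr <= t' -> vars r fr.+2 t'.
    by move=> Ht'; apply/allP => x /(allP Hr) /=; lia.
  have [s1 [D1 S1 E1]] : exists s', [/\ does d w (cexp d w e1 r fr fr.+2) s s' (cb e1 B),
      same fr.+2 fr s s' & reg s' fr = eval n K (trk s) e1 v].
    by apply: cexp_correct => //; try lia; apply: Hr2.
  have [T1 _] := S1.
  have k1 : keep fr s s1 by apply: same_keep S1 _ _; lia.
  have [s2 [D2 S2 E2]] : exists s', [/\ does d w (cexp d w e2 r fr.+1 fr.+2) s1 s' (cb e2 B),
      same fr.+2 fr.+1 s1 s' & reg s' fr.+1 = eval n K (trk s1) e2 v].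
    apply: cexp_correct => //; try lia.
    + exact: Hr2.
    + by rewrite Hv (keep_vars k1).
    + exact: keep_glob k1 _ Hg.
  have [T2 _] := S2.
  have k2 : keep fr s s2.
    by apply: keep_trans k1 _; apply: same_keep S2 _ _; lia.
  have E1' : reg s2 fr = eval n K (trk s) e1 v by case: S2 => _ h; rewrite h //; lia.
  have [_ _ z2] := keep_glob k2 Hfr Hg.
  exists (sett s2 t (reg s2 fr) (eval n K (trk s) e2 v != 0)); split.
  + apply: (does_seq D1 (l := cb e2 B + 2)); last lia.
    apply: (does_seq D2 _ (leqnn _)); apply: does_if; [lia | lia |].
    (* Lane [d + 2] belongs to the register holding zero, so the branch tests whether the value to
       be written is zero. *)
    rewrite lane_reg z2 E2 T1 eq_sym; case: (_ == 0) => /=.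
      by apply: does_write; lia.
    by apply: does_write; lia.
  + by move=> x Hx; apply: k2.
  + by rewrite /= E1' T2 T1.
- move=> /andP[ok1 ok2] Hw Hfr Hr Hv Hg HnB HKB HvB.
  have [|s1 [D1 k1 T1]] := IH1 r fr s v n K B ok1 _ Hfr Hr Hv Hg HnB HKB HvB; first lia.
  have [||s2 [D2 k2 T2]] := IH2 r fr s1 v n K B ok2 _ Hfr Hr _ (keep_glob k1 Hfr Hg) HnB HKB HvB.
  + lia.
  + by rewrite Hv (keep_vars k1).
  exists s2; split.
  + exact: (does_seq D1 D2).
  + exact: keep_trans k2.
  + by rewrite T2 T1.
- move=> /andP[okN okc] Hw Hfr Hr Hv Hg HnB HKB HvB.
  have [s1 [D1 S1 E1]] : exists s', [/\ does d w (cexp d w N r fr fr.+2) s s' (cb N B),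
      same fr.+2 fr s s' & reg s' fr = eval n K (trk s) N v].
    apply: cexp_correct => //; try lia.
    by apply/allP => x /(allP Hr) /=; lia.
  have [T1 _] := S1.
  have k1 : keep fr s s1 by apply: same_keep S1 _ _; lia.
  set NN := eval _ _ _ N v in E1 *.
  have HNN : NN <= vb N B by apply: eval_bound.
  pose k := cbc c (B + vb N B).
  pose sm x := foldl (fun A x => semc n K c (x :: v) A) (trk s) (iota 0 x).
  pose Inv x s' := [/\ keep fr s s', reg s' fr = NN, reg s' fr.+1 = x & trk s' = sm x].
  have [s2 [D2 [k2 _ _ T2]]] : exists s', does d w (loopP d w fr.+1 fr (ccmd c (fr.+1 :: r) fr.+2)) s1 s' (NN * k.+2 + 2) /\ Inv NN s'.
    apply: does_loop; [lia | lia | by move=> x s' [] | | ]; last first.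
      split=> /=.
      + by move=> x Hx /=; case: eqP => [|_]; [lia | apply: k1].
      + by case: eqP => [|_]; [lia|].
      + by rewrite eqxx.
      + by rewrite T1.
    move=> x s2 Hx [k2 f1 f2 f3].
    have [s3 [D3 k3 T3]] : exists s', [/\ does d w (ccmd c (fr.+1 :: r) fr.+2) s2 s' k, keep fr.+2 s2 s'
        & trk s' = semc n K c (x :: v) (trk s2)].
      apply: IH => //; try lia.
      + by rewrite /= ltnSn /=; apply/allP => y /(allP Hr) /=; lia.
      + by rewrite /= f2 Hv (keep_vars k2).
      + exact: keep_glob k2 _ Hg.
      + rewrite /= (_ : x <= _) /=; last lia.
        by apply/allP => y /(allP HvB) /=; lia.
    exists s3; split=> //; split=> /=.
    + by move=> y Hy /=; case: eqP => [|_]; [lia | rewrite k3 ?k2 //; lia].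
    + by case: eqP => [|_]; [lia | rewrite k3 //; lia].
    + by rewrite eqxx k3 ?f2.
    + by rewrite T3 f3 /sm -addn1 iotaD foldl_cat.
  exists s2; split=> //.
  apply: (does_seq D1 D2); rewrite leq_add2l leq_add2r leq_mul // /k; lia.
Qed.

End Commands.

(** * From commands to Turing machines *)

(** The base [x + 2] is at least 2 for every [x], so constants and sums are absorbed by a larger
    exponent. *)
Definition polyb (f : nat -> nat) : Prop := exists c, forall x, f x <= x.+2 ^ c.

Lemma polyb_le f g : polyb g -> (forall x, f x <= g x) -> polyb f.
Proof. by move=> [c Hc] H; exists c => x; apply: leq_trans (H x) (Hc x). Qed.

Lemma polyb_id : polyb id.
Proof. by exists 1 => x; rewrite expn1 ltnW. Qed.

Lemma polyb_const a : polyb (fun=> a).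
Proof.
exists a => x; apply: (@leq_trans (2 ^ a)); first exact: ltnW (ltn_expl _ _).
by case: a => // a; rewrite leq_exp2r.
Qed.

Lemma polyb_mul f g : polyb f -> polyb g -> polyb (fun x => f x * g x).
Proof. by move=> [a Ha] [b Hb]; exists (a + b) => x; rewrite expnD leq_mul. Qed.

Lemma polyb_add f g : polyb f -> polyb g -> polyb (fun x => f x + g x).
Proof.
move=> [a Ha] [b Hb]; exists (a + b).+1 => x.
have h1 : x.+2 ^ a <= x.+2 ^ (a + b) by rewrite leq_pexp2l // leq_addr.
have h2 : x.+2 ^ b <= x.+2 ^ (a + b) by rewrite leq_pexp2l // leq_addl.
have := Ha x; have := Hb x; rewrite expnS; nia.
Qed.

Lemma polyb_comp f g : polyb f -> polyb g -> polyb (fun x => f (g x)).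
Proof.
move=> [a Ha] [b Hb]; exists (b.+2 * a) => x.
apply: leq_trans (Ha _) _; rewrite expnM.
have h0 : 0 < x.+2 ^ b by rewrite expn_gt0.
have h1 : (g x).+2 <= x.+2 ^ b.+2 by have := Hb x; rewrite !expnS; nia.
by case: (a) => // a'; rewrite leq_exp2r.
Qed.

Lemma polyb_S f : polyb f -> polyb (fun x => (f x).+1).
Proof.
move=> H; apply: polyb_le (polyb_add H (polyb_const 1)) _ => x; lia.
Qed.

Lemma polyb_sumn (F : ex -> nat -> nat) s : eachP (fun e => polyb (F e)) s ->
  polyb (fun B => sumn (map (fun a => F a B) s)).
Proof.
elim: s => [_|a s IH [Ha Hs]] /=; first exact: polyb_const.
by apply: polyb_add => //; apply: IH.
Qed.

Lemma vb_poly e : polyb (vb e).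
Proof.
elim/ex_ind': e => [i|b|e IH|a b c d IHa IHb IHc IHd|t e IH|a b IHa IHb
  |a b c d IHa IHb IHc IHd|f s IHf IHs] /=.
- exact: polyb_id.
- exact: polyb_id.
- exact: polyb_S.
- exact: polyb_add.
- exact: polyb_const.
- by apply: polyb_mul => //; apply: polyb_comp => //; apply: polyb_add => //; exact: polyb_id.
- exact: polyb_add.
- apply: polyb_comp => //; apply: polyb_add; first exact: polyb_id.
  exact: polyb_sumn.
Qed.

Lemma eachP_all P (s : seq ex) : (forall e, P e) -> eachP P s.
Proof. by move=> H; elim: s => //= e s IH; split. Qed.

Ltac poly_auto := repeat first
  [ assumption | exact: vb_poly | exact: polyb_id | exact: polyb_const | apply: polyb_S | apply: polyb_add | apply: polyb_mul ].

Lemma cb_poly e : polyb (cb e).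
Proof.
have Hc f g : polyb f -> polyb g -> polyb (fun x => f (g x)) by exact: polyb_comp.
elim/ex_ind': e => [i|b|e IH|a b c d IHa IHb IHc IHd|t e IH|a b IHa IHb
  |a b c d IHa IHb IHc IHd|f s IHf IHs] /=.
- exact: polyb_const.
- exact: polyb_const.
- exact: polyb_S.
- by poly_auto.
- by poly_auto.
- poly_auto => //; by [apply: (Hc (cb b) (fun B => B + vb a B)); poly_auto
                   | apply: (Hc (vb b) (fun B => B + vb a B)); poly_auto].
- poly_auto => //; by apply: (Hc (cb d) (fun B => B + vb a B + vb b B + vb c B)); poly_auto.
- apply: polyb_add; last exact: polyb_const.
  apply: polyb_add; first exact: polyb_sumn.
  apply: (Hc (cb f) (fun B => B + sumn (map (fun a => vb a B) s))) => //.
  apply: polyb_add; first exact: polyb_id.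
  by apply: polyb_sumn; apply: eachP_all => e; exact: vb_poly.
Qed.

Lemma cbc_poly c : polyb (cbc c).
Proof.
elim: c => [t e1 e2|c1 IH1 c2 IH2|N c IH] /=.
- by apply: polyb_add; [apply: polyb_add; exact: cb_poly | exact: polyb_const].
- exact: polyb_add.
- apply: polyb_add; first exact: cb_poly.
  poly_auto; by apply: (polyb_comp (f := cbc c) (g := fun B => B + vb N B)); poly_auto.
Qed.

(** * Turning the input word into blocks *)

Section Init.
Variables d w : nat.
Hypothesis d0 : 0 < d.
Hypothesis dw : d < w.

Definition retreat := scan MoveR ;; go MoveL.

(** The blank cell -1 separates the unread input from the blocks. The head crosses it and all blocks
    to the left, writes the new block so that it ends where the old ones begin, and returns to cell
    0. *)
Definition feed b :=
  put None MoveL ;; scan MoveL ;; go MoveL ;; scan MoveL ;; goN MoveL w.-1 ;;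
  putN (b :: nseq w.-1 false) ;; scan MoveR ;; go MoveR.

Definition nonblank (s : sym) := s != None.

Definition feeds := Loop nonblank (Cond isone (feed true) (feed false) ;; retreat).

(* The input is consumed from its right end; every bit becomes a block, prepended
   to the blocks on the left of the blank cell [-1]. *)
Definition initP :=
  retreat ;; feeds ;; putN (nseq d false ++ nseq (w - d) true) ;; go MoveL ;; home.

Definition tracks0 (u : seq bool) : tracks := fun t q => (t == 0) && nth false u q.

(** The stage with [r] bits still unread: these occupy the cells from 0 to [r - 1], and the blocks
    of the later bits end just before cell -1. *)
Definition fed (u : seq bool) (r : nat) (T : Z -> sym) : Prop :=
  let H := (- 1 - Z.of_nat ((size u - r) * w))%Z in
  [/\ forall z, (0 <= z < Z.of_nat r)%Z -> T z = Some (nth false u (Z.to_nat z)),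
      forall z, (z = -1 \/ Z.of_nat r <= z)%Z -> T z = None,
      forall q j, q < size u - r -> j < w -> T (cell w H q j) = Some (tracks0 u j (r + q))
    & forall z, (z < H)%Z -> T z = None].

Lemma tx_feed u r T : r < size u -> fed u r.+1 T ->
  exists2 T', fed u r T' &
    tx (Cond isone (feed true) (feed false) ;; retreat) T (Z.of_nat r) T' (Z.of_nat r - 1)
       (20 * ((size u).+1 * w.+2)).
Proof.
move=> Hr [h1 h2 h3 h4].
set m := size u - r.+1 in h3 h4; set H := (- 1 - Z.of_nat (m * w))%Z in h3 h4.
set b := nth false u r.
pose s := b :: nseq w.-1 false.
have Hs : size s = w by rewrite /s /= size_nseq; lia.
pose T1 := updZ T (Z.of_nat r) None.
pose H' := (H - Z.of_nat w)%Z.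
pose T2 := over T1 H' s.
have EH' : H' = (- 1 - Z.of_nat ((size u - r) * w))%Z.
  by rewrite /H' /H /m (_ : size u - r = (size u - r.+1).+1) ?mulSn; lia.
have T1z z : z <> Z.of_nat r -> T1 z = T z by move=> Hz; rewrite /T1 updZ_neq.
have T1r : T1 (Z.of_nat r) = None by rewrite /T1 updZ_eq.
have T2o z : ~ (H' <= z < H)%Z -> T2 z = T1 z.
  move=> Hz; rewrite /T2 /over Hs; case: ifP => //; rewrite /H'; lia.
have T2i z : (H' <= z < H)%Z -> T2 z = Some (nth false s (Z.to_nat (z - H'))).
  by move=> Hz; rewrite /T2 /over Hs; case: ifP => //; rewrite /H'; lia.
have HH : (H <= -1)%Z by rewrite /H; lia.
have mu : m * w <= size u * w by rewrite leq_mul // /m; lia.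
have bl z : (H <= z < -1)%Z -> T z <> None.
  move=> Hz; have [q [j [Hq Hj ->]]] : exists q j, [/\ q < m, j < w & z = cell w H q j].
    by apply: cell_split; rewrite /cell; rewrite /H in Hz *; lia.
  by rewrite h3.
exists T2.
  rewrite /fed -EH'; split.
  - move=> z Hz; rewrite T2o; last lia.
    by rewrite T1z ?h1 //; lia.
  - move=> z Hz; rewrite T2o; last lia.
    have [->|Hzr] := Z.eq_dec z (Z.of_nat r); first exact: T1r.
    by rewrite T1z // h2 //; lia.
  - move=> [|q] j Hq Hj.
      rewrite T2i; last by rewrite /cell /H'; lia.
      rewrite addn0 (_ : Z.to_nat _ = j); last by rewrite /cell; lia.
      by rewrite /tracks0 /s; case: j Hj => //= j Hj; rewrite nth_nseq; case: ifP.
    have E : cell w H' q.+1 j = cell w H q j by rewrite /cell /H' mulSn; lia.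
    have Hq' : q < m by rewrite /m; lia.
    have Hc := cell_lt H Hj Hq'.
    have Hc2 : cell w H m 0 = (-1)%Z by rewrite /cell /H; lia.
    rewrite E T2o; last lia.
    rewrite T1z; last lia.
    by rewrite h3 // addSnnS.
  - by move=> z Hz; rewrite T2o; [rewrite T1z; [apply: h4|]|]; rewrite /H' in Hz *; lia.
have Hfeed : tx (feed b) T (Z.of_nat r) T2 0 (12 * ((size u).+1 * w.+2)).
  pose N := (size u).+1 * w.+2.
  have HN : m * w + size u + w < N by rewrite /N; nia.
  apply: (tx_seq (tx_put _ _ _ _) (l := 11 * N)); last by rewrite /N; nia.
  rewrite -/T1 /=.
  have X : tx (scan MoveL) T1 (Z.of_nat r - 1) T1 (-1) (2 * N).
    apply: tx_le (tx_scanL (a := (-1)%Z) _ _ _) _; [lia | | | lia].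
      by rewrite T1z ?h2 //; lia.
    by move=> z Hz; rewrite T1z ?h1 //; lia.
  apply: (tx_seq X (l := 9 * N)); last lia.
  apply: (tx_seq (tx_go _ _ _) (l := 8 * N)); last lia.
  have {}X : tx (scan MoveL) T1 (shift MoveL (-1)) T1 (H - 1) (2 * N).
    apply: tx_le (tx_scanL (a := (H - 1)%Z) _ _ _) _; [rewrite /=; lia | | | rewrite /= /H; lia].
      by rewrite T1z ?h4 //; lia.
    by move=> z /= Hz; rewrite T1z; [apply: bl|]; lia.
  apply: (tx_seq X (l := 6 * N)); last lia.
  apply: (tx_seq (tx_goL _ _ _) (l := 5 * N)); last lia.
  have E : (H - 1 - Z.of_nat w.-1)%Z = H' by rewrite /H'; lia.
  apply: (tx_seq (tx_putN s _ _) (l := 4 * N)); last by rewrite Hs; lia.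
  rewrite E -/T2 Hs (_ : (H' + Z.of_nat w)%Z = H); last by rewrite /H'; lia.
  have {}X : tx (scan MoveR) T2 H T2 (-1) (2 * N).
    apply: tx_le (tx_scanR (a := (-1)%Z) _ _ _) _; [lia | | | rewrite /H; lia].
      by rewrite T2o ?T1z ?h2 //; lia.
    by move=> z Hz; rewrite T2o ?T1z; [apply: bl| |]; lia.
  apply: (tx_seq X (l := 1)); last lia.
  exact: tx_go.
have Hret : tx retreat T2 0 T2 (Z.of_nat r - 1) (4 * ((size u).+1 * w.+2)).
  apply: (tx_seq (k := r.*2.+1) (l := 1)); [ | exact: tx_go | nia].
  apply: tx_le (tx_scanR (a := Z.of_nat r) _ _ _) _; [lia | | | lia].
    by rewrite T2o ?T1r //; lia.
  by move=> z Hz; rewrite T2o ?T1z ?h1 //; lia.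
apply: (tx_seq (k := (12 * ((size u).+1 * w.+2)).+1) _ Hret); last nia.
apply: tx_cond; rewrite h1; last lia.
rewrite Nat2Z.id -/b /isone; case: (b) Hfeed => //.
Qed.

Lemma tx_feeds u r T : r <= size u -> fed u r T ->
  exists2 T', fed u 0 T' &
    tx feeds T (Z.of_nat r - 1) T' (-1) (r * (21 * ((size u).+1 * w.+2))).+1.
Proof.
elim: r T => [|r IH] T Hr HT.
  by exists T => //; apply: tx_loopF; case: HT => _ h2 _ _; rewrite h2 //; lia.
have [T1 HT1 X1] := tx_feed Hr HT.
have [T2 HT2 X2] := IH T1 (ltnW Hr) HT1.
exists T2 => //.
apply: (tx_loopT _ _ X2 (k := 20 * ((size u).+1 * w.+2))).
- by case: HT => h1 _ _ _; rewrite h1 //; lia.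
- by rewrite (_ : (Z.of_nat r.+1 - 1)%Z = Z.of_nat r) //; lia.
- by rewrite (mulSn r); nia.
Qed.

(** One more block is written from the separator cell -1 on, carrying the marks of all registers.
    Every register thus starts with the input length, which is how register 0 obtains it. *)
Lemma tx_init u : exists H T,
  rep d w H (size u).+1 (St (fun=> size u) (tracks0 u)) T /\
  tx initP (tape_of u) 0 T H (40 * ((size u).+1 * ((size u).+1 * w.+2))).
Proof.
set n := size u.
have H0 : fed u n (tape_of u).
  rewrite /fed -/n subnn /tape_of; split=> //.
  - move=> z Hz; case: Z.ltb_spec => [|_]; first lia.
    by rewrite (nth_map false) // -/n; lia.
  - move=> z Hz; case: Z.ltb_spec => // Hz0; rewrite nth_default // size_map -/n; lia.
  - by move=> z Hz; case: Z.ltb_spec => //; lia.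
have Hret : tx retreat (tape_of u) 0 (tape_of u) (Z.of_nat n - 1) (2 * n + 2).
  have [h1 h2 _ _] := H0.
  apply: (tx_seq (k := n.*2.+1) (l := 1)); [ | exact: tx_go | lia].
  apply: tx_le (tx_scanR (a := Z.of_nat n) _ _ _) _; [lia | | | lia].
    by apply: h2; lia.
  by move=> z Hz; rewrite h1.
have [T1 [_ h2 h3 h4] X1] := tx_feeds (leqnn _) H0.
rewrite subn0 in h3 h4; set H := (_ - _)%Z in h3 h4.
have Hc : cell w H n 0 = (-1)%Z by rewrite /cell /H -/n; lia.
have HB : blocks w H n (tracks0 u) T1.
  split; first by apply: h4; lia.
    by move=> q j Hq Hj; rewrite h3.
  by move=> z Hz; apply: h2; lia.
pose s := nseq d false ++ nseq (w - d) true.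
have Hs : size s = w by rewrite size_cat !size_nseq; lia.
pose st0 := St (fun=> n) (tracks0 u).
have HB0 : blocks w H n (lane d st0) T1.
  apply: blocks_ext HB => j q Hj Hq; rewrite /lane /=; case: ltnP => // Hjd.
  by rewrite /tracks0 (_ : j == 0 = false) /=; lia.
have HB1 : blocks w H n.+1 (lane d st0) (over T1 (cell w H n 0) s).
  apply: blocks_app => // j Hj; rewrite /lane nth_cat size_nseq /=.
  case: ltnP => Hjd; last by rewrite nth_nseq eqxx; case: ifP => //; lia.
  by rewrite nth_nseq Hjd /tracks0 nth_default ?andbF.
exists H, (over T1 (cell w H n 0) s); split.
  split=> // t q Ht Hq /=; rewrite /tracks0 nth_default ?andbF // -/n; lia.
apply: (tx_seq Hret (l := n * (21 * (n.+1 * w.+2)) + 2 + w + 2 + (n.+1 * w).*2.+4)); last by nia.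
apply: (tx_seq X1 (l := w + 3 + (n.+1 * w).*2.+4)); last by rewrite -/n; lia.
rewrite -Hc; apply: (tx_seq (tx_putN s _ _) (l := 1 + (n.+1 * w).*2.+4)); last by rewrite Hs; lia.
apply: (tx_seq (tx_go _ _ _)); last exact: leqnn.
apply: (tx_home HB1); rewrite Hs /cell /=; lia.
Qed.

End Init.

(* Registers 0, 1, 2, 3 hold the input length, the global [K], zero and the result. *)
Section Main.
Variables (d : nat) (c1 : cmd) (e1 : ex) (c2 : cmd) (e2 : ex).

(* Registers 4, 5, 6 are the scratch registers of the doubling loop that computes [K]. *)
Definition width := d + 7 + needc c1 + need e1 + needc c2 + need e2.
Let w := width.

Definition mainP :=
  zeroP d w 1 ;; zeroP d w 2 ;; ccmd d w c1 [::] 4 ;; cexp d w e1 [::] 3 4 ;;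
  zeroP d w 1 ;; incP d w 1 ;;
  loopP d w 4 3 (copyP d w 5 1 ;; loopP d w 6 5 (incP d w 1)) ;;
  ccmd d w c2 [::] 4 ;; cexp d w e2 [::] 3 4.

Definition phase1 (u : seq bool) : tracks := semc (size u) 0 c1 [::] (tracks0 u).
(** Expressions are polynomially bounded, so the exponential number of guesses cannot be the value
    of one over the input alone. It is produced by a separate doubling loop, and the second phase is
    polynomial in it. *)
Definition bigK (u : seq bool) : nat := 2 ^ eval (size u) 0 (phase1 u) e1 [::].
Definition result (u : seq bool) : nat :=
  eval (size u) (bigK u) (semc (size u) (bigK u) c2 [::] (phase1 u)) e2 [::].

Definition cost (B : nat) : nat :=
  cbc c1 B + cb e1 B + (vb e1 B * (3 * B + 5)) + cbc c2 B + cb e2 B + 10.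

Lemma cost_poly : polyb cost.
Proof.
rewrite /cost; do 3! [apply: polyb_add; last by [apply: cb_poly | apply: cbc_poly | apply: polyb_const]].
apply: polyb_add.
  by apply: polyb_add; [apply: cbc_poly | apply: cb_poly].
by poly_auto.
Qed.

(** Register 5 keeps the old value of register 1 while register 1 is incremented that many times. *)
Lemma does_double e s : reg s 1 = 1 -> reg s 3 = e -> d + 7 <= w ->
  exists s', [/\ does d w (loopP d w 4 3 (copyP d w 5 1 ;; loopP d w 6 5 (incP d w 1)))
                   s s' (e * (3 * 2 ^ e + 5) + 2),
    reg s' 1 = 2 ^ e, forall r, r < 4 -> r <> 1 -> reg s' r = reg s r & trk s' = trk s].
Proof.
move=> H1 H3 Hw.
pose Inv x s' := [/\ reg s' 1 = 2 ^ x, reg s' 3 = e, reg s' 4 = x,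
  forall r, r < 4 -> r <> 1 -> reg s' r = reg s r & trk s' = trk s].
have [s' [D [h1 _ _ h2 h3]]] : exists s', does d w (loopP d w 4 3
    (copyP d w 5 1 ;; loopP d w 6 5 (incP d w 1))) s s' (e * (3 * 2 ^ e + 3).+2 + 2) /\ Inv e s'.
  apply: does_loop; [lia | lia | by move=> x s' [] | | ]; last first.
    by split=> //= r Hr _; case: eqP => // E; lia.
  move=> x s1 Hx [f1 f2 f3 f4 f5].
  have Hx2 : 2 ^ x <= 2 ^ e by rewrite leq_exp2l // ltnW.
  pose Inv2 y s' := [/\ reg s' 1 = 2 ^ x + y, reg s' 5 = 2 ^ x, reg s' 6 = y, reg s' 4 = x &
    (forall r, r < 4 -> r <> 1 -> reg s' r = reg s r) /\ trk s' = trk s].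
  have [s2 [D2 [g1 _ _ g3 [g4 g5]]]] : exists s', does d w (loopP d w 6 5 (incP d w 1)) (setr s1 5 (reg s1 1)) s' (2 ^ x * 3 + 2)
      /\ Inv2 (2 ^ x) s'.
    apply: does_loop; [lia | lia | by move=> y s' [] | | ]; last first.
      split=> //=; first by rewrite f1 addn0.
      by split=> // r Hr Hr1; rewrite /= ; do 2! [case: eqP => [?|_]; first lia]; apply: f4.
    move=> y s2 Hy [i1 i2 i3 i4 [i5 i6]].
    exists (setr s2 1 (reg s2 1).+1); split; first by apply: does_inc; lia.
    split=> //=.
    - by rewrite i1 addnS.
    - by rewrite i3.
    - by split=> // r Hr Hr1; rewrite /=; do 2! [case: eqP => [?|_]; first lia]; apply: i5.
  exists s2; split.
    by apply: (does_seq (k := 1) _ D2); [apply: does_copy; lia | lia].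
  split=> //=.
  - by rewrite g1 expnS mul2n addnn.
  - by rewrite g4.
  - by rewrite g3.
  - by move=> r Hr Hr1; case: eqP => [?|_]; [lia | apply: g4].
exists s'; split=> //; apply: (does_le D); lia.
Qed.

Hypothesis okc1 : okC d c1.
Hypothesis oke1 : okE d e1.
Hypothesis okc2 : okC d c2.
Hypothesis oke2 : okE d e2.

Lemma mainP_correct u : exists s',
  [/\ does d w mainP (St (fun=> size u) (tracks0 u)) s' (cost (size u + bigK u)),
      reg s' 2 = 0 & reg s' 3 = result u].
Proof.
(* One bound serves both phases: register 1 holds 0 in the first and [K] in the second. *)
set n := size u; set K := bigK u; set B := n + K.
pose s0 := setr (setr (St (fun=> n) (tracks0 u)) 1 0) 2 0.
have g0 : glob n 0 s0 by [].
have [s1 [D1 k1 T1]] : exists s', [/\ does d w (ccmd d w c1 [::] 4) s0 s' (cbc c1 B), keep 4 s0 s'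
    & trk s' = semc n 0 c1 [::] (trk s0)].
  by apply: ccmd_correct => //; rewrite /w /width /B; lia.
have g1 := keep_glob k1 isT g0.
have {}T1 : trk s1 = phase1 u by rewrite T1.
have [s2 [D2 S2 E2]] : exists s', [/\ does d w (cexp d w e1 [::] 3 4) s1 s' (cb e1 B), same 4 3 s1 s'
    & reg s' 3 = eval n 0 (trk s1) e1 [::]].
  by apply: cexp_correct => //; rewrite /w /width /B; lia.
have g2 := same_glob S2 isT isT g1.
have T2 : trk s2 = phase1 u by case: S2 => ->.
rewrite T1 in E2; set e := eval n 0 _ e1 [::] in E2.
have EK : K = 2 ^ e by [].
have He : e <= vb e1 B by apply: eval_bound => //; rewrite /B; lia.
pose s3 := setr (setr s2 1 0) 1 1.
have [s4 [D4 h1 h2 h3]] : exists s', [/\ does d w (loopP d w 4 3 (copyP d w 5 1 ;; loopP d w 6 5 (incP d w 1)))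
                   s3 s' (e * (3 * 2 ^ e + 5) + 2),
    reg s' 1 = 2 ^ e, forall r, r < 4 -> r <> 1 -> reg s' r = reg s3 r & trk s' = trk s3].
  by apply: does_double => //=; rewrite /w /width; lia.
have g4 : glob n K s4.
  by case: g2 => x y z; split; [rewrite h2 | | rewrite h2].
have [s5 [D5 k5 T5]] : exists s', [/\ does d w (ccmd d w c2 [::] 4) s4 s' (cbc c2 B), keep 4 s4 s'
    & trk s' = semc n K c2 [::] (trk s4)].
  by apply: ccmd_correct => //; rewrite /w /width /B; lia.
have g5 := keep_glob k5 isT g4.
have [s6 [D6 S6 E6]] : exists s', [/\ does d w (cexp d w e2 [::] 3 4) s5 s' (cb e2 B), same 4 3 s5 s'
    & reg s' 3 = eval n K (trk s5) e2 [::]].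
  by apply: cexp_correct => //; rewrite /w /width /B; lia.
have [_ _ g6] := same_glob S6 isT isT g5.
exists s6; split=> //; last by rewrite E6 T5 h3 /= T2.
have Z i s : i < 7 -> does d w (zeroP d w i) s (setr s i 0) 1.
  by move=> Hi; apply: does_zero; rewrite /w /width; lia.
have D : e * (3 * 2 ^ e + 5) <= vb e1 B * (3 * B + 5).
  by apply: leq_mul => //; rewrite -EK /B; lia.
apply: (does_seq (Z 1 _ isT) (l := cost B - 1)); last by rewrite /cost; lia.
apply: (does_seq (Z 2 _ isT) (l := cost B - 2)); last by rewrite /cost; lia.
apply: (does_seq D1 (l := cost B - 2 - cbc c1 B)); last by rewrite /cost; lia.
apply: (does_seq D2 (l := cost B - 2 - cbc c1 B - cb e1 B)); last by rewrite /cost; lia.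
apply: (does_seq (Z 1 _ isT) (l := cost B - 3 - cbc c1 B - cb e1 B)); last by rewrite /cost; lia.
apply: (@does_seq _ _ _ _ _ s3 _ 1 (cost B - 4 - cbc c1 B - cb e1 B)); last by rewrite /cost; lia.
  by apply: does_inc; rewrite /w /width; lia.
apply: (does_seq D4 (l := cbc c2 B + cb e2 B)); last by rewrite /cost; lia.
exact: (does_seq D5 D6).
Qed.

Lemma main_run u : 0 < d -> exists H L T s',
  [/\ rep d w H L s' T, L <= cost (size u + bigK u) + (size u).+1, reg s' 2 = 0,
    reg s' 3 = result u &
    tx (initP d w ;; mainP) (tape_of u) 0 T H
       (40 * ((size u).+1 * ((size u).+1 * w.+2)) +
        cost (size u + bigK u) * (cw w * ((size u).+1 + cost (size u + bigK u)).+1))].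
Proof.
move=> d0; have dw : d < w by rewrite /w /width; lia.
have [H [T [R X]]] := tx_init d0 dw u.
have [s' [D z2 z3]] := mainP_correct u.
have [L' [T' [R' HL X']]] := D _ _ _ R.
exists H, L', T', s'; split=> //; first lia.
exact: (tx_seq X X').
Qed.

End Main.

(** The head finally rests on the lane of the zero register, in the block marked by the result. This
    cell is set exactly when the result is 0, hence acceptance by [notone]. *)
Definition decideP d c1 e1 c2 e2 :=
  let w := width d c1 e1 c2 e2 in
  initP d w ;; mainP d c1 e1 c2 e2 ;; seek w (d + 3) (d + 2).

Lemma decider d c1 e1 c2 e2 : 0 < d -> okC d c1 -> okE d e1 -> okC d c2 -> okE d e2 ->
  exists M c, wf_tm M /\ forall u t, (size u + bigK c1 e1 u).+2 ^ c <= t ->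
    decides_within M u t (result c1 e1 c2 e2 u != 0).
Proof.
move=> d0 ok1 ok2 ok3 ok4; set w := width d c1 e1 c2 e2.
set cst := cost c1 e1 c2 e2.
pose tm x := 40 * (x.+1 * (x.+1 * w.+2)) + cst x * (cw w * (x.+1 + cst x).+1) +
  (w.+2 * (x.+2 + cst x) + w.*2) + 1.
have [c Hc] : polyb tm.
  have Hcst : polyb cst by exact: cost_poly.
  have Hid : polyb (fun x : nat => x) by exact: polyb_id.
  rewrite /tm; apply: polyb_add; last exact: polyb_const.
  apply: polyb_add; last by poly_auto.
  apply: polyb_add; first by poly_auto.
  apply: polyb_mul => //; apply: polyb_mul; first exact: polyb_const.
  by poly_auto.
exists (tm_of (decideP d c1 e1 c2 e2) notone), c; split; first exact: tm_of_wf.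
move=> u t Ht; set B := size u + bigK c1 e1 u in Ht.
have [H [L [T [s' [R HL z2 z3 X]]]]] := main_run ok1 ok2 ok3 ok4 u d0.
rewrite -/w -/cst -/B in R HL X.
have [l Hl Y] : tx (decideP d c1 e1 c2 e2) (tape_of u) 0 T (cell w H (reg s' 3) (d + 2)) (tm B - 1).
  have [T1 [h1 [k [l [X1 X2 Hkl]]]]] := tx_seq_inv X.
  have Hs : tx (seek w (d + 3) (d + 2)) T H T (cell w H (reg s' 3) (d + 2)) (w.+2 * L.+1 + w.*2).
    by apply: (rep_seek R); rewrite /w /width; lia.
  apply: (tx_seq X1 (tx_seq X2 Hs (leqnn _))).
  rewrite /tm -/B.
  have HB : size u <= B by rewrite /B; lia.
  have e1' : 40 * ((size u).+1 * ((size u).+1 * w.+2)) <= 40 * (B.+1 * (B.+1 * w.+2)).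
    by rewrite leq_mul // leq_mul // leq_mul.
  have e2' : cst B * (cw w * ((size u).+1 + cst B).+1) <= cst B * (cw w * (B.+1 + cst B).+1).
    by rewrite leq_mul // leq_mul // ltnS leq_add2r.
  have e3' : w.+2 * L.+1 <= w.+2 * (B.+2 + cst B) by rewrite leq_mul //; lia.
  lia.
have Hlt : l < t.
  by apply: leq_trans Ht; apply: leq_trans (Hc B); rewrite /tm in Hl *; lia.
have := tm_of_run notone Y Hlt.
have [[_ h2 _] Hr _] := R.
have Hr3 : reg s' 3 < L by apply: Hr; rewrite /w /width; lia.
rewrite h2 //; last by rewrite /w /width; lia.
rewrite lane_reg z2 z3 /notone.
case=> Hst _ _ _; split.
  by rewrite /halted Hst; case: ifP; rewrite eqxx ?orbT.
rewrite Hst [0 == _]eq_sym; case: (result _ _ _ _ u == 0) => /=; split=> //; lia.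
Qed.

(** * Machines that output a power of two *)

Lemma read_wordE s v : (forall i, i < size v -> nth None s i = Some (nth false v i)) ->
  nth None s (size v) = None -> read_word s = v.
Proof.
elim: v s => [|b v IH] [|x s] //= Hv Hn.
- by rewrite Hn.
- by have := Hv 0 isT.
- have := Hv 0 isT => /= ->; congr (_ :: _); apply: IH => // i Hi.
  exact: (Hv i.+1).
Qed.

Lemma binf_fuel f f' n : n <= f -> n <= f' -> binf f n = binf f' n.
Proof.
elim: f f' n => [|f IH] [|f'] [|n] //= Hf Hf'; congr (_ :: _).
by apply: IH; lia.
Qed.

Lemma bin_rec n : 0 < n -> bin n = odd n :: bin n./2.
Proof.
case: n => // n _; rewrite /bin /=; congr (_ :: _).
by apply: binf_fuel; lia.
Qed.

Lemma bin_exp2 m : bin (2 ^ m) = nseq m false ++ [:: true].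
Proof.
elim: m => //= m IH; rewrite bin_rec ?expn_gt0 // expnS mul2n odd_double doubleK.
by rewrite IH.
Qed.

Definition eraseP := Loop nonblank (put (Some false) MoveL).

Lemma tx_erase T a n : (forall z, (a < z <= a + Z.of_nat n)%Z -> T z <> None) -> T a = None ->
  exists T' k, [/\ tx eraseP T (a + Z.of_nat n) T' a k,
    forall z, (a < z <= a + Z.of_nat n)%Z -> T' z = Some false &
    forall z, ~ (a < z <= a + Z.of_nat n)%Z -> T' z = T z].
Proof.
elim: n T => [|n IH] T H Ha.
  exists T, 1; split=> //; last by move=> z Hz; lia.
  by rewrite Z.add_0_r; apply: tx_loopF; rewrite /nonblank Ha.
pose h := (a + Z.of_nat n.+1)%Z.
have [||T' [k [X h1 h2]]] := IH (updZ T h (Some false)).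
- by move=> z Hz; rewrite updZ_neq; [apply: H | rewrite /h]; lia.
- by rewrite updZ_neq // /h; lia.
exists T', (1 + k).+1; split.
- apply: (tx_loopT (k := 1) (l := k)); [ | exact: tx_put | | exact: leqnn].
    by apply/eqP/H; lia.
  by rewrite /= -/h (_ : (h - 1)%Z = (a + Z.of_nat n)%Z) // /h; lia.
- move=> z Hz; have [Ez|Ez] := Z.eq_dec z h; last by apply: h1; rewrite /h in Ez; lia.
  by rewrite h2 ?Ez ?updZ_eq // /h; lia.
- move=> z Hz; rewrite h2 ?updZ_neq //; rewrite /h; lia.
Qed.

(** Does nothing: in the empty environment [V 0] is 0, so the loop has no rounds. *)
Definition skipC := Fr (V 0) (Wr 0 (V 0) (V 0)).

(* The binary expansion of [2 ^ m] is [0^m 1]: overwriting the first [G k] blocks with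
   zeros and writing a one behind them yields the output. *)
Lemma computable_exp2 d e2 (G : nat -> nat) : 0 < d -> okE d e2 ->
  (forall k, result skipC (Gl false) skipC e2 (bin k) = G k) ->
  exists2 w, 0 < w & computable (fun k => 2 ^ (w * G k)).
Proof.
move=> d0 ok HG; set w := width d skipC (Gl false) skipC e2.
have w0 : d + 4 < w by rewrite /w /width; lia.
exists w; first lia.
(* [G k] blocks of [w] cells precede the marked one, which explains the factor [w] in the exponent.
   The blank behind the one ends the output word, and the blank at [H - 1] stops the erasure. *)
pose outP := locate w (d + 3) ;; goN MoveL (d + 3) ;; put (Some true) MoveR ;;
  put None MoveL ;; go MoveL ;; eraseP ;; go MoveR.
pose p := (initP d w ;; mainP d skipC (Gl false) skipC e2) ;; outP.
exists (tm_of p (fun=> true)); split; first exact: tm_of_wf.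
move=> k; have okS : okC d skipC by rewrite /= d0.
have [H [L [T [s' [R HL z2 z3 X]]]]] := @main_run d skipC (Gl false) skipC e2 okS isT okS ok (bin k) d0.
rewrite HG in z3; rewrite -/w in R X; set g := G k in z3 *.
have [HB Hr _] := R.
have Hg : g < L by rewrite -z3; apply: Hr; lia.
have HBm := HB; have [b1 b2 b3] := HB.
have X1 : tx (locate w (d + 3)) T H T (cell w H g (d + 3)) (w.+2 * L.+1).
  apply: (tx_find HB) => //; first lia.
    by rewrite lane_reg z3.
  by move=> q Hq; rewrite lane_reg z3; apply/eqP; lia.
have E0 : (cell w H g (d + 3) - Z.of_nat (d + 3))%Z = cell w H g 0 by rewrite /cell; lia.
set h := cell w H g 0 in E0.
have Hh : (H <= h < cell w H L 0)%Z by apply: cell_lt; lia.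
have Eh : h = (H - 1 + Z.of_nat (w * g).+1)%Z by rewrite /h /cell mulnC; lia.
have Ei : (H + Z.of_nat (w * g))%Z = h by rewrite Eh; lia.
have Ei1 : (H + Z.of_nat (w * g).+1)%Z = (h + 1)%Z by rewrite Eh; lia.
have Hout z : (h <= z)%Z -> ~ (H - 1 < z <= H - 1 + Z.of_nat (w * g))%Z by rewrite Eh; lia.
have Hin i : i < w * g -> (H - 1 < H + Z.of_nat i <= H - 1 + Z.of_nat (w * g))%Z by lia.
pose T2 := updZ (updZ T h (Some true)) (h + 1)%Z None.
have T2z z : (z < h)%Z -> T2 z = T z by move=> Hz; rewrite /T2 !updZ_neq //; lia.
have [||T3 [l [X3 h1 h2]]] := @tx_erase T2 (H - 1)%Z (w * g).
- move=> z Hz; rewrite T2z; last lia.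
  have [q [j [Hq Hj ->]]] : exists q j, [/\ q < L, j < w & z = cell w H q j].
    by apply: cell_split; lia.
  by rewrite b2.
- by rewrite T2z //; lia.
have [t _ Y] : tx p (tape_of (bin k)) 0 T3 H
    (40 * ((size (bin k)).+1 * ((size (bin k)).+1 * w.+2)) +
     cost skipC (Gl false) skipC e2 (size (bin k) + bigK skipC (Gl false) (bin k)) *
      (cw w * ((size (bin k)).+1 + cost skipC (Gl false) skipC e2 (size (bin k) + bigK skipC (Gl false) (bin k))).+1) +
     (w.+2 * L.+1 + ((d + 3).+1 + (1 + (1 + (1 + (l + 1))))))).
  apply: (tx_seq X _ (leqnn _)); apply: (tx_seq X1 _ (leqnn _)).
  apply: (tx_seq (tx_goL _ _ _) _ (leqnn _)); rewrite E0.
  apply: (tx_seq (tx_put _ _ _ _) _ (leqnn _)).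
  apply: (tx_seq (tx_put _ _ _ _) _ (leqnn _)); rewrite -/T2.
  apply: (tx_seq (tx_go _ _ _) _ (leqnn _)).
  rewrite (_ : shift _ _ = (H - 1 + Z.of_nat (w * g))%Z); last by rewrite /= Eh; lia.
  apply: (tx_seq X3 _ (leqnn _)).
  have := tx_go MoveR T3 (H - 1)%Z; rewrite /= (_ : (H - 1 + 1)%Z = H) //; lia.
exists t.+1; have [Hst Hhd _ Hrt] := tm_of_run (fun=> true) Y (ltnSn t).
split; first exact: Hst.
rewrite /output; have Hcell i : nth None (c_head (run (tm_of p (fun=> true)) t.+1 (init_config (bin k))) ::
    c_right (run (tm_of p (fun=> true)) t.+1 (init_config (bin k)))) i = T3 (H + Z.of_nat i)%Z.
  case: i => [|i] /=; first by rewrite Hhd Z.add_0_r.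
  by rewrite Hrt; congr (T3 _); lia.
apply: read_wordE; rewrite bin_exp2 size_cat size_nseq /= addn1.
- move=> i Hi; rewrite Hcell nth_cat size_nseq nth_nseq.
  case: ltnP => Hi'; first by rewrite h1 //; apply: Hin.
  have {Hi Hi'}-> : i = w * g by apply/eqP; rewrite eqn_leq Hi' andbT -ltnS.
  rewrite subnn Ei h2; last by apply: Hout; apply: Z.le_refl.
  by rewrite /T2 updZ_neq ?updZ_eq //; apply: Z.neq_succ_diag_r.
- rewrite Hcell Ei1 h2; last by apply: Hout; apply: Z.le_succ_diag_r.
  by rewrite /T2 updZ_eq.
Qed.

(** * Evaluating arithmetic, numerals and lists *)

(** Every variable evaluates to 0 in the empty environment. *)
Definition zeroE := Ap (V 0) [::].
Definition oneE := Sc zeroE.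
Definition litE k := iter k Sc zeroE.
(** Passing the operands through [Ap] evaluates them in the surrounding environment and gives the
    body one of its own, so operands are never shifted under a binder. *)
Definition addE a b := Ap (Sum (litE 2) (IfE (V 0) zeroE (V 1) (V 2))) [:: a; b].
Definition mulE a b := Ap (Sum (V 0) (V 2)) [:: a; b].
Definition eqE a b := IfE a b oneE zeroE.
Definition notE a := IfE a zeroE oneE zeroE.
Definition ifTE c a b := IfE c zeroE b a.
Definition andE a b := IfE a zeroE zeroE (notE (notE b)).
Definition orE a b := IfE a zeroE (notE (notE b)) oneE.
Definition impE a b := orE (notE a) b.
Definition exE N b := notE (notE (Sum N b)).
Definition allE N b := notE (Sum N (notE b)).
Definition ltE a b := Ap (exE (V 1) (eqE (V 0) (V 1))) [:: a; b].
Definition subE a b := Ap (Sum (V 0) (notE (ltE (V 0) (V 2)))) [:: a; b].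
(** Exactly [a./2] numbers [i] satisfy [2 i + 1 < a]. *)
Definition halfE a := Ap (Sum (V 0) (ltE (Sc (addE (V 0) (V 0))) (V 1))) [:: a].
Definition oddE a := Ap (subE (V 0) (addE (halfE (V 0)) (halfE (V 0)))) [:: a].

Lemma nat_neq0 (b : bool) : ((b : nat) != 0) = b. Proof. by case: b. Qed.
Lemma nat_eq0 (b : bool) : ((b : nat) == 0) = ~~ b. Proof. by case: b. Qed.

Lemma sum_pred (P : pred nat) s : \sum_(i <- s) (P i : nat) = count P s.
Proof. by elim: s => [|i s IH]; rewrite ?big_nil // big_cons IH. Qed.

Lemma count_ltn_iota m k : count (fun i => i < m) (iota 0 k) = minn m k.
Proof.
elim: k => [|k IH]; first by rewrite minn0.
by rewrite -addn1 iotaD count_cat IH /= add0n; lia.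
Qed.

Section Eval.
Variables (n K : nat) (A : tracks).
Notation ev := (eval n K A).

Lemma ev_V i v : ev (V i) v = nth 0 v i. Proof. by []. Qed.
Lemma ev_Gl b v : ev (Gl b) v = if b then K else n. Proof. by []. Qed.
Lemma ev_Sc e v : ev (Sc e) v = (ev e v).+1. Proof. by []. Qed.
Lemma ev_Rd t e v : ev (Rd t e) v = A t (ev e v). Proof. by []. Qed.
Lemma ev_Ap f s v : ev (Ap f s) v = ev f (map (ev^~ v) s). Proof. by []. Qed.
Lemma ev_Sum N b v : ev (Sum N b) v = \sum_(i <- iota 0 (ev N v)) ev b (i :: v).
Proof. by []. Qed.
Lemma ev_zero v : ev zeroE v = 0. Proof. by []. Qed.
Lemma ev_one v : ev oneE v = 1. Proof. by []. Qed.
Lemma ev_lit k v : ev (litE k) v = k.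
Proof. by elim: k => //= k ->. Qed.
Lemma ev_add a b v : ev (addE a b) v = ev a v + ev b v.
Proof. by rewrite /= big_cons big_cons big_nil /= addn0. Qed.
Lemma ev_mul a b v : ev (mulE a b) v = ev a v * ev b v.
Proof. by rewrite /= big_const_seq count_predT size_iota iter_addn_0 mulnC. Qed.
Lemma ev_eq a b v : ev (eqE a b) v = (ev a v == ev b v) :> nat.
Proof. by rewrite /=; case: eqP. Qed.
Lemma ev_not a v : ev (notE a) v = ~~ (ev a v != 0) :> nat.
Proof. by rewrite /=; case: eqP. Qed.
Lemma ev_ifT c a b v : ev (ifTE c a b) v = if ev c v != 0 then ev a v else ev b v.
Proof. by rewrite /=; case: eqP. Qed.
Lemma ev_and a b v : ev (andE a b) v = (ev a v != 0) && (ev b v != 0) :> nat.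
Proof. by rewrite /=; case: eqP => //= _; case: (ev b v). Qed.
Lemma ev_or a b v : ev (orE a b) v = (ev a v != 0) || (ev b v != 0) :> nat.
Proof. by rewrite /=; case: eqP => //= _; case: (ev b v). Qed.
Lemma ev_imp a b v : ev (impE a b) v = (ev a v != 0) ==> (ev b v != 0) :> nat.
Proof. by rewrite ev_or ev_not nat_neq0; case: (_ != 0). Qed.
Lemma ev_ex N b v : ev (exE N b) v = has (fun i => ev b (i :: v) != 0) (iota 0 (ev N v)) :> nat.
Proof.
by rewrite /exE !ev_not ev_Sum nat_neq0 negbK sum_nat_seq_neq0.
Qed.
Lemma ev_all N b v : ev (allE N b) v = all (fun i => ev b (i :: v) != 0) (iota 0 (ev N v)) :> nat.
Proof.
rewrite /allE ev_not ev_Sum sum_nat_seq_neq0 -all_predC; congr nat_of_bool.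
apply: eq_all => i; rewrite -[predC _ i]/(~~ (ev (notE b) (i :: v) != 0)).
by rewrite ev_not nat_neq0 negbK.
Qed.
Lemma ev_lt a b v : ev (ltE a b) v = (ev a v < ev b v) :> nat.
Proof.
rewrite ev_Ap ev_ex [map _ _]/=; congr nat_of_bool; apply/hasP/idP => [[i]|H].
  by rewrite mem_iota ev_eq nat_neq0 /= => Hi /eqP <-.
by exists (ev a v); rewrite ?mem_iota // ev_eq nat_neq0 /= eqxx.
Qed.
Lemma ev_sub a b v : ev (subE a b) v = ev a v - ev b v.
Proof.
rewrite ev_Ap ev_Sum [map _ _]/= (eq_bigr (fun i => ~~ (i < ev b v) : nat)) => [|i _]; last first.
  by rewrite ev_not ev_lt nat_neq0.
rewrite sum_pred; have := count_predC (fun i => i < ev b v) (iota 0 (ev a v)).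
rewrite count_ltn_iota size_iota => H.
rewrite (eq_count (a2 := predC (fun i => i < ev b v))) //=; lia.
Qed.
Lemma ev_half a v : ev (halfE a) v = (ev a v)./2.
Proof.
rewrite ev_Ap ev_Sum [map _ _]/= (eq_bigr (fun i => (i < (ev a v)./2) : nat)) => [|i _]; last first.
  by rewrite ev_lt ev_Sc ev_add /=; congr nat_of_bool; lia.
by rewrite sum_pred count_ltn_iota /=; lia.
Qed.
Lemma ev_odd a v : ev (oddE a) v = odd (ev a v).
Proof. by rewrite ev_Ap ev_sub ev_add ev_half /=; lia. Qed.

Lemma ev_Fold N c e b v : ev (Fold N c e b) v =
  foldl (fun acc x => let r := ev b [:: acc, x & v] in if r < ev c v then r else 0)
        (ev e v) (iota 0 (ev N v)).
Proof. by []. Qed.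

(** As long as the intended values [s t] stay below the cap, clipping never acts and [Fold] is plain
    iteration. *)
Lemma ev_loop N c e b v (s : nat -> nat) : s 0 = ev e v ->
  (forall t, t < ev N v -> ev b [:: s t, t & v] = s t.+1) ->
  (forall t, t < ev N v -> s t.+1 < ev c v) ->
  ev (Fold N c e b) v = s (ev N v).
Proof.
move=> H0; rewrite ev_Fold; elim: (ev N v) => // m IH Hb Hc.
rewrite -addn1 iotaD foldl_cat IH => [|t Ht|t Ht]; last 2 first.
- by apply: Hb; lia.
- by apply: Hc; lia.
by rewrite /= add0n Hb // Hc // addn1.
Qed.

End Eval.

Definition evE := (ev_V, ev_Gl, ev_Sc, ev_Rd, ev_zero, ev_one, ev_lit, ev_add, ev_mul,
  ev_eq, ev_not, ev_ifT, ev_and, ev_or, ev_imp, ev_ex, ev_all, ev_lt, ev_sub, ev_half,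
  ev_odd, nat_neq0, nat_eq0, negbK).

(** * Parsing the self-delimiting code *)

Lemma size_enc_nat v : size (enc_nat v) = (size (bin v)).*2.+2.
Proof.
rewrite /enc_nat size_cat /= addn2; congr _.+2.
by elim: (bin v) => //= b s ->.
Qed.

Lemma nth_enc_nat v i : i < size (bin v) ->
  nth false (enc_nat v) i.*2 = nth false (bin v) i /\
  nth false (enc_nat v) i.*2.+1 = nth false (bin v) i.
Proof.
rewrite /enc_nat; elim: (bin v) i => //= b s IH [|i] //= Hi.
exact: IH.
Qed.

Lemma nth_enc_nat_end v :
  nth false (enc_nat v) (size (bin v)).*2 = false /\
  nth false (enc_nat v) (size (bin v)).*2.+1 = true.
Proof. by rewrite /enc_nat; elim: (bin v) => //= b s IH. Qed.

Lemma bin0 : bin 0 = [::]. Proof. by []. Qed.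

Lemma iter_half_le i v : iter i half v <= v.
Proof. by elim: i => //= i IH; lia. Qed.

Lemma nth_bin v i : nth false (bin v) i = odd (iter i half v).
Proof.
elim: i v => [|i IH] v; case: (posnP v) => [->|Hv].
- by rewrite bin0.
- by rewrite bin_rec.
- by rewrite bin0 nth_nil; have := iter_half_le i.+1 0; rewrite leqn0 => /eqP ->.
- by rewrite bin_rec // iterSr -IH.
Qed.

Lemma iter_half_bin v : iter (size (bin v)) half v = 0.
Proof.
elim/ltn_ind: v => v IH; case: (posnP v) => [->|Hv]; first by rewrite bin0.
by rewrite bin_rec // [size _]/= iterSr IH //; lia.
Qed.

Lemma bin_inj u v : bin u = bin v -> u = v.
Proof.
elim/ltn_ind: u v => u IH v; case: (posnP u) => [->|Hu]; case: (posnP v) => [->|Hv] //.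
- by rewrite (bin_rec Hv).
- by rewrite (bin_rec Hu).
rewrite (bin_rec Hu) (bin_rec Hv) => -[Ho /IH Hh].
by rewrite -(odd_double_half u) -(odd_double_half v) Ho Hh //; lia.
Qed.

Section Occ.
Variable w : seq bool.

Definition occ (p : nat) (l : seq bool) : Prop :=
  exists pre suf, w = pre ++ l ++ suf /\ size pre = p.

Lemma occ_cat p a b : occ p (a ++ b) -> occ p a /\ occ (p + size a) b.
Proof.
move=> [pre [suf [E <-]]]; split; first by exists pre, (b ++ suf); rewrite E -catA.
by exists (pre ++ a), suf; rewrite E -!catA size_cat.
Qed.

Lemma occ_nth p l i : occ p l -> i < size l -> nth false w (p + i) = nth false l i.
Proof.
move=> [pre [suf [-> <-]]] Hi; rewrite nth_cat ltnNge leq_addr /= addKn nth_cat Hi //.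
Qed.

Lemma occ_nth0 p l : occ p l -> 0 < size l -> nth false w p = nth false l 0.
Proof. by move=> H Hl; rewrite -(occ_nth H Hl) addn0. Qed.

Lemma occ_size p l : occ p l -> p + size l <= size w.
Proof. by move=> [pre [suf [-> <-]]]; rewrite !size_cat; lia. Qed.

End Occ.

Definition termE p := andE (notE (Rd 0 p)) (Rd 0 (Sc p)).
(** Counts the [i] for which none of the pairs 0 to [i] is the terminator 01. Pairs that code a bit
    have equal entries, so the first terminator found is the true one. *)
Definition lenE p := Ap (Sum (Gl false)
  (allE (Sc (V 0)) (notE (termE (addE (V 2) (addE (V 0) (V 0))))))) [:: p].
Definition endE p := Ap (Sc (Sc (addE (V 0) (addE (lenE (V 0)) (lenE (V 0)))))) [:: p].
(** Horner's rule; the least significant bit is stored first, so the bits are read backwards. The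
    cap is the input length plus one, so only values up to the input length are recovered. *)
Definition valE p := Ap (Fold (lenE (V 0)) (Sc (Gl false)) zeroE
  (addE (addE (V 0) (V 0))
     (Rd 0 (addE (V 2) (mulE (litE 2) (subE (lenE (V 2)) (Sc (V 1)))))))) [:: p].
(** Compares codes, not values: a proposition is a binary number that may exceed any polynomial in
    the input length, out of reach of [valE]. *)
Definition eqnE p q := Ap (andE (eqE (lenE (V 0)) (lenE (V 1)))
  (allE (lenE (V 0)) (eqE (Rd 0 (addE (V 1) (addE (V 0) (V 0))))
                          (Rd 0 (addE (V 2) (addE (V 0) (V 0))))))) [:: p; q].

(* [S] maps the position of a list cell to the position of the next one and fixes
   the end of the list. *)
Definition nthL (S : ex -> ex) p t := Ap (Fold (V 1) (Sc (Gl false)) (V 0) (S (V 0))) [:: p; t].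
(** A list has no more elements than the input has bits, so that many steps reach the end marker and
    then stay there; its two bits remain to be skipped. *)
Definition skipL (S : ex -> ex) p := Sc (Sc (nthL S p (Gl false))).
Definition cellE (f : ex -> ex) p := Ap (ifTE (Rd 0 (V 0)) (f (Sc (Sc (V 0)))) (V 0)) [:: p].
(** A list cell starts with the bit 1 and the end marker with 0, so adding these first bits counts
    the elements. *)
Definition sizeL S p := Ap (Sum (Gl false) (Rd 0 (nthL S (V 1) (V 0)))) [:: p].

Definition stepN := cellE endE.
Definition stepP := cellE (fun p => endE (endE p)).
Definition stepA := cellE (fun p => skipL stepN (skipL stepN (skipL stepN p))).

Definition memN l p := Ap (exE (Gl false)
  (andE (Rd 0 (nthL stepN (V 1) (V 0)))
        (eqnE (Sc (Sc (nthL stepN (V 1) (V 0)))) (V 2)))) [:: l; p].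

(** Quantifiers in expressions run up to the input length; this cuts them down to the entries of a
    list. *)
Lemma has_iota_nth (T : Type) (x0 : T) (P : pred T) s n : size s <= n ->
  has (fun i => (i < size s) && P (nth x0 s i)) (iota 0 n) = has P s.
Proof.
move=> Hn; apply/hasP/(has_nthP x0) => [[i _ /andP[Hi Hp]]|[i Hi Hp]]; first by exists i.
by exists i; rewrite ?Hi // mem_iota; lia.
Qed.

Lemma size_enc_list (T : Type) (e : T -> seq bool) s : size s <= size (enc_list e s).
Proof.
rewrite /enc_list size_cat; apply: leq_trans (leq_addr _ _).
by elim: s => //= x s IH; rewrite size_cat; lia.
Qed.

Section Parse.
Variables (w : seq bool) (K : nat) (A : tracks).
Hypothesis HA : forall p, A 0 p = nth false w p.
Let n := size w.
Notation ev := (eval n K A).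
Notation occ := (occ w).

Lemma ev_len p v x : occ (ev p v) (enc_nat x) -> ev (lenE p) v = size (bin x).
Proof.
move=> H; rewrite ev_Ap ev_Sum [map _ _]/=.
have Hs := occ_size H; rewrite size_enc_nat -/n in Hs.
have Hterm i : i <= size (bin x) ->
    (~~ A 0 (ev p v + i.*2)) && A 0 (ev p v + i.*2).+1 = (i == size (bin x)).
  move=> Hi; rewrite !HA -addnS !(occ_nth H) ?size_enc_nat; try lia.
  case: (ltngtP i (size (bin x))) Hi => // [Hi _|-> _].
    by have [-> ->] := nth_enc_nat Hi; case: (nth _ _ _).
  by have [-> ->] := nth_enc_nat_end x.
rewrite (eq_bigr (fun i => (i < size (bin x)) : nat)) => [|i _]; last first.
  rewrite ev_all ev_Sc ev_V [nth _ _ _]/=; congr nat_of_bool.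
  transitivity (all (fun j => ~~ (~~ A 0 (ev p v + j.*2) && A 0 (ev p v + j.*2).+1)) (iota 0 i.+1)).
    by apply: eq_all => j; rewrite /termE !evE /= addnn.
  apply/allP/idP => [Hall|Hi j].
    rewrite ltnNge; apply/negP => Hi.
    have := Hall (size (bin x)); rewrite mem_iota /= => /(_ ltac:(lia)).
    by rewrite Hterm // eqxx.
  by rewrite mem_iota /= => Hj; rewrite Hterm; lia.
by rewrite sum_pred count_ltn_iota [ev _ _]/=; lia.
Qed.

Lemma ev_end p v x : occ (ev p v) (enc_nat x) -> ev (endE p) v = ev p v + size (enc_nat x).
Proof.
move=> H; rewrite ev_Ap !evE !(@ev_len (V 0) _ x) //= size_enc_nat; lia.
Qed.

Lemma ev_val p v x : occ (ev p v) (enc_nat x) -> x <= n -> ev (valE p) v = x.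
Proof.
move=> H Hx; rewrite ev_Ap [map _ _]/=.
have El : ev (lenE (V 0)) [:: ev p v] = size (bin x) by apply: ev_len.
rewrite (@ev_loop _ _ _ _ _ _ _ _ (fun t => iter (size (bin x) - t) half x)) ?El.
- by rewrite subnn.
- by rewrite subn0 iter_half_bin.
- move=> t Ht; rewrite !evE (@ev_len (V 2) _ x) // [nth _ _ 2]/= [nth _ _ 1]/= [nth _ _ 0]/=.
  rewrite HA mul2n (occ_nth H); last by rewrite size_enc_nat; lia.
  have [-> _] := @nth_enc_nat x (size (bin x) - t.+1) ltac:(lia).
  rewrite nth_bin (_ : size (bin x) - t = (size (bin x) - t.+1).+1); last lia.
  by rewrite iterS addnn addnC odd_double_half.
- by move=> t Ht; rewrite ev_Sc ltnS; apply: leq_trans (iter_half_le _ _) Hx.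
Qed.

Lemma ev_eqn p q v x y : occ (ev p v) (enc_nat x) -> occ (ev q v) (enc_nat y) ->
  ev (eqnE p q) v = (x == y) :> nat.
Proof.
move=> Hp Hq; rewrite ev_Ap [map _ _]/= ev_and ev_eq ev_all !nat_neq0.
rewrite (@ev_len (V 0) _ x) // (@ev_len (V 1) _ y) //; congr nat_of_bool.
apply/andP/eqP => [[/eqP Es /allP Hall]|Exy]; last first.
  rewrite -Exy in Hq *; split=> //; apply/allP => i; rewrite mem_iota => Hi.
  rewrite !evE [nth _ _ 2]/= [nth _ _ 1]/= [nth _ _ 0]/= !HA addnn.
  have Hi2 : i.*2 < size (enc_nat x) by rewrite size_enc_nat; lia.
  by rewrite (occ_nth Hp Hi2) (occ_nth Hq Hi2) eqxx.
apply: bin_inj; apply: (@eq_from_nth _ false) => // i Hi.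
have Hi' : i < size (bin y) by rewrite -Es.
have := Hall i; rewrite mem_iota => /(_ Hi).
rewrite !evE [nth _ _ 2]/= [nth _ _ 1]/= [nth _ _ 0]/= !HA addnn.
rewrite (occ_nth Hp) ?(occ_nth Hq) ?size_enc_nat; try lia.
have [-> _] := nth_enc_nat Hi; have [-> _] := nth_enc_nat Hi'.
by case: (nth _ _ _); case: (nth _ _ _).
Qed.

Definition stepper (T : Type) (e : T -> seq bool) (S : ex -> ex) : Prop :=
  (forall p v x, occ (ev p v) ([:: true; false] ++ e x) ->
     ev (S p) v = ev p v + (size (e x)).+2) /\
  (forall p v, occ (ev p v) [:: false; true] -> ev (S p) v = ev p v).

Section Lists.
Variables (T : Type) (e : T -> seq bool) (S : ex -> ex).
Hypothesis HS : stepper e S.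

Definition offset (s : seq T) t := size (flatten [seq [:: true; false] ++ e x | x <- take t s]).

Lemma occ_offset p s t x0 : occ p (enc_list e s) ->
  if t < size s then occ (p + offset s t) ([:: true; false] ++ e (nth x0 s t))
  else occ (p + offset s t) [:: false; true].
Proof.
rewrite /enc_list /offset; elim: s t p => [|x s IH] t p /=.
  by rewrite addn0.
rewrite -catA -2!cat_cons => H; have [H1 H2] := @occ_cat w _ [:: true, false & e x] _ H.
case: t => [|t] /=; first by rewrite addn0.
have := IH t _ H2; rewrite ltnS size_cat /=; set o := size (flatten _).
by rewrite (_ : p + (size (e x) + o).+2 = p + (size (e x)).+2 + o) //; lia.
Qed.

Lemma offsetS s t x0 : offset s t.+1 =
  offset s t + if t < size s then (size (e (nth x0 s t))).+2 else 0.
Proof.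
have cons y l k : offset (y :: l) k.+1 = (size (e y)).+2 + offset l k.
  by rewrite /offset /= size_cat.
elim: s t => [|x s IH] [|t] //; rewrite cons.
  by rewrite /offset take0 addn0 add0n.
by rewrite IH cons addnA.
Qed.

Lemma offset_size s t : size s <= t ->
  size (enc_list e s) = offset s t + 2.
Proof. by move=> H; rewrite /offset take_oversize // /enc_list size_cat. Qed.

Lemma offset_le s t : offset s t + 2 <= size (enc_list e s).
Proof.
rewrite /enc_list size_cat leq_add2r /offset -{2}(cat_take_drop t s) map_cat flatten_cat size_cat.
exact: leq_addr.
Qed.

Lemma ev_nthL p t v s (x0 : T) : occ (ev p v) (enc_list e s) ->
  ev (nthL S p t) v = ev p v + offset s (ev t v).
Proof.
move=> H; rewrite ev_Ap [map _ _]/=.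
have Hs := occ_size H; rewrite -/n in Hs.
rewrite (@ev_loop _ _ _ _ _ _ _ _ (fun t => ev p v + offset s t)) //=.
- by rewrite /offset take0 addn0.
- move=> i _; have := occ_offset i x0 H; rewrite (offsetS _ _ x0); case: ifP => _ Hi.
    by rewrite (HS.1 _ _ (nth x0 s i)) //= addnA.
  by rewrite HS.2 //= addn0.
- by move=> i _; have := offset_le s i.+1; lia.
Qed.

Lemma ev_nthL_bit p t v s (x0 : T) : occ (ev p v) (enc_list e s) ->
  A 0 (ev (nthL S p t) v) = (ev t v < size s).
Proof.
move=> H; rewrite (ev_nthL t x0 H) HA; have := occ_offset (ev t v) x0 H.
by case: ltnP => _ Ho; rewrite (occ_nth0 Ho).
Qed.

Lemma occ_nthL p t v s (x0 : T) : occ (ev p v) (enc_list e s) -> ev t v < size s ->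
  occ (ev (nthL S p t) v).+2 (e (nth x0 s (ev t v))).
Proof.
move=> H Ht; rewrite (ev_nthL t x0 H); have := occ_offset (ev t v) x0 H.
by rewrite Ht => /occ_cat[_]; rewrite addn2.
Qed.

Lemma ev_skipL p v s (x0 : T) : occ (ev p v) (enc_list e s) ->
  ev (skipL S p) v = ev p v + size (enc_list e s).
Proof.
move=> H; rewrite /skipL !ev_Sc (ev_nthL _ x0 H) ev_Gl -/n.
have Hs := occ_size H; have Hz := size_enc_list e s.
by rewrite (@offset_size s n) ?addnA ?addn2 // /n; lia.
Qed.

Lemma ev_sizeL p v s (x0 : T) : occ (ev p v) (enc_list e s) -> ev (sizeL S p) v = size s.
Proof.
move=> H; rewrite ev_Ap ev_Sum [map _ _]/=.
rewrite (eq_bigr (fun i => (i < size s) : nat)) => [|i _].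
  rewrite sum_pred count_ltn_iota [ev _ _]/= -/n.
  have Hs := occ_size H; have := size_enc_list e s; rewrite /n; lia.
by rewrite ev_Rd (@ev_nthL_bit _ _ _ s x0).
Qed.

End Lists.

Lemma ev_cell T (e : T -> seq bool) f :
  (forall p v x, occ (ev p v) (e x) -> ev (f p) v = ev p v + size (e x)) ->
  stepper e (cellE f).
Proof.
move=> Hf; split=> [p v x H|p v H]; rewrite ev_Ap ev_ifT [map _ _]/= ev_Rd nat_neq0 HA ev_V [nth _ _ 0]/=.
  rewrite (occ_nth0 H) // (@Hf _ _ x); first by rewrite !ev_Sc /=; lia.
  by have [_] := occ_cat H; rewrite !ev_Sc /= addn2.
by rewrite (occ_nth0 H).
Qed.

Lemma stepN_ok : stepper enc_nat stepN. Proof. exact: ev_cell ev_end. Qed.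

Lemma ev_endP p v x : occ (ev p v) (enc_pair x) -> ev (endE (endE p)) v = ev p v + size (enc_pair x).
Proof.
rewrite /enc_pair => /occ_cat [H1 H2].
have E := ev_end H1.
by rewrite (@ev_end _ _ x.2) ?E // size_cat addnA.
Qed.

Lemma stepP_ok : stepper enc_pair stepP. Proof. exact: ev_cell ev_endP. Qed.

Lemma ev_skipN p v s : occ (ev p v) (enc_list enc_nat s) ->
  ev (skipL stepN p) v = ev p v + size (enc_list enc_nat s).
Proof. exact: (ev_skipL stepN_ok 0). Qed.

Lemma ev_skipAct p v x : occ (ev p v) (enc_act x) ->
  ev (skipL stepN (skipL stepN (skipL stepN p))) v = ev p v + size (enc_act x).
Proof.
case: x => [[pr de] ad]; rewrite /enc_act => /occ_cat [H1 /occ_cat [H2 H3]].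
have E1 := ev_skipN H1; rewrite -E1 in H2 H3.
have E2 := ev_skipN H2; rewrite -E2 in H3.
by rewrite (ev_skipN H3) E2 E1 !size_cat !addnA.
Qed.

Lemma stepA_ok : stepper enc_act stepA. Proof. exact: ev_cell ev_skipAct. Qed.

Lemma ev_mem l p v s x : occ (ev l v) (enc_list enc_nat s) -> occ (ev p v) (enc_nat x) ->
  ev (memN l p) v = (x \in s) :> nat.
Proof.
move=> Hl Hp; rewrite ev_Ap ev_ex [map _ _]/= ev_Gl -/n -has_pred1; congr nat_of_bool.
have Hs := occ_size Hl; have Hz := size_enc_list enc_nat s.
rewrite -(@has_iota_nth _ 0 _ s n); last by rewrite /n; lia.
apply: eq_has => i; rewrite ev_and nat_neq0 ev_Rd nat_neq0.
rewrite (ev_nthL_bit stepN_ok _ 0 (s := s)) //.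
rewrite ev_V [nth _ _ 0]/=; case: ltnP => // Hi; rewrite !andTb (@ev_eqn _ _ _ (nth 0 s i) x) // ?nat_neq0 //.
by rewrite !ev_Sc; apply: (occ_nthL stepN_ok 0).
Qed.

End Parse.

(** * Reading an encoded instance *)

Definition pActs := endE zeroE.
Definition pAlpha := skipL stepA pActs.
Definition pOrd := skipL stepN pAlpha.
Definition pS0 := skipL stepP pOrd.
Definition pPlan := skipL stepN pS0.
Definition ntE := sizeL stepN pAlpha.
Definition npE := sizeL stepN pPlan.
Definition alphaE t := valE (Sc (Sc (nthL stepN pAlpha t))).
Definition planE q := valE (Sc (Sc (nthL stepN pPlan q))).
Definition precE a b :=
  let c := nthL stepP pOrd (V 0) in
  Ap (exE (Gl false) (andE (Rd 0 c) (andE (eqE (valE (Sc (Sc c))) (V 1))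
                                          (eqE (valE (endE (Sc (Sc c)))) (V 2))))) [:: a; b].
Definition coverE a b :=
  Ap (andE (precE (V 0) (V 1))
           (notE (exE ntE (andE (precE (V 1) (V 0)) (precE (V 0) (V 2)))))) [:: a; b].
Definition preE x := Sc (Sc (nthL stepA pActs x)).
Definition delE x := skipL stepN (preE x).
Definition addlE x := skipL stepN (delE x).
(** A state is never stored. The truth of the single proposition coded at [f] is followed through
    the first [q] actions as a value 0 or 1, hence the cap 2; additions are tested first because
    they override deletions. *)
Definition holdsE f q :=
  Ap (Fold (V 1) (litE 2) (memN pS0 (V 0))
        (ifTE (memN (addlE (planE (V 1))) (V 2)) oneE
          (ifTE (memN (delE (planE (V 1))) (V 2)) zeroE (V 0)))) [:: f; q].
Definition execE :=
  let c := nthL stepN (preE (planE (V 1))) (V 0) in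
  allE npE (allE (Gl false) (impE (Rd 0 c) (holdsE (Sc (Sc c)) (V 1)))).

Section Instance.
Variables (I : instance) (K : nat) (A : tracks).
Let w := enc I.
Let n := size w.
Hypothesis HA : forall p, A 0 p = nth false w p.
Hypothesis HI : valid I.
Notation ev := (eval n K A).
Notation occ := (occ w).

Lemma occ_all v : [/\ occ (ev pActs v) (enc_list enc_act (i_acts I)),
  occ (ev pAlpha v) (enc_list enc_nat (i_alpha I)),
  occ (ev pOrd v) (enc_list enc_pair (i_ord I)),
  occ (ev pS0 v) (enc_list enc_nat (i_s0 I)) &
  occ (ev pPlan v) (enc_list enc_nat (i_plan I))].
Proof.
have H0 : occ 0 (enc I) by exists [::], [::]; rewrite cats0.
move: H0; rewrite {1}/enc => /occ_cat[H0] /occ_cat[H1] /occ_cat[H2] /occ_cat[H3] /occ_cat[H4 H5].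
have E0 : ev pActs v = 0 + size (enc_nat (i_nF I)).
  by rewrite /pActs (ev_end HA (x := i_nF I)) ev_zero.
rewrite -E0 in H1 H2 H3 H4 H5.
have E1 := ev_skipL (stepA_ok K HA) ([::], [::], [::]) H1; rewrite -/pAlpha in E1.
rewrite -E1 in H2 H3 H4 H5.
have E2 := ev_skipL (stepN_ok K HA) 0 H2; rewrite -/pOrd in E2.
rewrite -E2 in H3 H4 H5.
have E3 := ev_skipL (stepP_ok K HA) (0, 0) H3; rewrite -/pS0 in E3.
rewrite -E3 in H4 H5.
have E4 := ev_skipL (stepN_ok K HA) 0 H4; rewrite -/pPlan in E4.
rewrite -E4 in H5; exact: And5 H1 H2 H3 H4 H5.
Qed.

Lemma ev_nt v : ev ntE v = ntasks I.
Proof. by have [_ H _ _ _] := occ_all v; apply: (ev_sizeL HA (stepN_ok K HA) 0). Qed.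

Lemma ev_np v : ev npE v = size (i_plan I).
Proof. by have [_ _ _ _ H] := occ_all v; apply: (ev_sizeL HA (stepN_ok K HA) 0). Qed.

(** Indices of tasks and actions are smaller than the length of an encoded list, hence within the
    range where [valE] is exact. *)
Lemma sizes_le : [/\ size (i_acts I) <= n, ntasks I <= n & size (i_plan I) <= n] /\ size (i_ord I) <= n.
Proof.
have [h1 h2 h3 _ h5] := occ_all [::].
have le (T : Type) (e : T -> seq bool) p l : occ p (enc_list e l) -> size l <= n.
  by move=> H; apply: leq_trans (size_enc_list e l) (leq_trans (leq_addl _ _) (occ_size H)).
by split; [split|]; [apply: le h1 | apply: le h2 | apply: le h5 | apply: le h3].
Qed.

Lemma ev_alpha t v : ev t v < ntasks I -> ev (alphaE t) v = nth 0 (i_alpha I) (ev t v).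
Proof.
move=> Ht; have [_ H _ _ _] := occ_all v.
have Ho := occ_nthL (stepN_ok K HA) 0 H Ht.
apply: (ev_val HA); first by rewrite !ev_Sc.
have [_ /allP Hal _ _ _] := HI; have [[Hs _ _] _] := sizes_le.
by apply: leq_trans Hs; apply: ltnW; apply: Hal; apply: mem_nth.
Qed.

Lemma ev_plan t v : ev t v < size (i_plan I) -> ev (planE t) v = nth 0 (i_plan I) (ev t v).
Proof.
move=> Ht; have [_ _ _ _ H] := occ_all v.
have Ho := occ_nthL (stepN_ok K HA) 0 H Ht.
apply: (ev_val HA); first by rewrite !ev_Sc.
have [_ _ /allP Hal _ _] := HI; have [[Hs _ _] _] := sizes_le.
by apply: leq_trans Hs; apply: ltnW; apply: Hal; apply: mem_nth.
Qed.

Lemma plan_lt t : t < size (i_plan I) -> nth 0 (i_plan I) t < size (i_acts I).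
Proof. by move=> Ht; have [_ _ /allP Hal _ _] := HI; apply: Hal; apply: mem_nth. Qed.

Lemma ev_prec a b v : ev (precE a b) v = prec I (ev a v) (ev b v) :> nat.
Proof.
rewrite ev_Ap ev_ex [map _ _]/= [ev (Gl _) _]/= -/n; congr nat_of_bool.
have [_ Hs] := sizes_le.
rewrite /prec -has_pred1 -(has_iota_nth (0, 0) _ Hs); apply: eq_has => i.
set u := [:: i; ev a v; ev b v]; have [_ _ Ho _ _] := occ_all u.
rewrite ev_and nat_neq0 ev_Rd nat_neq0 (ev_nthL_bit HA (stepP_ok K HA) _ (0, 0) Ho).
rewrite ev_V [nth _ _ 0]/=; case: ltnP => // Hi; rewrite !andTb ev_and !ev_eq !nat_neq0.
set c := Sc (Sc _).
have Hc : occ (ev c u) (enc_pair (nth (0, 0) (i_ord I) i)).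
  by rewrite !ev_Sc; exact: (occ_nthL (stepP_ok K HA) (0, 0) (t := V 0) Ho Hi).
have [_ _ _ _ [/allP Hall _]] := HI.
have := Hall _ (mem_nth (0, 0) Hi).
move: Hc; rewrite /pred1; case: (nth (0, 0) (i_ord I) i) => x y /occ_cat [H1 H2] /andP[Hx Hy].
have [[_ Hn _] _] := sizes_le.
rewrite (ev_val HA H1); last exact: leq_trans (ltnW Hx) Hn.
rewrite -(ev_end HA H1) in H2; rewrite (ev_val HA H2) //.
exact: leq_trans (ltnW Hy) Hn.
Qed.

Lemma ev_cover a b v : ev (coverE a b) v = cover I (ev a v) (ev b v) :> nat.
Proof.
rewrite ev_Ap [map _ _]/= ev_and ev_prec ev_not ev_ex !nat_neq0 ev_nt; congr nat_of_bool.
rewrite /cover; congr (_ && ~~ _); apply: eq_has => c.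
by rewrite ev_and !ev_prec !nat_neq0.
Qed.

Lemma occ_act x v : ev x v < size (i_acts I) ->
  [/\ occ (ev (preE x) v) (enc_list enc_nat (act_of I (ev x v)).1.1),
      occ (ev (delE x) v) (enc_list enc_nat (act_of I (ev x v)).1.2) &
      occ (ev (addlE x) v) (enc_list enc_nat (act_of I (ev x v)).2)].
Proof.
move=> Hx; have [H _ _ _ _] := occ_all v.
have := occ_nthL (stepA_ok K HA) ([::], [::], [::]) H Hx.
rewrite -/(act_of I (ev x v)) -[X in occ X]/(ev (preE x) v).
case: (act_of _ _) => [[pr de] ad].
rewrite {1}/enc_act => /occ_cat[H1] /occ_cat[H2 H3].
have E1 := ev_skipN HA H1; rewrite -E1 -/(delE x) in H2 H3.
have E2 := ev_skipN HA H2; rewrite -E2 -/(addlE x) in H3.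
by split.
Qed.

Definition apply_act (s : pred nat) (a : nat) : pred nat :=
  fun x => (x \in (act_of I a).2) || (s x && (x \notin (act_of I a).1.2)).

(** Turns the recursion over states into a quantifier over prefixes of the plan, the form that
    [execE] evaluates. *)
Lemma executableE s p : executable I s p =
  all (fun q => all (foldl apply_act s (take q p)) (act_of I (nth 0 p q)).1.1) (iota 0 (size p)).
Proof.
elim: p s => // a p IH s.
have -> : executable I s (a :: p) = all s (act_of I a).1.1 && executable I (apply_act s a) p.
  by rewrite /= /apply_act; case: (act_of I a) => [[pr de] ad].
by rewrite IH /= (iotaDl 1 0) all_map.
Qed.

Lemma ev_holds f q x v : occ (ev f v) (enc_nat x) -> ev q v <= size (i_plan I) ->
  ev (holdsE f q) v = foldl apply_act (fun x => x \in i_s0 I) (take (ev q v) (i_plan I)) x :> nat.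
Proof.
move=> Hf Hq; rewrite ev_Ap [map _ _]/=.
set s := fun t => (foldl apply_act (fun x => x \in i_s0 I) (take t (i_plan I)) x : nat).
rewrite (ev_loop (s := s)) //.
- have [_ _ _ H _] := occ_all [:: ev f v; ev q v].
  by rewrite (ev_mem HA H (x := x)) // /s take0.
- rewrite [ev (V 1) _]/= => t Ht; have Htp : t < size (i_plan I) by lia.
  set u := [:: s t; t; ev f v; ev q v].
  have Ep : ev (planE (V 1)) u = nth 0 (i_plan I) t by apply: ev_plan.
  have [|_ Hd Ha] := @occ_act (planE (V 1)) u; first by rewrite Ep; apply: plan_lt.
  rewrite Ep in Hd Ha.
  have Hx : occ (ev (V 2) u) (enc_nat x) by [].
  rewrite !ev_ifT (ev_mem HA Ha Hx) (ev_mem HA Hd Hx) !nat_neq0 ev_one ev_zero ev_V [nth _ _ 0]/=.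
  rewrite /s (take_nth 0 Htp) -cats1 foldl_cat /= {2}/apply_act.
  by case: (_ \in _) => //=; case: (x \in _) => //=; rewrite ?andbT ?andbF.
- by move=> t _; rewrite ev_lit /s ltnS leq_b1.
Qed.

Lemma ev_exec v : ev execE v = executable I (fun x => x \in i_s0 I) (i_plan I) :> nat.
Proof.
rewrite ev_all ev_np executableE; congr nat_of_bool; apply: eq_in_all => q.
rewrite mem_iota add0n => /andP[_ Hq]; rewrite ev_all nat_neq0 [ev (Gl _) _]/= -/n.
set st := foldl _ _ _; set pr := (act_of _ _).1.1.
have Ep i : ev (planE (V 1)) [:: i, q & v] = nth 0 (i_plan I) q by apply: ev_plan.
have Ho i : occ (ev (preE (planE (V 1))) [:: i, q & v]) (enc_list enc_nat pr).
  by have [] := @occ_act (planE (V 1)) [:: i, q & v]; rewrite ?Ep ?plan_lt.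
have Hs : size pr <= n.
  exact: leq_trans (size_enc_list enc_nat pr) (leq_trans (leq_addl _ _) (occ_size (Ho 0))).
rewrite -[RHS]negbK -has_predC -(has_iota_nth 0 _ Hs) -all_predC; apply: eq_in_all => i _.
set u := [:: i, q & v].
rewrite ev_imp nat_neq0 ev_Rd nat_neq0 (ev_nthL_bit HA (stepN_ok K HA) (V 0) 0 (Ho i)).
rewrite -[predC _ i]/(~~ ((i < size pr) && ~~ st (nth 0 pr i))) ev_V [nth _ _ 0]/=.
case: ltnP => // Hi; rewrite implyTb andTb negbK.
rewrite (@ev_holds _ _ (nth 0 pr i)) ?nat_neq0 //.
- by rewrite !ev_Sc; apply: (occ_nthL (stepN_ok K HA) 0 (t := V 0)); first exact: Ho.
- exact: ltnW.
Qed.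

End Instance.

(** * List scheduling and the exchange argument *)

Lemma index_find (T : eqType) (P : pred T) s x : x \in s -> P x -> find P s <= index x s.
Proof.
move=> Hx HP; rewrite leqNgt; apply/negP => /(before_find x).
by rewrite nth_index // HP.
Qed.

Lemma exists_min (T : eqType) (P : pred T) (f : T -> nat) s : has P s ->
  exists x, [/\ x \in s, P x & forall y, y \in s -> P y -> f x <= f y].
Proof.
elim: s => //= a s IH.
have [/IH [x [Hx Px Hmin]] _|Hs] := boolP (has P s); last first.
  rewrite orbF => Pa; exists a; split=> //; first by rewrite mem_head.
  move=> y; rewrite inE => /orP[/eqP-> //|Hy] Py.
  by case/hasP: Hs; exists y.
have [/andP[Pa Hle]|Hna] := boolP (P a && (f a <= f x)).
  exists a; split=> //; first by rewrite mem_head.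
  move=> y; rewrite inE => /orP[/eqP-> //|Hy] Py.
  by apply: leq_trans Hle (Hmin _ Hy Py).
exists x; split=> //; first by rewrite inE Hx orbT.
move=> y; rewrite inE => /orP[/eqP->|Hy] Py; last exact: Hmin.
by move: Hna; rewrite Py /= -ltnNge => /ltnW.
Qed.

Section Scheduling.
Variable I : instance.
Hypothesis HI : valid I.
Variables (C : pred nat) (B : rel nat).
Notation nt := (ntasks I).
Notation tasks := (iota 0 nt).
Notation alpha := (nth 0 (i_alpha I)).

Definition pickable (D : pred nat) (a v : nat) : bool :=
  [&& ~~ D v, alpha v == a, all (fun u => prec I u v ==> D u) tasks
    & C v ==> all (fun u => (C u && B u v) ==> D u) tasks].

(* [c] lies at or after the first vertex cover task that [u] must not follow. *)
Definition deadline (u c : nat) : bool :=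
  C c && has (fun c' => [&& C c', (u == c') || prec I u c' & (c' == c) || B c' c]) tasks.

Definition good (D : pred nat) (a v : nat) : bool :=
  pickable D a v &&
  all (fun u => pickable D a u ==> all (fun c => deadline u c ==> deadline v c) tasks) tasks.

Definition pick1 (D : pred nat) (a : nat) : nat := find (good D a) tasks.

(** If no task is suitable, [find] returns [nt], which is not a task. Position [nt] is then set for
    good and serves as the failure flag of the schedule. *)
Definition step1 (D : pred nat) (a : nat) : pred nat :=
  fun t => if t == pick1 D a then true else D t.

Definition schedule (p : seq nat) : pred nat := foldl step1 (fun=> false) p.

Lemma prec_lt a b : prec I a b -> a < nt /\ b < nt.
Proof.
have [_ _ _ _ [/allP H _]] := HI.
by move=> /H /andP[].
Qed.

Lemma mem_tasks x : (x \in tasks) = (x < nt).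
Proof. by rewrite mem_iota add0n. Qed.

Lemma schedule_rcons p a : schedule (rcons p a) = step1 (schedule p) a.
Proof. by rewrite /schedule -cats1 foldl_cat. Qed.

Lemma pick1_ge D a : nt <= pick1 D a -> pick1 D a = nt.
Proof.
move=> H; apply/eqP; rewrite eqn_leq H andbT.
by have := find_size (good D a) tasks; rewrite size_iota.
Qed.

Lemma pick1_good D a : pick1 D a < nt -> good D a (pick1 D a).
Proof.
move=> H; have Hh : has (good D a) tasks by rewrite has_find size_iota.
by have := nth_find 0 Hh; rewrite nth_iota.
Qed.

(** Each pick has all its predecessors among the earlier picks, so the picks in their order respect
    [prec] whatever was guessed: a wrong guess can fail but not mislead. *)
Lemma schedule_sound p : ~~ schedule p nt ->
  exists ts, [/\ uniq ts, all (fun t => t < nt) ts, map alpha ts = p,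
    forall t, t < nt -> schedule p t = (t \in ts) &
    forall a b, b \in ts -> prec I a b -> index a ts < index b ts].
Proof.
elim/last_ind: p => [|p a IH]; first by exists [::].
rewrite schedule_rcons {1}/step1; case: eqP => // Hn /IH [ts [Hu Hlt Hm HD Ho]].
have Hv : pick1 (schedule p) a < nt.
  by rewrite ltnNge; apply/negP => /pick1_ge E; rewrite E in Hn.
have /andP[/and4P[Hv1 /eqP Hv2 /allP Hv3 _] _] := pick1_good Hv.
set v := pick1 _ a in Hv Hv1 Hv2 Hv3 *.
have Hvts : v \notin ts by rewrite -HD.
exists (rcons ts v); split.
- by rewrite rcons_uniq Hvts.
- by rewrite all_rcons Hv.
- by rewrite map_rcons Hm Hv2.
- by move=> t Ht; rewrite /step1 mem_rcons inE -/v; case: eqP => //= _; apply: HD.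
move=> x y; rewrite mem_rcons inE -cats1 !index_cat => Hy Hp.
have [Hx _] := prec_lt Hp.
case: (boolP (y \in ts)) Hy => [Hyts _|Hyts].
  have Hi := Ho _ _ Hyts Hp.
  have Hxts : x \in ts by rewrite -index_mem; apply: leq_trans Hi (index_size _ _).
  by rewrite Hxts.
rewrite orbF => /eqP Ey; rewrite Ey in Hp *.
have Hxts : x \in ts by rewrite -HD //; have := Hv3 x; rewrite mem_tasks Hp; apply.
by rewrite Hxts /= eqxx addn0 index_mem.
Qed.

Lemma schedule_linearization : size (i_plan I) = nt -> ~~ schedule (i_plan I) nt ->
  exists ts, linearization I ts /\ map alpha ts = i_plan I.
Proof.
move=> Hs /schedule_sound [ts [Hu Hlt Hm _ Ho]]; exists ts; split=> //.
have Hsz : size ts = nt by rewrite -Hs -Hm size_map.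
have Hsub : {subset ts <= tasks} by move=> x /(allP Hlt); rewrite mem_tasks.
have [|_ Heq] := uniq_min_size Hu Hsub; first by rewrite size_iota Hsz.
have Hp : perm_eq ts tasks by apply: uniq_perm => //; rewrite iota_uniq.
split=> // a b Hab; apply: Ho => //.
by have [_ Hb] := prec_lt Hab; rewrite Heq mem_tasks.
Qed.

Hypothesis HC : forall a b, cover I a b -> C a || C b.
Hypothesis Btotal : forall x y, x < nt -> y < nt -> C x -> C y -> x != y -> B x y || B y x.

Definition consistent (ts : seq nat) : Prop :=
  [/\ perm_eq ts tasks, map alpha ts = i_plan I,
      forall a b, prec I a b -> index a ts < index b ts &
      forall x y, x < nt -> y < nt -> C x -> C y -> B x y -> index x ts < index y ts].

(** If [u] and [y] do not form a cover pair, an intermediate task replaces [y]; it comes earlier in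
    [ts], so this terminates. *)
Lemma cover_path ts u y : (forall a b, prec I a b -> index a ts < index b ts) ->
  prec I u y -> exists x, cover I u x && ((x == y) || prec I x y).
Proof.
move=> Ho; have [m] := ubnP (index y ts); elim: m y => // m IH y Hy Hp.
have [Hc|Hnc] := boolP (cover I u y); first by exists y; rewrite Hc eqxx.
have /hasP [c _ /andP[H1 H2]] : has (fun c => prec I u c && prec I c y) tasks.
  by move: Hnc; rewrite /cover Hp negbK.
have [|x /andP[Hx1 Hx2]] := IH c _ H1; first by have := Ho _ _ H2; lia.
exists x; rewrite Hx1 /=; apply/orP; right.
have [_ _ _ _ [_ [_ Htr]]] := HI.
by case/orP: Hx2 => [/eqP->|Hx2] //; apply: Htr Hx2 H2.
Qed.

(** * Exchanging the chosen task with the one in a solution *)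

Section Exchange.
Variables (ts : seq nat) (q : nat).
Hypothesis Hts : consistent ts.
Hypothesis Hq : q < nt.
Variable D : pred nat.
Hypothesis HD : forall t, t < nt -> D t = (t \in take q ts).
Let u := nth 0 ts q.
Let a := alpha u.

Let Hperm : perm_eq ts tasks. Proof. by case: Hts. Qed.
Let Hsize : size ts = nt. Proof. by rewrite (perm_size Hperm) size_iota. Qed.
Let Hu : uniq ts. Proof. by rewrite (perm_uniq Hperm) iota_uniq. Qed.
Let Hmem x : (x \in ts) = (x < nt). Proof. by rewrite (perm_mem Hperm) mem_tasks. Qed.
Let Hprec : forall a b, prec I a b -> index a ts < index b ts. Proof. by case: Hts. Qed.
Let HB : forall x y, x < nt -> y < nt -> C x -> C y -> B x y -> index x ts < index y ts.
Proof. by case: Hts. Qed.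

Lemma take_index x : x < nt -> (x \in take q ts) = (index x ts < q).
Proof. by move=> Hx; rewrite in_take ?Hmem. Qed.

Lemma D_index x : x < nt -> D x = (index x ts < q).
Proof. by move=> Hx; rewrite HD // take_index. Qed.

Lemma u_lt : u < nt. Proof. by rewrite -Hmem mem_nth ?Hsize. Qed.
Lemma u_index : index u ts = q. Proof. by rewrite index_uniq ?Hsize. Qed.

Lemma B_index x y : x < nt -> y < nt -> C x -> C y -> (x == y) || B x y = (index x ts <= index y ts).
Proof.
move=> Hx Hy Cx Cy; case: eqP => [->|/eqP Hn] /=; first by rewrite leqnn.
apply/idP/idP => [Hb|Hi]; first exact: ltnW (HB _ _ _ _ Hb).
have /orP[//|Hb] := Btotal Hx Hy Cx Cy Hn.
by have := HB Hy Hx Cy Cx Hb; lia.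
Qed.

Definition first_cov (x : nat) : nat := find (fun c => C c && ((x == c) || prec I x c)) ts.

(** The machine knows the relation [B] but not the positions in [ts]. Totality of [B] on [C] turns
    the one into the other; the deadline sets of two tasks are therefore nested, and [good] selects
    a minimal [first_cov]. *)
Lemma deadline_first x c : c < nt -> deadline x c = C c && (first_cov x <= index c ts).
Proof.
move=> Hc; rewrite /deadline; case Cc: (C c) => //=.
apply/hasP/idP => [[c']|Hle].
  rewrite mem_tasks => Hc' /and3P[Cc' Hx Hb]; rewrite B_index // in Hb.
  by apply: leq_trans Hb; apply: index_find; rewrite ?Hmem ?Cc'.
have Hlt : first_cov x < size ts by apply: leq_ltn_trans Hle _; rewrite index_mem Hmem.
have Hh : has (fun c => C c && ((x == c) || prec I x c)) ts by rewrite has_find.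
have /andP[Cn Hn] := nth_find 0 Hh.
have Hnl : nth 0 ts (first_cov x) < nt by rewrite -Hmem mem_nth.
exists (nth 0 ts (first_cov x)); first by rewrite mem_tasks.
by rewrite Cn Hn /= B_index // index_uniq.
Qed.

Lemma u_pickable : pickable D a u.
Proof.
have Hul := u_lt; have Hui := u_index.
apply/and4P; split=> //.
- by rewrite D_index // Hui ltnn.
- apply/allP => x _; apply/implyP => Hp; have [Hx _] := prec_lt Hp.
  by rewrite D_index // -Hui; apply: Hprec.
- apply/implyP => Cu; apply/allP => x; rewrite mem_tasks => Hx.
  by apply/implyP => /andP[Cx Hb]; rewrite D_index // -Hui; apply: HB.
Qed.

(** The task [u] of the solution is itself pickable, so a pickable task with minimal [first_cov]
    exists. *)
Lemma pick1_lt : pick1 D a < nt.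
Proof.
rewrite -[nt in _ < nt](size_iota 0) -has_find.
have Hh : has (pickable D a) tasks.
  by apply/hasP; exists u; [rewrite mem_tasks u_lt | exact: u_pickable].
have [v [Hv Pv Hmin]] := exists_min first_cov Hh.
apply/hasP; exists v => //; rewrite /good Pv /=.
apply/allP => x Hx; apply/implyP => Px; apply/allP => c; rewrite mem_tasks => Hc.
apply/implyP; rewrite !deadline_first // => /andP[-> Hle] /=.
exact: leq_trans (Hmin _ Hx Px) Hle.
Qed.

Let v := pick1 D a.
Let Hv : v < nt. Proof. exact: pick1_lt. Qed.

Lemma v_index : q <= index v ts.
Proof.
have /andP[/and4P[Hv1 _ _ _] _] := pick1_good pick1_lt.
by rewrite leqNgt -D_index.
Qed.

Definition swap (t : nat) : nat := if t == u then v else if t == v then u else t.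

Lemma swapK : involutive swap.
Proof.
move=> t; rewrite /swap; case: (t =P u) => [->|Hu'].
  by rewrite eqxx; case: eqP => // ->.
case: (t =P v) => [->|Hv']; first by rewrite eqxx.
by case: eqP => // _; case: eqP.
Qed.

Lemma index_swap t : index t (map swap ts) = index (swap t) ts.
Proof. by rewrite -{1}(swapK t) index_map //; apply: inv_inj swapK. Qed.

(* A successor [y] of [u] is reached through a vertex cover task; since [v] has the earlier
   deadline, that task follows [v]. *)
Lemma late_successor y : prec I u y \/ [/\ y < nt, C u, C y & B u y] -> u <> v ->
  y <> v -> index v ts < index y ts.
Proof.
move=> Hy Huv Hyv; have /andP[Hpv /allP Hgood] := pick1_good pick1_lt.
have Hgu c : c < nt -> deadline u c -> deadline v c.
  move=> Hc; have := Hgood u; rewrite mem_tasks u_lt u_pickable => /(_ isT) /allP.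
  by move=> /(_ c); rewrite mem_tasks Hc => /(_ isT) /implyP.
have Hiv : forall c, c < nt -> deadline v c -> index v ts <= index c ts.
  move=> c Hc /andP[Cc /hasP [c']]; rewrite mem_tasks => Hc' /and3P[Cc' Hx Hb].
  rewrite B_index // in Hb; apply: leq_trans Hb.
  by case/orP: Hx => [/eqP->|/Hprec/ltnW].
have Hvq : index v ts != q.
  apply/eqP => E; apply: Huv; rewrite -[v](nth_index 0 (s := ts)) ?Hmem // E //.
(* A task of [C] is its own deadline; [v] would have to be placed no later than [u], contradicting
   that it comes strictly after position [q]. *)
have HnC : ~~ C u.
  apply/negP => Cu; have : deadline u u by rewrite deadline_first ?u_lt // Cu index_find ?Hmem ?u_lt // Cu eqxx.
  move=> /(Hgu _ u_lt) /(Hiv _ u_lt); rewrite u_index.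
  by have := v_index; lia.
have Hp : prec I u y by case: Hy => // -[_ Cu]; rewrite Cu in HnC.
have [x /andP[Hcov Hxy]] := cover_path Hprec Hp.
have Cx : C x by have := HC Hcov; rewrite (negbTE HnC).
have Hux : prec I u x by case/andP: Hcov.
have [_ Hx] := prec_lt Hux.
have Hdx : deadline u x by rewrite deadline_first // Cx index_find ?Hmem // Cx Hux orbT.
have Hvx := Hiv _ Hx (Hgu _ Hx Hdx).
have [_ Hyn] := prec_lt Hp.
have Hle : index v ts <= index y ts.
  by apply: leq_trans Hvx _; case/orP: Hxy => [/eqP->|/Hprec/ltnW].
rewrite ltn_neqAle Hle andbT; apply/eqP => E; apply: Hyv.
by rewrite -[y](nth_index 0 (s := ts)) ?Hmem // -E nth_index ?Hmem.
Qed.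

Lemma early_predecessor x : x < nt -> prec I x v \/ [/\ C x, C v & B x v] -> index x ts < q.
Proof.
move=> Hx Hxv; have /andP[/and4P[_ _ /allP H1 H2] _] := pick1_good pick1_lt.
rewrite -D_index //; case: Hxv => [Hp|[Cx Cv Hb]].
  by have := H1 x; rewrite mem_tasks Hp; apply.
have /allP := implyP H2 Cv => /(_ x); rewrite mem_tasks Hx => /(_ isT) /implyP.
by apply; rewrite Cx.
Qed.

(** Only two situations are critical: tasks after [u] must come after the old position of [v], and
    tasks before [v] must come before position [q]. *)
Lemma swap_order x y : x < nt -> y < nt ->
  prec I x y \/ [/\ C x, C y & B x y] -> index (swap x) ts < index (swap y) ts.
Proof.
move=> Hx Hy Hxy.
have Hlt : index x ts < index y ts by case: Hxy => [/Hprec //|[Cx Cy]]; apply: HB.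
have [Euv|Huv] := eqVneq u v.
  have id t : swap t = t by rewrite /swap -Euv; case: eqP.
  by rewrite !id.
have Hqv : q <= index v ts := v_index.
rewrite /swap; case: (x =P u) => [Ex|Hxu].
  case: (y =P u) => [Ey|_]; first by move: Hlt; rewrite Ex Ey ltnn.
  case: (y =P v) => [Ey|Hyv].
    have := @early_predecessor x Hx; rewrite Ex u_index -Ey -Ex => /(_ Hxy); lia.
  rewrite Ex in Hxy; apply: late_successor => //; last exact/eqP.
  by case: Hxy => [|[h1 h2 h3]]; [left | right].
case: (x =P v) => [Ex|Hxv].
  case: (y =P u) => [Ey|_]; first by move: Hlt; rewrite Ex Ey u_index; lia.
  case: (y =P v) => [Ey|Hyv]; first by move: Hlt; rewrite Ex Ey ltnn.
  by rewrite u_index; apply: leq_ltn_trans Hqv _; rewrite -Ex.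
case: (y =P u) => [Ey|Hyu].
  by apply: leq_trans Hqv; rewrite -u_index -Ey.
case: (y =P v) => [Ey|Hyv] //.
by rewrite u_index; apply: early_predecessor => //; rewrite -Ey.
Qed.

Lemma swap_consistent : consistent (map swap ts).
Proof.
have [_ Hm _ _] := Hts.
have /andP[/and4P[_ /eqP Hav _ _] _] := pick1_good pick1_lt.
split.
- apply: uniq_perm; rewrite ?iota_uniq ?map_inj_uniq //; first exact: inv_inj swapK.
  move=> t; rewrite -[t]swapK mem_map; last exact: inv_inj swapK.
  rewrite Hmem mem_tasks swapK /swap; case: (t =P u) => [->|_]; first by rewrite Hv u_lt.
  by case: (t =P v) => [->|]; rewrite ?Hv ?u_lt.
- rewrite -Hm -map_comp; apply: eq_map => t /=; rewrite /swap.
  case: (t =P u) => [->|_]; first by rewrite Hav.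
  by case: (t =P v) => [->|//]; rewrite Hav.
- move=> x y Hp; have [Hx Hy] := prec_lt Hp.
  by rewrite !index_swap; apply: swap_order => //; left.
- by move=> x y Hx Hy Cx Cy Hb; rewrite !index_swap; apply: swap_order => //; right.
Qed.

Lemma swap_take t : t < nt -> step1 D a t = (t \in take q.+1 (map swap ts)).
Proof.
move=> Ht; rewrite in_take; last first.
  by rewrite -[t]swapK mem_map ?Hmem; [rewrite /swap; case: eqP; [|case: eqP] => *; rewrite ?u_lt | exact: inv_inj swapK].
rewrite index_swap /step1 -/v ltnS D_index // /swap.
case: (t =P v) => [->|Htv].
  by case: eqP => [E|_]; rewrite ?eqxx; [rewrite E u_index leqnn | rewrite u_index leqnn].
case: (t =P u) => [Etu|Htu].
  rewrite Etu u_index ltnn; apply/esym/negbTE; rewrite -ltnNge ltn_neqAle v_index andbT.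
  apply/eqP => E; apply: Htv; rewrite Etu -[v](nth_index 0 (s := ts)) ?Hmem // -E //.
rewrite [RHS]leq_eqVlt; case: (index t ts =P q) => //= E; case: Htu.
by rewrite /u -E nth_index ?Hmem.
Qed.

End Exchange.

(** Invariant: after [q] picks the scheduled set consists of the first [q] tasks of some consistent
    order. Each pick that differs from that order is repaired by one swap. *)
Lemma schedule_complete ts : consistent ts -> ~~ schedule (i_plan I) nt.
Proof.
move=> Hts.
have Hsz : size (i_plan I) = nt.
  by case: Hts => Hp <- _ _; rewrite size_map (perm_size Hp) size_iota.
suff H q : q <= nt -> exists2 ts', consistent ts' &
    ~~ schedule (take q (i_plan I)) nt /\
    forall t, t < nt -> schedule (take q (i_plan I)) t = (t \in take q ts').
  by have [ts' _ [H1 _]] := H nt (leqnn _); rewrite -Hsz take_size in H1; rewrite -Hsz.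
elim: q => [_|q IH Hq]; first by exists ts => //; rewrite !take0; split.
have [ts' Hts' [Hn HD]] := IH (ltnW Hq).
have Hpq : take q.+1 (i_plan I) = rcons (take q (i_plan I)) (alpha (nth 0 ts' q)).
  rewrite (take_nth 0) ?Hsz //; congr rcons; case: Hts' => Hp <- _ _.
  by rewrite (nth_map 0) // (perm_size Hp) size_iota.
exists (map (swap ts' q (schedule (take q (i_plan I)))) ts').
  exact: swap_consistent.
rewrite Hpq schedule_rcons; split; last by move=> t Ht; apply: swap_take.
rewrite /step1; case: eqP => // E.
by have := pick1_lt Hts' Hq HD; rewrite -E ltnn.
Qed.

End Scheduling.

(** * The verification algorithm *)

Lemma foldl_iota_ind (T : Type) (P : nat -> T -> Prop) (f : T -> nat -> T) N A :
  P 0 A -> (forall x A', x < N -> P x A' -> P x.+1 (f A' x)) -> P N (foldl f A (iota 0 N)).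
Proof.
move=> H0 Hs; suff H k : k <= N -> P k (foldl f A (iota 0 k)) by apply: H.
elim: k => // k IH Hk; rewrite -[in iota _ _]addn1 iotaD foldl_cat /= add0n.
by apply: Hs => //; apply: IH; apply: ltnW.
Qed.

(** Expresses a search by counting the indices up to which it has not succeeded; [pick1E] has this
    form because expressions offer sums only. *)
Lemma count_find (P : pred nat) m :
  count (fun v => all (fun u => ~~ P u) (iota 0 v.+1)) (iota 0 m) = find P (iota 0 m).
Proof.
rewrite -[RHS](minn_idPl _ : minn (find P (iota 0 m)) m = _); last first.
  by rewrite -{2}(size_iota 0 m) find_size.
rewrite -count_ltn_iota; apply: eq_in_count => v; rewrite mem_iota add0n => /andP[_ Hv].
apply/allP/idP => [H|Hf u].
  rewrite ltnNge; apply/negP => Hle.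
  have Hh : has P (iota 0 m) by rewrite has_find size_iota; apply: leq_ltn_trans Hle Hv.
  have := nth_find 0 Hh; have := Hh; rewrite has_find size_iota => Hfm.
  rewrite nth_iota // add0n => Hp; have := H (find P (iota 0 m)).
  by rewrite mem_iota Hp; lia.
rewrite mem_iota add0n => /andP[_ Hu].
have Hlt : u < find P (iota 0 m) by lia.
have := before_find 0 Hlt; rewrite nth_iota; last by lia.
by rewrite add0n => ->.
Qed.

Lemma guess_exists (P : nat -> bool) L : exists2 x, x < 2 ^ L &
  forall i, i < L -> odd (iter i half x) = P i.
Proof.
elim: L P => [|L IH] P; first by exists 0.
have [x Hx Hi] := IH (fun i => P i.+1).
exists (P 0 + x.*2); first by rewrite expnS; case: (P 0); lia.
case=> [|i] Hil; first by rewrite /=; lia.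
by rewrite iterSr half_bit_double Hi.
Qed.

Definition endpoints (M : seq (nat * nat)) := flatten [seq [:: e.1; e.2] | e <- M].

Lemma size_endpoints M : size (endpoints M) = (size M).*2.
Proof. by elim: M => //= e M; rewrite /endpoints /= => ->. Qed.

(** Select from each edge an endpoint in [X]; the edges are disjoint, so the selected endpoints are
    distinct. *)
Lemma matching_le_cover (T : eqType) (M : seq (nat * nat)) (X : seq nat) :
  uniq (endpoints M) -> all (fun e => (e.1 \in X) || (e.2 \in X)) M -> size M <= size X.
Proof.
move=> Hu Hc; pose f (e : nat * nat) := if e.1 \in X then e.1 else e.2.
have Hsub (M' : seq (nat * nat)) : {subset map f M' <= endpoints M'}.
  elim: M' => //= e M' IH x; rewrite /endpoints /= !inE => /orP[/eqP->|/IH ->].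
    by rewrite /f; case: ifP; rewrite eqxx ?orbT.
  by rewrite !orbT.
rewrite -(size_map f); apply: uniq_leq_size.
  elim: M Hu {Hc} => // e M IH; rewrite {1}/endpoints [flatten _]/= -/(endpoints M) => /and3P[H1 H2 /IH H3].
  rewrite /= H3 andbT; apply/negP => /Hsub; rewrite /f.
  by case: ifP => _ H; move: H1 H2; rewrite !inE ?H ?orbT.
move=> x /mapP [e He ->]; have := allP Hc _ He; rewrite /f.
by case: ifP.
Qed.

Definition mE := Sum ntE (Rd 1 (V 0)).
Definition idxE a := Ap (Sum (V 0) (Rd 1 (V 0))) [:: a].
(** Repeated halving never exceeds [x], so the cap [x + 1] has no effect. *)
Definition bitE x i := Ap (oddE (Fold (V 1) (Sc (V 0)) (V 0) (halfE (V 0)))) [:: x; i].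
Definition beforeE x c c' :=
  Ap (bitE (V 0) (addE (mulE (idxE (V 1)) mE) (idxE (V 2)))) [:: x; c; c'].
Definition pickE v a x :=
  Ap (andE (notE (Rd 2 (V 0)))
     (andE (eqE (alphaE (V 0)) (V 1))
     (andE (allE ntE (impE (precE (V 0) (V 1)) (Rd 2 (V 0))))
           (impE (Rd 1 (V 0))
              (allE ntE (impE (andE (Rd 1 (V 0)) (beforeE (V 3) (V 0) (V 1))) (Rd 2 (V 0))))))))
     [:: v; a; x].
Definition deadlineE u c x :=
  Ap (andE (Rd 1 (V 1))
     (exE ntE (andE (Rd 1 (V 0))
              (andE (orE (eqE (V 1) (V 0)) (precE (V 1) (V 0)))
                    (orE (eqE (V 0) (V 2)) (beforeE (V 3) (V 0) (V 2)))))))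
     [:: u; c; x].
Definition goodE v a x :=
  Ap (andE (pickE (V 0) (V 1) (V 2))
     (allE ntE (impE (pickE (V 0) (V 2) (V 3))
        (allE ntE (impE (deadlineE (V 1) (V 0) (V 4)) (deadlineE (V 2) (V 0) (V 4)))))))
     [:: v; a; x].
Definition pick1E a x :=
  Ap (Sum ntE (allE (Sc (V 0)) (notE (goodE (V 0) (V 2) (V 3))))) [:: a; x].

(* Track 1 holds a maximal matching of the cover graph, track 2 the scheduled tasks,
   position 0 of track 3 whether some guess has succeeded. *)
Definition matchableE :=
  andE (coverE (V 1) (V 0)) (andE (notE (Rd 1 (V 1))) (notE (Rd 1 (V 0)))).
(** A loop with bound 0 or 1 acts as a conditional; its index shifts the two task variables by
    one. *)
Definition matchPairC := Fr matchableE (Sqc (Wr 1 (V 2) oneE) (Wr 1 (V 1) oneE)).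
Definition matchC := Fr ntE (Fr ntE matchPairC).
(** One position more than there are tasks, to clear the failure flag as well. *)
Definition resetC := Fr (Sc ntE) (Wr 2 (V 0) zeroE).
Definition scheduleC := Fr npE (Wr 2 (pick1E (planE (V 0)) (V 1)) oneE).
Definition checkC := Wr 3 zeroE (orE (Rd 3 zeroE) (andE (eqE npE ntE) (notE (Rd 2 ntE)))).
Definition guessC := Fr (Gl true) (Sqc resetC (Sqc scheduleC checkC)).
Definition guessesE := mulE mE mE.
Definition answerE := andE (Rd 3 zeroE) execE.

Lemma semc_Fr n K N c v A : semc n K (Fr N c) v A =
  foldl (fun A x => semc n K c (x :: v) A) A (iota 0 (eval n K A N v)).
Proof. by []. Qed.

Definition rank (C : pred nat) c := count C (iota 0 c).
(* The bits of [x], read as a square matrix indexed by the ranks in [C], encode a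
   relation on the vertex cover. *)
Definition guess (C : pred nat) nt x : rel nat :=
  fun c c' => odd (iter (rank C c * rank C nt + rank C c') half x).

(** * Meaning of the expressions, and the matching phase *)

Section Simulation.
Variable I : instance.
Hypothesis HI : valid I.
Let w := enc I.
Let n := size w.
Notation nt := (ntasks I).
Notation tasks := (iota 0 nt).

Section Expressions.
Variables (K : nat) (A : tracks).
Hypothesis HA : forall p, A 0 p = nth false w p.
Notation ev := (eval n K A).
Notation C := (A 1).
Notation D := (A 2).

Lemma ev_m v : ev mE v = rank C nt.
Proof. by rewrite ev_Sum (ev_nt _ HA) (eq_bigr (fun i => C i : nat)) // sum_pred. Qed.

Lemma ev_idx a v : ev (idxE a) v = rank C (ev a v).
Proof.
by rewrite ev_Ap ev_Sum [map _ _]/= (eq_bigr (fun i => C i : nat)) // sum_pred.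
Qed.

Lemma ev_bit x i v : ev (bitE x i) v = odd (iter (ev i v) half (ev x v)).
Proof.
rewrite ev_Ap ev_odd [map _ _]/= (ev_loop (s := fun t => iter t half (ev x v))) //.
  by move=> t _; rewrite ev_half.
by move=> t _; rewrite ev_Sc ltnS iter_half_le.
Qed.

Lemma ev_before x c c' v : ev (beforeE x c c') v = guess C nt (ev x v) (ev c v) (ev c' v).
Proof. by rewrite ev_Ap ev_bit ev_add ev_mul !ev_idx ev_m. Qed.

Lemma ev_pick v a x u : ev v u < nt ->
  ev (pickE v a x) u = pickable I C (guess C nt (ev x u)) D (ev a u) (ev v u).
Proof.
move=> Hv; rewrite ev_Ap [map _ _]/=; set e := [:: ev v u; ev a u; ev x u].
have Ha : ev (alphaE (V 0)) e = nth 0 (i_alpha I) (ev v u) by apply: ev_alpha.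
rewrite ev_and ev_not ev_Rd !nat_neq0 ev_and ev_eq !nat_neq0 Ha ev_and ev_all !nat_neq0.
rewrite ev_imp ev_Rd ev_all !nat_neq0 !(ev_nt _ HA) /pickable; congr nat_of_bool.
congr [&& _, _, _ & _ ==> _]; apply: eq_all => i.
  by rewrite ev_imp nat_neq0 (ev_prec _ HA HI) ev_Rd !nat_neq0.
by rewrite ev_imp nat_neq0 ev_and !ev_Rd !nat_neq0 ev_before nat_neq0.
Qed.

Lemma ev_deadline a c x u :
  ev (deadlineE a c x) u = deadline I C (guess C nt (ev x u)) (ev a u) (ev c u).
Proof.
rewrite ev_Ap [map _ _]/= ev_and ev_Rd ev_ex !nat_neq0 (ev_nt _ HA); congr nat_of_bool.
rewrite /deadline; congr (_ && _); apply: eq_has => i.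
rewrite ev_and ev_Rd !nat_neq0 ev_and !ev_or !ev_eq (ev_prec _ HA HI) ev_before !nat_neq0.
by [].
Qed.

Lemma ev_good v a x u : ev v u < nt ->
  ev (goodE v a x) u = good I C (guess C nt (ev x u)) D (ev a u) (ev v u).
Proof.
move=> Hv; rewrite ev_Ap [map _ _]/= ev_and ev_pick // ev_all !nat_neq0 (ev_nt _ HA).
congr nat_of_bool; rewrite /good; congr (_ && _); apply: eq_in_all => i.
rewrite mem_tasks => Hi; rewrite ev_imp ev_pick // ev_all !nat_neq0 (ev_nt _ HA).
congr (_ ==> _); apply: eq_all => c.
by rewrite ev_imp !ev_deadline !nat_neq0.
Qed.

Lemma ev_pick1 a x u :
  ev (pick1E a x) u = pick1 I C (guess C nt (ev x u)) D (ev a u).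
Proof.
rewrite ev_Ap ev_Sum [map _ _]/= (ev_nt _ HA) /pick1 -count_find -sum_pred.
apply: eq_big_seq => v; rewrite mem_tasks => Hv; rewrite ev_all; congr nat_of_bool.
apply: eq_in_all => i; rewrite mem_iota add0n [ev _ _]/= ltnS => /andP[_ Hi].
by rewrite ev_not ev_good ?nat_neq0 //; apply: leq_ltn_trans Hi Hv.
Qed.

End Expressions.

Definition matched (A : tracks) : Prop :=
  (forall p, A 0 p = nth false w p) /\ (A 2 = (fun=> false)) /\ (A 3 = (fun=> false)) /\
  exists M, [/\ uniq (endpoints M), all (fun e => cover I e.1 e.2) M &
                forall t, A 1 t = (t \in endpoints M)].

Lemma cover_lt a b : cover I a b -> a < nt /\ b < nt.
Proof. by move=> /andP[/(prec_lt HI)]. Qed.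

Lemma cover_irr a b : cover I a b -> a != b.
Proof.
move=> /andP[H _]; apply/eqP => E; have [_ _ _ _ [_ [Hirr _]]] := HI.
by have := Hirr a; rewrite {2}E H.
Qed.

(** Marks are never removed, so a pair that has been visited stays covered; a cover pair with both
    ends unmarked extends the matching when it is visited. *)
Lemma matchC_ok A : matched A ->
  let A' := semc n 0 matchC [::] A in
  matched A' /\ forall a b, cover I a b -> A' 1 a || A' 1 b.
Proof.
move=> HM; set A' := semc _ _ _ _ _.
pose cov (A : tracks) a b := cover I a b -> A 1 a || A 1 b.
suff [H1 H2] : matched A' /\ forall a, a < nt -> forall b, b < nt -> cov A' a b.
  by split=> // a b Hab; have [Ha Hb] := cover_lt Hab; apply: H2.
have HA := HM.1.
rewrite /A' semc_Fr (ev_nt _ HA).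
apply: (foldl_iota_ind (P := fun k A => matched A /\ forall a, a < k -> forall b, b < nt -> cov A a b)) => //.
move=> a A1 Ha [HM1 Hc1]; rewrite semc_Fr (ev_nt _ HM1.1).
suff [h1 h2 h3] : [/\ matched (foldl (fun A x => semc n 0 matchPairC [:: x; a] A) A1 tasks),
  forall t, A1 1 t -> foldl (fun A x => semc n 0 matchPairC [:: x; a] A) A1 tasks 1 t
  & forall b, b < nt -> cov (foldl (fun A x => semc n 0 matchPairC [:: x; a] A) A1 tasks) a b].
  split=> // a' Ha' b Hb; have [Ea|Na] := eqVneq a' a; first by rewrite Ea; apply: h3.
  move=> Hcov; have Hlt : a' < a by rewrite ltn_neqAle Na -ltnS.
  by have /orP[/h2 ->|/h2 ->] := Hc1 a' Hlt b Hb Hcov; rewrite ?orbT.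
apply: (foldl_iota_ind (P := fun k A => [/\ matched A, forall t, A1 1 t -> A 1 t & forall b, b < k -> cov A a b])).
  by split.
move=> b A2 Hb [HM2 Hmono Hc2].
set bb := [&& cover I a b, ~~ A2 1 a & ~~ A2 1 b].
have Ec : eval n 0 A2 matchableE [:: b; a] = bb.
  by rewrite !ev_and (ev_cover _ HM2.1 HI) !ev_not !ev_Rd !nat_neq0.
pose A3 := if bb then setF (setF A2 1 a true) 1 b true else A2.
have -> : semc n 0 matchPairC [:: b; a] A2 = A3.
  by rewrite semc_Fr Ec /A3; case: (bb).
have Hm3 t : A2 1 t -> A3 1 t.
  by rewrite /A3 /setF; case: ifP => // _ H; case: ifP => // _; case: ifP.
split.
- rewrite /A3; case Eb: bb => //; have [h1 [h2 [h3 [M [M1 M2 M3]]]]] := HM2.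
  move: Eb => /and3P[Hcov Na Nb].
  split; [by move=> p; rewrite /setF /= | split; [by rewrite /setF /= -h2 | split; [by rewrite /setF /= -h3|]]].
  exists ((a, b) :: M); split.
  + by rewrite /endpoints /= -/(endpoints M) inE negb_or cover_irr // -!M3 Na Nb M1.
  + by rewrite /= Hcov.
  + move=> t; rewrite /setF /endpoints /= -/(endpoints M) !inE -M3.
    by case: eqP => //= _; rewrite ?orbT //; case: eqP.
- by move=> t /Hmono /Hm3.
- move=> b' Hb' Hcov; have [Eb|Nb] := eqVneq b' b; last first.
    have Hlt : b' < b by rewrite ltn_neqAle Nb -ltnS.
    by have /orP[/Hm3 ->|/Hm3 ->] := Hc2 b' Hlt Hcov; rewrite ?orbT.
  rewrite Eb in Hcov *; rewrite /A3 /bb Hcov /=.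
  case Ha2: (A2 1 a) => /=; first by rewrite Ha2.
  case Hb2: (A2 1 b) => /=; first by rewrite Hb2 orbT.
  by rewrite /setF !eqxx orbT.
Qed.

Lemma rank_vc A : matched A -> rank (A 1) nt <= (vc_number I).*2.
Proof.
move=> [_ [_ [_ [M [M1 M2 M3]]]]].
rewrite /vc_number; case: ex_minnP => k /existsP [X /andP[/eqP HX /forallP Hvc]] _.
have -> : rank (A 1) nt = (size M).*2.
  rewrite -size_endpoints /rank -size_filter; apply: perm_size; apply: uniq_perm => //.
    by rewrite filter_uniq // iota_uniq.
  move=> t; rewrite mem_filter M3 mem_tasks; apply: andb_idr => /flatten_mapP [e He].
  have [h1 h2] := cover_lt (allP M2 _ He).
  by rewrite !inE => /orP[/eqP->|/eqP->].
rewrite leq_double -HX cardE -(size_map val); apply: (matching_le_cover nat M1).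
apply/allP => e He; have Hc := allP M2 _ He; have [h1 h2] := cover_lt Hc.
have /forallP /(_ (Ordinal h2)) := Hvc (Ordinal h1); rewrite /= Hc /=.
case/orP => Hin; apply/orP; [left | right].
  by apply/mapP; exists (Ordinal h1); rewrite ?mem_enum.
by apply/mapP; exists (Ordinal h2); rewrite ?mem_enum.
Qed.

End Simulation.

Lemma semc_Sqc n K c1 c2 v A : semc n K (Sqc c1 c2) v A = semc n K c2 v (semc n K c1 v A).
Proof. by []. Qed.

Lemma semc_Wr n K t e1 e2 v A :
  semc n K (Wr t e1 e2) v A = setF A t (eval n K A e1 v) (eval n K A e2 v != 0).
Proof. by []. Qed.

Lemma setF_same A t q b : setF A t q b t = fun q' => if q' == q then b else A t q'.
Proof. by apply: functional_extensionality => q'; rewrite /setF eqxx. Qed.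

Lemma setF_other A t q b t' : t' != t -> setF A t q b t' = A t'.
Proof.
by move=> /negbTE H; apply: functional_extensionality => q'; rewrite /setF H.
Qed.

Lemma rank_index (C : pred nat) nt c : c < nt -> C c ->
  rank C c = index c (filter C (iota 0 nt)).
Proof.
move=> Hc Cc; rewrite -(subnKC (ltnW Hc)) iotaD filter_cat index_cat add0n.
rewrite mem_filter mem_iota ltnn andbF /rank -size_filter.
by rewrite -(subnSK Hc) /= Cc /= eqxx addn0.
Qed.

(** * The guessing phase and its correctness *)

Section Verification.
Variable I : instance.
Hypothesis HI : valid I.
Let w := enc I.
Let n := size w.
Notation nt := (ntasks I).
Notation tasks := (iota 0 nt).
Notation plan := (i_plan I).

Definition succeeds (C : pred nat) (x : nat) : bool :=
  (size plan == nt) && ~~ schedule I C (guess C nt x) plan nt.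

Section Guess.
Variables (K : nat) (C : pred nat).

(** [resetC] clears positions up to [nt] only; the last clause makes the whole track empty
    afterwards, so that it equals the initial schedule as a function. *)
Definition ready (A : tracks) : Prop :=
  [/\ forall p, A 0 p = nth false w p, A 1 = C & forall t, nt < t -> A 2 t = false].

Lemma resetC_ok x A : ready A -> let A' := semc n K resetC [:: x] A in
  [/\ ready A', A' 3 = A 3 & A' 2 = (fun=> false)].
Proof.
move=> [H0 H1 H2]; rewrite /resetC semc_Fr ev_Sc (ev_nt _ H0); set A' := foldl _ _ _.
have [[h1 h2 h3] h4] : [/\ A' 0 = A 0, A' 1 = A 1 & A' 3 = A 3] /\
    (forall t, A' 2 t = if t < nt.+1 then false else A 2 t).
  rewrite /A'; apply: (foldl_iota_ind (P := fun k A' => [/\ A' 0 = A 0, A' 1 = A 1 & A' 3 = A 3] /\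
    (forall t, A' 2 t = if t < k then false else A 2 t))) => // y A1 Hy [[h1 h2 h3] h4].
  rewrite semc_Wr ev_zero (@setF_other _ 2 _ _ 0) // (@setF_other _ 2 _ _ 1) // (@setF_other _ 2 _ _ 3) //; split=> // t.
  rewrite setF_same ev_V [nth _ _ _]/= h4 ltnS [t <= y]leq_eqVlt.
  by case: eqP.
have E : A' 2 = (fun=> false).
  by apply: functional_extensionality => t; rewrite h4 ltnS; case: leqP => // /H2.
by split=> //; split; rewrite ?h1 ?h2 ?E.
Qed.

Lemma scheduleC_ok x A : ready A -> A 2 = (fun=> false) ->
  let A' := semc n K scheduleC [:: x] A in
  [/\ ready A', A' 3 = A 3 & A' 2 = schedule I C (guess C nt x) plan].
Proof.
move=> [H0 H1 _] H2; rewrite /scheduleC semc_Fr (ev_np _ H0); set A' := foldl _ _ _.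
pose P k A' := [/\ A' 0 = A 0, A' 1 = A 1, A' 3 = A 3,
  A' 2 = schedule I C (guess C nt x) (take k plan) & forall t, nt < t -> A' 2 t = false].
have [h1 h2 h3 h4 h5] : P (size plan) A'.
  apply: foldl_iota_ind; first by rewrite /P take0 H2.
  move=> k A1 Hk [h1 h2 h3 h4 h5].
  have HA1 p : A1 0 p = nth false w p by rewrite h1.
  have Ep : eval n K A1 (pick1E (planE (V 0)) (V 1)) [:: k; x] =
      pick1 I C (guess C nt x) (A1 2) (nth 0 plan k).
    by rewrite (ev_pick1 HI _ HA1) (@ev_plan _ _ _ HA1 HI (V 0)) // h2 H1.
  rewrite semc_Wr Ep ev_one /P setF_same (@setF_other _ 2 _ _ 0) // (@setF_other _ 2 _ _ 1) // (@setF_other _ 2 _ _ 3) //; split=> //.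
    by rewrite (take_nth 0) // schedule_rcons -h4.
  move=> t Ht; case: eqP => [Et|_]; last exact: h5.
  have := find_size (good I C (guess C nt x) (A1 2) (nth 0 plan k)) tasks.
  by rewrite size_iota -/(pick1 I C (guess C nt x) (A1 2) (nth 0 plan k)) -Et leqNgt Ht.
by split=> //; [split=> // [p|]; rewrite ?h1 ?h2 | rewrite h4 take_size].
Qed.

Lemma checkC_ok x A : ready A -> A 2 = schedule I C (guess C nt x) plan ->
  let A' := semc n K checkC [:: x] A in ready A' /\ A' 3 0 = A 3 0 || succeeds C x.
Proof.
move=> [H0 H1 H2] HD; rewrite /checkC semc_Wr; set b := _ != 0.
have Eb : b = A 3 0 || succeeds C x.
  rewrite /b ev_or ev_and ev_eq ev_not !ev_Rd !nat_neq0 ev_zero (ev_np _ H0) (ev_nt _ H0) HD.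
  by [].
by rewrite /ready setF_same (@setF_other _ 3 _ _ 0) // (@setF_other _ 3 _ _ 1) // (@setF_other _ 3 _ _ 2) // ev_zero eqxx Eb.
Qed.

Lemma guessC_ok A : ready A -> A 3 0 = false ->
  let A' := semc n K guessC [::] A in ready A' /\ A' 3 0 = has (succeeds C) (iota 0 K).
Proof.
move=> HA H3; rewrite /guessC semc_Fr ev_Gl.
apply: (foldl_iota_ind (P := fun k A' => ready A' /\ A' 3 0 = has (succeeds C) (iota 0 k))) => //.
move=> x A1 _ [h1 h2]; rewrite !semc_Sqc.
have [r1 e1 d1] := resetC_ok x h1.
have [r2 e2 d2] := scheduleC_ok x r1 d1.
have [r3 e3] := checkC_ok r2 d2.
split=> //; rewrite e3 e2 e1 h2 -[in iota _ _.+1]addn1 iotaD has_cat /= add0n orbF.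
by [].
Qed.

End Guess.

Let A1 := phase1 matchC w.

Lemma phase1_ok : matched I A1 /\ forall a b, cover I a b -> A1 1 a || A1 1 b.
Proof.
apply: (matchC_ok HI); split; [by [] | split; [by [] | split; [by []|]]].
by exists [::].
Qed.

Lemma bigK_bound : bigK matchC guessesE w = 2 ^ (rank (A1 1) nt * rank (A1 1) nt).
Proof.
have [[H0 _] _] := phase1_ok.
by rewrite /bigK /guessesE ev_mul !(ev_m 0 H0).
Qed.

Lemma resultE : (result matchC guessesE guessC answerE w != 0) =
  has (succeeds (A1 1)) (iota 0 (bigK matchC guessesE w)) &&
  executable I (fun x => x \in i_s0 I) plan.
Proof.
have [[H0 [H2 [H3 _]]] _] := phase1_ok.
rewrite /result; set K := bigK _ _ _; set A2 := semc _ _ _ _ _.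
have [[h0 _ _] h3] : ready (A1 1) A2 /\ A2 3 0 = has (succeeds (A1 1)) (iota 0 K).
  by apply: guessC_ok; rewrite -/A1 ?H3 //; split=> // t _; rewrite H2.
by rewrite /answerE ev_and ev_Rd ev_zero (ev_exec _ h0 HI) !nat_neq0 h3.
Qed.

Lemma verification_correct :
  result matchC guessesE guessC answerE w != 0 <-> plan_verification I.
Proof.
have [[_ [_ [_ _]]] HC] := phase1_ok.
rewrite resultE; split.
  move=> /andP[/hasP [x _ /andP[/eqP Hs Hsch]] Hex].
  by have [ts [Hl Hm]] := schedule_linearization HI Hs Hsch; exists ts.
move=> [ts [[Hp Ho] [Hm Hex]]]; rewrite Hex andbT.
pose C := A1 1; pose Cl := filter C tasks; pose m := rank C nt.
(* Entry [i] of the matrix compares the solution's positions of the cover tasks of ranks [i %/ m]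
   and [i %% m], matching how [guess] addresses its bits. *)
pose P i := index (nth 0 Cl (i %/ m)) ts < index (nth 0 Cl (i %% m)) ts.
have [x Hx HP] := guess_exists P (m * m).
have Hg c c' : c < nt -> c' < nt -> C c -> C c' -> guess C nt x c c' = (index c ts < index c' ts).
  move=> Hc Hc' Cc Cc'.
  have Hr y : y < nt -> C y -> rank C y < m /\ nth 0 Cl (rank C y) = y.
    move=> Hy Cy; have Hin : y \in Cl by rewrite mem_filter Cy mem_tasks.
    by rewrite (rank_index Hy Cy) nth_index // /m /rank -size_filter index_mem.
  have [r1 n1] := Hr c Hc Cc; have [r2 n2] := Hr c' Hc' Cc'.
  rewrite /guess -/m HP; last by nia.
  by rewrite /P divnMDl ?modnMDl ?(divn_small r2) ?(modn_small r2) ?addn0 ?n1 ?n2 //; lia.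
apply/hasP; exists x; first by rewrite bigK_bound mem_iota.
rewrite /succeeds; apply/andP; split.
  by rewrite -Hm size_map (perm_size Hp) size_iota.
apply: (schedule_complete HI (C := C) (B := guess C nt x) HC _ (ts := ts)).
  move=> a b Ha Hb Ca Cb Hab; rewrite !Hg // -neq_ltn; apply: contra Hab => /eqP E.
  have Hin y : y < nt -> y \in ts by move=> Hy; rewrite (perm_mem Hp) mem_tasks.
  by rewrite -[a](nth_index 0 (Hin _ Ha)) E nth_index ?Hin.
by split=> // a b Ha Hb Ca Cb; rewrite Hg.
Qed.

Lemma bigK_le : bigK matchC guessesE w <= 2 ^ (4 * (vc_number I * vc_number I)).
Proof.
have [HM _] := phase1_ok.
have H := rank_vc HI HM; rewrite bigK_bound leq_exp2l //; nia.
Qed.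

End Verification.

(** * Computability of the parameter-dependent factor *)

Definition inputE := Fold (Gl false) (Gl true) zeroE
  (addE (addE (V 0) (V 0)) (Rd 0 (subE (Gl false) (Sc (V 1))))).
Definition growthE c := mulE (litE c) (addE (litE 2) (mulE (litE 4) (mulE inputE inputE))).

Lemma lt_exp_bin k : k < 2 ^ size (bin k).
Proof.
elim/ltn_ind: k => k IH; case: (posnP k) => [->|Hk] //.
rewrite bin_rec // [size _]/= expnS; have := IH k./2 ltac:(lia); lia.
Qed.

(** The number [k] may be exponential in the length of its expansion, so the cap has to be the
    second global constant, here two to that length and thus larger than [k]. *)
Lemma ev_input k A : (forall p, A 0 p = nth false (bin k) p) ->
  eval (size (bin k)) (2 ^ size (bin k)) A inputE [::] = k.
Proof.
move=> HA; rewrite (ev_loop (s := fun t => iter (size (bin k) - t) half k)).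
- by rewrite ev_Gl subnn.
- by rewrite subn0 iter_half_bin.
- rewrite ev_Gl => t Ht; rewrite !ev_add ev_Rd ev_sub ev_Sc ev_Gl !ev_V [nth _ _ 0]/= [nth _ _ 1]/=.
  rewrite HA nth_bin (_ : size (bin k) - t = (size (bin k) - t.+1).+1); last lia.
  by rewrite iterS addnn addnC odd_double_half.
- move=> t _; rewrite ev_Gl; apply: leq_ltn_trans (iter_half_le _ _) (lt_exp_bin k).
Qed.

Lemma ok_litE d c : okE d (litE c).
Proof. by elim: c. Qed.

Lemma growth_computable c :
  exists2 w, 0 < w & computable (fun k => 2 ^ (w * (c * (2 + 4 * (k * k))))).
Proof.
apply: (@computable_exp2 1 (growthE c)) => //.
  by rewrite /growthE /mulE /= ok_litE; vm_compute.
move=> k; rewrite /result /bigK; set A2 := semc _ _ _ _ _.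
have HA p : A2 0 p = nth false (bin k) p by [].
by rewrite /growthE ev_mul ev_lit ev_add ev_lit ev_mul ev_lit ev_mul (ev_input HA).
Qed.

Theorem theorem9 :
  exists (f : nat -> nat) (c : nat) (M : TM),
    computable f /\ wf_tm M /\
    forall I : instance, valid I ->
      decides_within M (enc I) (f (vc_number I) * (size (enc I)).+1 ^ c)
        (plan_verification I).
Proof.
have [||||M [c [HM Hdec]]] := @decider 4 matchC guessesE guessC answerE isT.
1-4: by vm_compute.
have [w w0 Hf] := growth_computable c.
exists (fun k => 2 ^ (w * (c * (2 + 4 * (k * k))))), c, M; split=> //; split=> // I HI.
set k := vc_number I; set n := size (enc I).
have Ht : (n + bigK matchC guessesE (enc I)).+2 ^ c <= 2 ^ (w * (c * (2 + 4 * (k * k)))) * n.+1 ^ c.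
  have HK := bigK_le HI; rewrite -/k in HK.
  set Q := 2 ^ (4 * (k * k)) in HK.
  have HQ : 0 < Q by rewrite expn_gt0.
  (* Here [4 * Q] is [2 ^ (2 + 4 * (k * k))], which explains the exponent computed by [growthE]; the
     factor [w], being positive, only enlarges the bound. *)
  have h : (n + bigK matchC guessesE (enc I)).+2 <= 4 * Q * n.+1 by nia.
  apply: (@leq_trans ((4 * Q * n.+1) ^ c)).
    by case: (c) => // c'; rewrite leq_exp2r.
  rewrite expnMn leq_mul2r; apply/orP; right.
  rewrite (_ : 4 * Q = 2 ^ (2 + 4 * (k * k))); last by rewrite expnD.
  by rewrite -expnM leq_exp2l // mulnC; nia.
have [Hh Ha] := Hdec _ _ Ht.
split=> //; rewrite Ha; exact: verification_correct.
Qed.
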